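(* Let $\ell$ be a non-atomic $\sigma$-finite measure on $\mathbb R$, and let $F:\mathbb R\to(-\infty,\infty]$ and $G:\mathbb R\times\mathbb R\to(-\infty,\infty]$ satisfy: 1. $F$ and $G$ are lower semicontinuous on the respective sets on which they are finite; 2. there exist $a\in[0,1)$ and $c\in\mathbb R$ such that $\int_{\mathbb R}e^{-(1-a)F(x)}\ell(dx)<\infty$, $\inf_xF(x)>c$, and $\inf_{(x,y)}[G(x,y)+a(F(x)+F(y))]>c$; 3. there is a Borel set $A\subset\mathbb R$ with $\ell(A)>0$ such that $\int_{A\times A}[F(x)+F(y)+G(x,y)]\,\ell(dx)\ell(dy)<\infty$; 4. for all $\lambda\in\mathbb R$, $\int_{\mathbb R\times\mathbb R}\exp[\lambda(x^2+y^2)-F(x)-F(y)-G(x,y)]\,\ell(dx)\ell(dy)<\infty$. For $n\in\mathbb N$ let $$\mathbf H_n(x)=\frac1n\sum_{i=1}^nF(x_i)+\frac1{2n^2}\sum_{i=1}^n\sum_{j\ne i}G(x_i,x_j),\qquad x\in\mathbb R^n,$$ and let $X^{(n)}$ be distributed according to the probability measure $P_n(dx)=Z_n^{-1}e^{-n\mathbf H_n(x)}\ell^{\otimes n}(dx)$ on $\mathbb R^n$, where $Z_n=\int_{\mathbb R^n}e^{-n\mathbf H_n}d\ell^{\otimes n}$. Then $\{\|X^{(n)}\|_2/\sqrt n\}_{n\in\mathbb N}$ satisfies an LDP at speed $n$ with GRF $$J_X(x)=\inf\left\{\mathcal I_*(\mu):\mu\in\mathcal P_2(\mathbb R),\ x=\sqrt{M_2(\mu)}\right\},\qquad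 x\ge0,$$ where $\mathcal I_*(\mu)=\mathcal I(\mu)-\inf_{\nu\in\mathcal P_2(\mathbb R)}\mathcal I(\nu)$ and $$\mathcal I(\mu)=H(\mu|\ell)+\frac12\int_{\mathbb R\times\mathbb R}G(x,y)\,\mu(dx)\mu(dy)+\int_{\mathbb R}F(x)\,\mu(dx).$$
   Context: $\mathcal P_2(\mathbb R)$: Borel probability measures on $\mathbb R$ with finite second moment; $M_2(\mu)=\int x^2\mu(dx)$. $H(\mu|\ell)=\int\log(d\mu/d\ell)\,d\mu$ if $\mu\ll\ell$, $+\infty$ otherwise. To avoid expressions of the form $\infty-\infty$, $\mathcal I(\mu)$ is understood as the (well-defined, $(-\infty,\infty]$-valued) combined expression $H(\mu|e^{-(1-a)F}\ell)+\frac12\int\int[G(x,y)+aF(x)+aF(y)]\mu(dx)\mu(dy)$, which agrees with the displayed sum when all terms are finite. LDP: a sequence of random variables $\{\eta_n\}$ with values in a regular topological space $\mathcal X$ satisfies a large deviation principle (LDP) at speed $s_n$ (positive reals with $s_n\to\infty$) with rate function $I:\mathcal X\to[0,\infty]$ if $I$ is lower semicontinuous and for every Borel set $\Gamma$, $-\inf_{\Gamma^\circ}I\le\liminf_n\frac1{s_n}\log\mathbb P(\eta_n\in\Gamma)\le\limsup_n\frac1{s_n}\log\mathbb P(\eta_n\in\Gamma)\le-\inf_{\bar\Gamma}I$. It is a good rate function (GRF) if moreover its level sets are compact. *)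

(* Defs.v *)
From HB Require Import structures.
From mathcomp Require Import all_boot all_order all_algebra.
From mathcomp Require Import all_classical all_reals all_analysis measurable_realfun.

Set Implicit Arguments.
Unset Strict Implicit.
Unset Printing Implicit Defensive.

Import Order.TTheory GRing.Theory Num.Theory.
Import numFieldNormedType.Exports.

Local Open Scope classical_set_scope.
Local Open Scope ring_scope.
Local Open Scope ereal_scope.

Definition non_atomic d (T : measurableType d) (R : realType)
    (mu : set T -> \bar R) : Prop :=
  forall A, measurable A -> 0 < mu A ->
    exists B, [/\ measurable B, B `<=` A, 0 < mu B & mu B < mu A].

Section tuple_measure.
Context d (T : measurableType d) (R : realType).

Definition cons_pair n (z : T * n.-tuple T) : n.+1.-tuple T :=
  [tuple of z.1 :: z.2].

Lemma measurable_cons_pair n : measurable_fun [set: _] (@cons_pair n).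
Proof. exact: (measurable_cons measurable_fst measurable_snd). Qed.

Section cons_measure.
Variables (n : nat) (m1 : {sigma_finite_measure set T -> \bar R})
  (m2 : {sigma_finite_measure set (n.-tuple T) -> \bar R}).

Definition cons_measure : set (n.+1.-tuple T) -> \bar R :=
  pushforward (m1 \x m2) (@cons_pair n).

Let cons_measure0 : cons_measure set0 = 0.
Proof. by rewrite /cons_measure /pushforward preimage_set0 measure0. Qed.

Let cons_measure_ge0 A : 0 <= cons_measure A.
Proof. by apply: integral_ge0 => x _; exact: measure_ge0. Qed.

Let cons_measure_sigma_additive : semi_sigma_additive cons_measure.
Proof.
have mU (A : set (n.+1.-tuple T)) : measurable A -> measurable (@cons_pair n @^-1` A).
  by move=> mA; rewrite -[X in measurable X]setTI; exact: measurable_cons_pair.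
move=> A mA tA mUA; rewrite /cons_measure /pushforward preimage_bigcup.
apply: measure_semi_sigma_additive.
- by move=> k; exact: mU.
- apply/trivIsetP => /= i j _ _ ij; rewrite -preimage_setI.
  by move/trivIsetP : tA => /(_ _ _ _ _ ij) ->//; rewrite preimage_set0.
- by rewrite -preimage_bigcup; exact: mU.
Qed.

HB.instance Definition _ := isMeasure.Build _ _ _ cons_measure
  cons_measure0 cons_measure_ge0 cons_measure_sigma_additive.

Let split_pair (t : n.+1.-tuple T) : T * n.-tuple T :=
  (thead t, [tuple of behead t]).

Let cons_pairK : cancel (@cons_pair n) split_pair.
Proof.
by move=> [x t]; rewrite /split_pair /cons_pair /= /thead tnth0; congr (_, _); exact/val_inj.
Qed.

Let split_pairK : cancel split_pair (@cons_pair n).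
Proof. by move=> t; rewrite [RHS]tuple_eta; apply/val_inj. Qed.

Let measurable_split_pair : measurable_fun [set: _] split_pair.
Proof.
apply: measurable_fun_pair; first exact: measurable_tnth.
exact: measurable_behead.
Qed.

Let cons_measure_sigma_finite : sigma_finite setT cons_measure.
Proof.
have /sigma_finiteP[A [AT ndA Afin]] := sigma_finiteT m1.
have /sigma_finiteP[B [BT ndB Bfin]] := sigma_finiteT m2.
exists (fun k => split_pair @^-1` (A k `*` B k)).
  rewrite -preimage_bigcup -[LHS](preimage_setT split_pair); congr (_ @^-1` _).
  apply/esym; rewrite -subTset => -[x t] _.
  have : [set: T] x by []. rewrite AT => -[i _ Aix].
  have : [set: n.-tuple T] t by []. rewrite BT => -[j _ Bjt].
  exists (maxn i j) => //; split => /=.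
    by move: x Aix; exact/subsetPset/ndA/leq_maxl.
  by move: t Bjt; exact/subsetPset/ndB/leq_maxr.
move=> k; have [mA ?] := Afin k; have [mB ?] := Bfin k; split.
  by rewrite -[X in measurable X]setTI; apply: measurable_split_pair => //; exact: measurableX.
rewrite /cons_measure /pushforward -comp_preimage.
rewrite (_ : _ \o _ = id) ?preimage_id; last by apply/funext => z /=; exact: cons_pairK.
by rewrite product_measure1E// lte_mul_pinfty// ge0_fin_numE.
Qed.

HB.instance Definition _ :=
  Measure_isSigmaFinite.Build _ _ _ cons_measure cons_measure_sigma_finite.

End cons_measure.

Let dirac_nil : {sigma_finite_measure set (0.-tuple T) -> \bar R} :=
  [the {sigma_finite_measure set (0.-tuple T) -> \bar R} of \d_[tuple]].

Fixpoint tuple_measure (mu : {sigma_finite_measure set T -> \bar R}) (n : nat) :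
    {sigma_finite_measure set (n.-tuple T) -> \bar R} :=
  match n with
  | 0 => dirac_nil
  | m.+1 => [the {sigma_finite_measure set (m.+1.-tuple T) -> \bar R} of
      cons_measure mu (tuple_measure mu m)]
  end.

Lemma tuple_measure_box (mu : {sigma_finite_measure set T -> \bar R}) n
    (A : 'I_n -> set T) : (forall i, measurable (A i)) ->
  tuple_measure mu n [set t | forall i, A i (tnth t i)] = \prod_(i < n) mu (A i).
Proof.
elim: n A => [|n IH] A mA.
  by rewrite big_ord0/= diracE mem_set// => -[].
rewrite big_ord_recl -IH => [|i]; last exact: mA.
have mbox : measurable [set t : n.-tuple T | forall i, A (lift ord0 i) (tnth t i)].
  rewrite [X in measurable X](_ : _ =
    \bigcap_(i in [set: 'I_n]) ((fun t => tnth t i) @^-1` A (lift ord0 i))).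
    apply: fin_bigcap_measurable => // i _.
    by rewrite -[X in measurable X]setTI; exact: measurable_tnth.
  by apply/seteqP; split=> [t tA i _|t tA i]; exact: tA.
rewrite -(product_measure1E mu (tuple_measure mu n))//=.
rewrite /cons_measure /pushforward; congr (_ _).
apply/seteqP; split=> [[x t] /= h|[x t] [/= h0 h] i].
  split; first by have := h ord0; rewrite tnth0.
  by move=> i; have := h (lift ord0 i); rewrite tnthS.
have [->|i0] := eqVneq i ord0; first by rewrite tnth0.
case: (unliftP ord0 i) i0 => [j ->|->]; last by rewrite eqxx.
by rewrite tnthS.
Qed.

End tuple_measure.

Section mdensity.
Context d (T : measurableType d) (R : realType).
Variables (mu : {sigma_finite_measure set T -> \bar R}) (h : T -> R).
Hypotheses (mh : measurable_fun [set: T] h) (h0 : forall x, (0 <= h x)%R).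

(* The proofs are arguments so that the measure structure can be inferred. *)
Definition mdensity of measurable_fun [set: T] h & (forall x, (0 <= h x)%R) :=
  fun A : set T => \int[mu]_(x in A) (h x)%:E.

Local Notation nu := (mdensity mh h0).

Let nu0 : nu set0 = 0. Proof. exact: integral_set0. Qed.

Let nu_ge0 A : 0 <= nu A.
Proof. by apply: integral_ge0 => x _; rewrite lee_fin. Qed.

Let nu_sigma_additive : semi_sigma_additive nu.
Proof.
apply: semi_sigma_additive_nng_induced => [|x]; last by rewrite lee_fin.
exact/measurable_EFinP.
Qed.

HB.instance Definition _ :=
  isMeasure.Build _ _ _ nu nu0 nu_ge0 nu_sigma_additive.

Let nu_sigma_finite : sigma_finite setT nu.
Proof.
have /sigma_finiteP[A [AT ndA Afin]] := sigma_finiteT mu.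
have mB k : measurable (A k `&` [set x | (h x <= k%:R)%R]).
  apply: measurableI; first exact: (Afin k).1.
  rewrite -[X in measurable X]setTI (_ : [set x | _] = h @^-1` `]-oo, k%:R]).
    exact: mh.
  by apply/seteqP; split=> x /=; rewrite in_itv.
exists (fun k => A k `&` [set x | (h x <= k%:R)%R]).
  apply/esym; rewrite -subTset => x _.
  have : [set: T] x by [].
  rewrite AT => -[i _ Aix].
  exists (maxn i (Num.truncn (h x)).+1) => //; split.
    by apply: (subsetPset _ _ (ndA _ _ (leq_maxl _ _))).
  rewrite /= (le_trans (ltW (truncnS_gt (h x))))// ler_nat leq_maxr//.
move=> k; split => //.
have mukfin : mu (A k `&` [set x | (h x <= k%:R)%R]) < +oo.
  apply: le_lt_trans (Afin k).2; apply: le_measure; rewrite ?inE//.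
  exact: (Afin k).1.
apply: (@le_lt_trans _ _
  (\int[mu]_(x in A k `&` [set x | (h x <= k%:R)%R]) (k%:R)%:E)).
  apply: ge0_le_integral => //.
  - by move=> x _; rewrite lee_fin.
  - by apply/measurable_funTS/measurable_EFinP.
  - by move=> x [_ /=]; rewrite lee_fin.
by rewrite integral_cst// lte_mul_pinfty// lee_fin.
Qed.

HB.instance Definition _ := Measure_isSigmaFinite.Build _ _ _ nu nu_sigma_finite.

End mdensity.

Definition rel_entropy d (T : measurableType d) (R : realType)
    (mu : probability T R) (nu : {sigma_finite_measure set T -> \bar R}) : \bar R :=
  if `[< mu `<< nu >] then
    \int[mu]_x lne (Radon_Nikodym (charge_of_finite_measure mu) nu x)
  else +oo.

Section ldp.
Context (R : realType) (X : topologicalType).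

Definition borel : set (set X) := <<s open >>.

Definition ldp (d : nat -> measure_display) (Omega : forall n, measurableType (d n))
    (P : forall n, probability (Omega n) R) (eta : forall n, Omega n -> X)
    (s : nat -> R) (I : X -> \bar R) : Prop :=
  [/\ forall n B, borel B -> measurable (eta n @^-1` B),
      (forall n, (0 < s n)%R) /\ s @ \oo --> +oo%R,
      forall x, 0 <= I x,
      lower_semicontinuous I
    & forall B, borel B ->
        let u n := (s n)^-1%:E * lne (P n (eta n @^-1` B)) in
        [/\ - ereal_inf (I @` B°) <= limn_einf u,
            limn_einf u <= limn_esup u
          & limn_esup u <= - ereal_inf (I @` closure B)]].

Definition good_rate (I : X -> \bar R) : Prop :=
  forall r : R, compact [set x | I x <= r%:E].

End ldp.

Section gibbs.
Context (R : realType).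
Variable l : {sigma_finite_measure set R -> \bar R}.
Variables (F : {mfun R >-> \bar R}) (G : {mfun (R * R)%type >-> \bar R}).

Definition energy n (x : n.-tuple R) : \bar R :=
  (n%:R^-1)%:E * (\sum_(i < n) F (tnth x i)) +
  ((2 * n%:R ^+ 2)^-1)%:E *
    (\sum_(i < n) \sum_(j < n | j != i) G (tnth x i, tnth x j)).

Definition partition_function n : \bar R :=
  \int[tuple_measure l n]_x expeR (- (n%:R%:E * energy x)).

Definition gibbs n (B : set (n.-tuple R)) : \bar R :=
  (fine (partition_function n))^-1%:E *
  \int[tuple_measure l n]_(x in B) expeR (- (n%:R%:E * energy x)).

(* The density e^{-(1-a)F}. When [F] avoids [-oo] and [a < 1], [expeR] below is
   finite, so [fine] is harmless; a real-valued density makes [ref_measure]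
   sigma-finite whatever [F] is. *)
Definition ref_density (a : R) (x : R) : R :=
  fine (expeR (- ((1 - a)%:E * F x))).

Lemma measurable_ref_density a : measurable_fun [set: R] (ref_density a).
Proof.
have mf : measurable_fun [set: R] (fun x => - ((1 - a)%:E * F x)).
  by apply: measurableT_comp => //; apply: measurable_funeM.
rewrite (_ : ref_density a = (fun x => if - ((1 - a)%:E * F x) \is a fin_num
    then expR (fine (- ((1 - a)%:E * F x))) else 0%R)); last first.
  by apply/funext => x; rewrite /ref_density; case: (- _).
apply: measurable_fun_ifT => //.
- apply: (measurable_fun_bool true).
  rewrite setTI (_ : _ @^-1` _ = (fun x => - ((1 - a)%:E * F x)) @^-1`
    [set y | y \is a fin_num]); last first.
    by apply/seteqP; split.
  rewrite -[X in measurable X]setTI; apply: mf => //.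
  rewrite (_ : [set y : \bar R | _] = ~` ([set -oo] `|` [set +oo])).
    by apply: measurableC; exact: measurableU.
  by apply/seteqP; split=> -[r||]//=; [move=> _ []|case; right|case; left].
- by apply: measurableT_comp => //; apply: measurableT_comp.
Qed.

Lemma ref_density_ge0 a x : (0 <= ref_density a x)%R.
Proof. by rewrite fine_ge0// expeR_ge0. Qed.

Definition ref_measure (a : R) : {sigma_finite_measure set R -> \bar R} :=
  [the {sigma_finite_measure set R -> \bar R} of
    mdensity l (measurable_ref_density a) (ref_density_ge0 a)].

Definition second_moment (mu : probability R R) : \bar R :=
  \int[mu]_x (x ^+ 2)%:E.

Definition P2 : set (probability R R) := [set mu | second_moment mu < +oo].

(* The form of H(mu|l) + 1/2 \int\int G + \int F that is free of oo - oo. *)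
Definition gibbs_functional (a : R) (mu : probability R R) : \bar R :=
  rel_entropy mu (ref_measure a) +
  (2^-1)%:E * \int[mu \x mu]_z (G z + a%:E * F z.1 + a%:E * F z.2).

Definition gibbs_functional_star (a : R) (mu : probability R R) : \bar R :=
  gibbs_functional a mu - ereal_inf (gibbs_functional a @` P2).

(* [ereal_inf set0 = +oo], so the value is [+oo] on negative reals. *)
Definition norm_rate (a x : R) : \bar R :=
  ereal_inf (gibbs_functional_star a @`
    [set mu | P2 mu /\ x = Num.sqrt (fine (second_moment mu))]).

End gibbs.

Definition scaled_norm (R : realType) n (x : n.-tuple R) : R :=
  Num.sqrt (\sum_(i < n) tnth x i ^+ 2)%R / Num.sqrt n%:R.

(* Main.v *)
(* With [K = G + a F + a F - c >= 0] and the finite measure [nu] of density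
   [e^{-(1-a)F}] with respect to [l], the Gibbs measure is proportional to
   [exp (- (1/2n) sum_{i <> j} K (x_i, x_j) - (1/n) sum_i A (x_i))] times
   [nu^n], where [A = a (F - c) >= 0], and the rate of a law of density [f] is,
   up to a constant, the free energy [int f ln f + 1/2 int int K f f].

   Upper bound. Hoeffding's decoupling (average over permutations and apply
   Jensen) reduces exponential moments of the pair energy to powers of one double
   integral. This lets a bounded kernel be replaced by a step kernel, for which
   the method of types gives the bound; [exp_int] makes [x^2] uniformly integrable
   along densities of bounded free energy and large tails superexponentially
   unlikely. Densities of bounded entropy have limits along ultrafilters, setwise
   and hence, by Radon-Nikodym, as densities; under these limits moments converge
   and the free energy is lower semicontinuous. This removes the truncation of
   [K] and also yields the lower semicontinuity and goodness of the rate.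

   Lower bound. Tilt [nu^n] by the product of a bounded density carried by a set
   where [A] and [x^2] are bounded, and use [e^{-s} >= e^{-t} (1 + t - s)]
   together with Chebyshev's inequality; general densities are approximated by
   such ones. *)

Require Import Defs.
From HB Require Import structures.
From mathcomp Require Import all_boot all_order all_algebra.
From mathcomp Require Import finmap fingroup perm ring lra.
From mathcomp Require Import all_classical all_reals all_analysis measurable_realfun.

Set Implicit Arguments.
Unset Strict Implicit.
Unset Printing Implicit Defensive.

Import Order.TTheory GRing.Theory Num.Theory.
Import numFieldNormedType.Exports.

Local Open Scope classical_set_scope.
Local Open Scope ring_scope.
Local Open Scope ereal_scope.

(** * Integration against product measures *)

(** The square is unbounded, so the norm is not a continuous function of the empirical law, and [K]
    may be unbounded or infinite. The proof therefore estimates the Gibbs weight of moment events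
    directly, with densities as the only competitors.

    Closeness of kernels in L1 says nothing under an unbounded density. Exponential moments repair
    this in two ways: decoupling turns them into bounds under the product measure, and Young's
    inequality turns the same moments into bounds that are uniform over densities of bounded
    entropy. Each approximation in the upper bound uses one or both.

    The mass [nu setT] appears in every exponent because [entropy1] exceeds the entropy by exactly
    this amount. It cancels on division by the partition function, which is itself bounded on both
    sides as the weight of the sure event.

    The term [A] exists because a point has [n - 1] partners, not [n]. It enters with the factor
    [1/n]: the upper bound drops it by positivity, and in the lower bound it costs only a constant
    in the exponent. *)

Section measurable_exp_ln.
Context (R : realType).

Lemma measurable_expeR : measurable_fun [set: \bar R] (@expeR R).
Proof.
rewrite (_ : @expeR R = fun x => if x == +oo then +oo else
    if x == -oo then 0 else (expR (fine x))%:E); last first.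
  by apply/funext; case.
apply: measurable_fun_ifT => //.
  apply: (measurable_fun_bool true); rewrite setTI.
  rewrite (_ : _ @^-1` _ = [set +oo])//.
  by apply/seteqP; split=> x /= /eqP.
apply: measurable_fun_ifT => //.
  apply: (measurable_fun_bool true); rewrite setTI.
  rewrite (_ : _ @^-1` _ = [set -oo])//.
  by apply/seteqP; split=> x /= /eqP.
by apply/measurable_EFinP; apply: measurableT_comp.
Qed.

End measurable_exp_ln.

Lemma emeasurable_sum_cond d (T : measurableType d) (R : realType) (D : set T)
    (I : Type) (s : seq I) (P : pred I) (h : I -> T -> \bar R) :
  (forall i, P i -> measurable_fun D (h i)) ->
  measurable_fun D (fun x => \sum_(i <- s | P i) h i x).
Proof.
move=> mh; under eq_fun do rewrite big_mkcond.
by apply: emeasurable_sum => i; case: (P i) (mh i) => [/(_ isT)//|_].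
Qed.

Section mdensity_integral.
Context d (T : measurableType d) (R : realType).
Variables (mu : {sigma_finite_measure set T -> \bar R}) (h : T -> R).
Hypotheses (mh : measurable_fun [set: T] h) (h0 : forall x, (0 <= h x)%R).

Import HBNNSimple.

(** By monotone convergence along the same simple functions on both sides, it is enough to treat
    indicators, where the identity is the definition of [mdensity]. *)
Lemma ge0_integral_mdensity (f : T -> \bar R) :
  measurable_fun [set: T] f -> (forall x, 0 <= f x) ->
  \int[mdensity mu mh h0]_x f x = \int[mu]_x (f x * (h x)%:E).
Proof.
move=> mf f0.
have mhE : measurable_fun [set: T] (EFin \o h) by exact/measurable_EFinP.
pose g := nnsfun_approx measurableT mf.
have Hlim (m : {measure set T -> \bar R}) : \int[m]_x f x = limn (fun n => \int[m]_x (g n x)%:E) :> \bar R.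
  rewrite -monotone_convergence//.
  - by apply: eq_integral => y _; apply/esym/cvg_lim => //; exact: cvg_nnsfun_approx.
  - by move=> n; exact/measurable_EFinP.
  - by move=> n y _; rewrite lee_fin.
  - by move=> y _ a b ab; rewrite lee_fin; exact/lefP/nd_nnsfun_approx.
rewrite (Hlim (mdensity mu mh h0)).
have -> : \int[mu]_x (f x * (h x)%:E) =
    limn (fun n => \int[mu]_x ((g n x)%:E * (h x)%:E)).
  rewrite -monotone_convergence//.
  - apply: eq_integral => y _; apply/esym/cvg_lim => //.
    by apply: cvgeZr => //; exact: cvg_nnsfun_approx.
  - by move=> n; apply: emeasurable_funM => //; exact/measurable_EFinP.
  - by move=> n y _; rewrite mule_ge0// lee_fin.
  - move=> y _ a b ab; apply: lee_wpmul2r; rewrite lee_fin//.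
    exact/lefP/nd_nnsfun_approx.
apply/congr_lim/funext => n.
have gE x : (g n x)%:E = \sum_(y \in range (g n)) (y * \1_(g n @^-1` [set y]) x)%:E.
  by rewrite /= fimfunE -fsumEFin.
have mind r : measurable_fun [set: T] (fun x => (r * \1_(g n @^-1` [set r]) x)%:E).
  by apply/measurable_EFinP; exact: measurable_funM.
under eq_integral do rewrite gE.
rewrite ge0_integral_fsum//; last by move=> m y _; exact: nnfun_muleindic_ge0.
under [RHS]eq_integral => x _.
  rewrite gE ge0_mule_fsuml => [|y]; last exact: nnfun_muleindic_ge0.
  over.
rewrite ge0_integral_fsum//; last 2 first.
- by move=> y; exact: emeasurable_funM.
- by move=> m y _; apply: mule_ge0; [exact: nnfun_muleindic_ge0|rewrite lee_fin].
apply: eq_fsbigr => r rg.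
rewrite integralZl_indic_nnsfun// integral_indic// setIT.
under [RHS]eq_integral do rewrite EFinM -muleA.
rewrite ge0_integralZl//.
- congr (_ * _); rewrite /= /mdensity integral_mkcond.
  by apply: eq_integral => x _; rewrite epatch_indic muleC.
- by apply: emeasurable_funM => //; exact/measurable_EFinP.
- by move=> x _; rewrite mule_ge0// lee_fin.
- by move: rg; rewrite inE => -[t _ <-]; rewrite lee_fin.
Qed.

End mdensity_integral.

Section tuple_integral.
Context d (T : measurableType d) (R : realType).
Implicit Types mu : {sigma_finite_measure set T -> \bar R}.

Lemma ge0_integral_tuple_measureS mu n (f : n.+1.-tuple T -> \bar R) :
  measurable_fun [set: _] f -> (forall t, 0 <= f t) ->
  \int[tuple_measure mu n.+1]_t f t =
  \int[mu]_x \int[tuple_measure mu n]_t f [tuple of x :: t].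
Proof.
move=> mf f0.
have mc := @measurable_cons_pair _ T n.
transitivity (\int[pushforward (mu \x tuple_measure mu n) (@cons_pair d T n)]_t f t).
  by apply: eq_measure_integral.
rewrite ge0_integral_pushforward//= preimage_setT fubini_tonelli1//.
exact: measurableT_comp.
Qed.

Lemma ge0_integral_tuple_measure0 mu (f : 0.-tuple T -> \bar R) :
  \int[tuple_measure mu 0]_t f t = f [tuple].
Proof.
rewrite integral_dirac//; last first.
  have -> : f = cst (f [tuple]) by apply/funext => t; rewrite tuple0.
  exact: measurable_cst.
by rewrite diracT mul1e.
Qed.

Lemma measurable_tuple_prod n (h : T -> R) : measurable_fun [set: T] h ->
  measurable_fun [set: n.-tuple T] (fun t => (\prod_(i < n) h (tnth t i))%R).
Proof.
move=> mh; apply: measurable_prod => i _.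
by apply: measurableT_comp => //; exact: measurable_tnth.
Qed.

Lemma ge0_integral_tuple_mdensity mu (h : T -> R)
    (mh : measurable_fun [set: T] h) (h0 : forall x, (0 <= h x)%R) n
    (f : n.-tuple T -> \bar R) :
  measurable_fun [set: _] f -> (forall t, 0 <= f t) ->
  \int[tuple_measure (mdensity mu mh h0) n]_t f t =
  \int[tuple_measure mu n]_t (f t * (\prod_(i < n) h (tnth t i))%:E).
Proof.
elim: n f => [|n IH] f mf f0.
  by rewrite !ge0_integral_tuple_measure0 big_ord0 mule1.
have mprod m : measurable_fun [set: m.-tuple T]
    (fun t => (\prod_(i < m) h (tnth t i))%:E).
  by apply/measurable_EFinP; exact: measurable_tuple_prod.
have mfc x : measurable_fun [set: n.-tuple T] (fun t => f [tuple of x :: t]).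
  by apply: measurableT_comp => //; exact: measurable_cons.
rewrite !ge0_integral_tuple_measureS//; last 2 first.
- by apply: emeasurable_funM => //; exact: mprod.
- by move=> t; rewrite mule_ge0// lee_fin prodr_ge0.
have mint : measurable_fun [set: T]
    (fun x => \int[tuple_measure (mdensity mu mh h0) n]_t f [tuple of x :: t]).
  apply: (@measurable_fun_fubini_tonelli_F _ _ _ _ _ _ (f \o @cons_pair d T n)) => //.
  - by apply: measurableT_comp => //; exact: measurable_cons_pair.
  - by move=> z; exact: f0.
rewrite ge0_integral_mdensity//; last by move=> x; apply: integral_ge0.
apply: eq_integral => x _; rewrite IH//.
rewrite -ge0_integralZr//; last 3 first.
- by apply: emeasurable_funM => //; exact: mprod.
- by move=> t _; rewrite mule_ge0// lee_fin prodr_ge0.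
- by rewrite lee_fin.
apply: eq_integral => t _; rewrite big_ord_recl tnth0 EFinM.
under [in RHS]eq_bigr do rewrite tnthS.
by rewrite -muleA [X in _ * X]muleC.
Qed.

End tuple_integral.

Section tuple_measure_symmetry.
Context d (T : measurableType d) (R : realType).
Implicit Types mu : {sigma_finite_measure set T -> \bar R}.

Definition box n : set (set (n.-tuple T)) :=
  [set B | exists2 A : 'I_n -> set T, (forall i, measurable (A i)) &
    B = [set t | forall i, A i (tnth t i)]].

Lemma measurable_box n (A : 'I_n -> set T) : (forall i, measurable (A i)) ->
  measurable [set t : n.-tuple T | forall i, A i (tnth t i)].
Proof.
move=> mA.
rewrite [X in measurable X](_ : _ =
  \bigcap_(i in [set: 'I_n]) ((fun t => tnth t i) @^-1` A i)).
  apply: fin_bigcap_measurable => // i _.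
  by rewrite -[X in measurable X]setTI; exact: measurable_tnth.
by apply/seteqP; split=> [t tA i _|t tA i]; exact: tA.
Qed.

Lemma box_setI_closed n : setI_closed (@box n).
Proof.
move=> _ _ [A mA ->] [B mB ->]; exists (fun i => A i `&` B i).
  by move=> i; exact: measurableI.
by apply/seteqP; split=> [t [tA tB] i|t tAB]; [split|split=> i; have [] := tAB i].
Qed.

Lemma box_setT n : @box n [set: _].
Proof. by exists (fun=> setT) => //; apply/seteqP; split. Qed.

Lemma measurable_tuple_box n : @measurable _ (n.-tuple T) = <<s @box n >>.
Proof.
apply/seteqP; split; apply: smallest_sub.
- exact: smallest_sigma_algebra.
- move=> B; rewrite -bigcup_seq => -[/= i _ [A mA <-]].
  apply: sub_sigma_algebra; rewrite setTI.
  exists (fun j => if j == i then A else setT) => [j|]; first by case: ifP.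
  apply/seteqP; split=> [t At j|t /(_ i)]; last by rewrite eqxx.
  by case: ifPn => // /eqP ->.
- exact: sigma_algebra_measurable.
- by move=> _ [A mA ->]; exact: measurable_box.
Qed.

Lemma tuple_measure_setT mu n :
  tuple_measure mu n [set: _] = \prod_(i < n) mu setT.
Proof.
rewrite -(@tuple_measure_box _ _ _ mu n (fun=> setT))//; congr (tuple_measure _ _ _).
by apply/seteqP; split.
Qed.

Lemma tuple_measure_setT_lty mu n : mu setT < +oo ->
  tuple_measure mu n [set: _] < +oo.
Proof.
move=> mufin; rewrite tuple_measure_setT.
suff : \prod_(i < n) mu setT \is a fin_num by rewrite fin_numElt => /andP[].
elim/big_ind : _ => // [x y|_ _]; first exact: fin_numM.
by rewrite ge0_fin_numE.
Qed.

Definition perm_tuple n (s : 'S_n) (t : n.-tuple T) : n.-tuple T :=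
  [tuple tnth t (s i) | i < n].

Lemma measurable_perm_tuple n (s : 'S_n) : measurable_fun [set: _] (perm_tuple s).
Proof.
apply/measurable_fun_tnthP => i.
rewrite (_ : _ \o _ = (fun t => tnth t (s i))); last first.
  by apply/funext => t /=; rewrite tnth_mktuple.
exact: measurable_tnth.
Qed.

(** The pushforward by a permutation agrees with the product measure on boxes. Boxes form a
    generating pi-system, which determines a measure of finite mass. *)
Lemma ge0_integral_perm_tuple mu n (s : 'S_n) (f : n.-tuple T -> \bar R) :
  mu setT < +oo -> measurable_fun [set: _] f -> (forall t, 0 <= f t) ->
  \int[tuple_measure mu n]_t f (perm_tuple s t) = \int[tuple_measure mu n]_t f t.
Proof.
move=> mufin mf f0; have mp := @measurable_perm_tuple n s.
transitivity (\int[pushforward (tuple_measure mu n) (perm_tuple s)]_t f t).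
  by rewrite ge0_integral_pushforward//= preimage_setT.
apply: eq_measure_integral => A mA _.
apply: (measure_unique (@box n) (fun=> setT)) => //.
- exact: measurable_tuple_box.
- exact: box_setI_closed.
- by move=> _; exact: box_setT.
- by apply/seteqP; split=> // x _; exists 0%N.
- move=> _ [B mB ->]; rewrite /= /pushforward.
  rewrite (_ : _ @^-1` _ = [set t | forall i, B ((s^-1)%g i) (tnth t i)]).
    rewrite (tuple_measure_box mu mB).
    rewrite (@tuple_measure_box _ _ _ mu n (fun i => B ((s^-1)%g i)))//.
    rewrite (reindex_inj (@perm_inj _ s)).
    by apply: eq_bigr => i _; rewrite permK.
  apply/seteqP; split=> t /= tB i.
    by have := tB ((s^-1)%g i); rewrite tnth_mktuple permKV.
  by have := tB (s i); rewrite tnth_mktuple permK.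
- by move=> _; rewrite /= /pushforward preimage_setT tuple_measure_setT_lty.
Qed.

Lemma ge0_integral_tuple_tnth mu n (i : 'I_n) (f : T -> \bar R) :
  mu setT = 1 -> measurable_fun [set: _] f -> (forall t, 0 <= f t) ->
  \int[tuple_measure mu n]_t f (tnth t i) = \int[mu]_x f x.
Proof.
move=> mu1 mf f0; have mp := @measurable_tnth _ T n i.
transitivity (\int[pushforward (tuple_measure mu n) (@tnth n T ^~ i)]_t f t).
  by rewrite ge0_integral_pushforward//= preimage_setT.
apply: eq_measure_integral => A mA _; rewrite /= /pushforward.
rewrite (_ : _ @^-1` _ =
    [set t | forall j, (if j == i then A else setT) (tnth t j)]); last first.
  apply/seteqP; split=> [t At j|t /(_ i)]; last by rewrite eqxx.
  by case: ifPn => // /eqP ->.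
rewrite (@tuple_measure_box _ _ _ mu n (fun j => if j == i then A else setT)); last first.
  by move=> j; case: ifP.
rewrite (bigD1 i)//= eqxx big1 ?mule1// => j /negPf ->; exact: mu1.
Qed.

(** The preimage of a rectangle is a box whose other sides are full. These have mass one, so the law
    of two distinct coordinates satisfies the characterization of the product measure. *)
Lemma ge0_integral_tuple_tnth2 mu n (i j : 'I_n) (f : T * T -> \bar R) :
  i != j -> mu setT = 1 -> measurable_fun [set: _] f -> (forall t, 0 <= f t) ->
  \int[tuple_measure mu n]_t f (tnth t i, tnth t j) = \int[mu \x mu]_z f z.
Proof.
move=> ij mu1 mf f0.
have mp : measurable_fun [set: n.-tuple T] (fun t => (tnth t i, tnth t j)).
  by apply: measurable_fun_pair; exact: measurable_tnth.
transitivity (\int[pushforward (tuple_measure mu n)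
    (fun t => (tnth t i, tnth t j))]_z f z).
  by rewrite ge0_integral_pushforward//= preimage_setT.
apply: eq_measure_integral => A mA _; apply/esym.
apply: product_measure_unique => // B C mB mC; rewrite /= /pushforward.
rewrite (_ : _ @^-1` _ = [set t | forall k,
    (if k == i then B else if k == j then C else setT) (tnth t k)]); last first.
  apply/seteqP; split=> [t [/= tB tC] k|t tk].
    by case: ifPn => [/eqP ->//|_]; case: ifPn => [/eqP ->|].
  split; first by have := tk i; rewrite eqxx.
  by have := tk j; rewrite eqxx eq_sym (negPf ij).
rewrite (@tuple_measure_box _ _ _ mu n
  (fun k => if k == i then B else if k == j then C else setT)); last first.
  by move=> k; do 2 case: ifP => //.
rewrite (bigD1 i)//= (bigD1 j)/=; last by rewrite eq_sym.
rewrite eqxx eq_sym (negPf ij) eqxx big1 ?mule1// => k /andP[/negPf -> /negPf ->].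
exact: mu1.
Qed.

End tuple_measure_symmetry.

(** * Hoeffding decoupling *)

Section decoupling.
Context (R : realType).

(** Jensen's inequality from the tangent line [e^u >= e^m (1 + u - m)] at the mean [m]: the factors
    [1 + u i - m] sum to the cardinality. *)
Lemma expR_mean (I : finType) (u : I -> R) : (0 < #|I|)%N ->
  (expR (#|I|%:R^-1 * \sum_i u i) <= #|I|%:R^-1 * \sum_i expR (u i))%R.
Proof.
move=> I0; set N := (#|I|%:R : R)%R; set m := (N^-1 * _)%R.
have N0 : (0 < N)%R by rewrite ltr0n.
rewrite -(ler_pM2l N0) mulrA divff ?gt_eqF// mul1r.
have sumE : (\sum_i (1 + (u i - m)) = N)%R.
  rewrite big_split/= sumrB !sumr_const -/N -[(m *+ _)%R]mulr_natr -/N.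
  by rewrite /m mulrAC mulVf ?gt_eqF// mul1r subrr addr0.
rewrite -[X in (X * _)%R]sumE mulr_suml.
apply: ler_sum => i _; rewrite -[X in (_ <= expR X)%R](subrKC m) expRD.
by rewrite mulrC ler_wpM2l ?expR_ge0// expR_ge1Dx.
Qed.

(** Double counting. The sum over permutations is the same for all [n (n - 1)] ordered pairs of
    positions; adding these and exchanging the sums, each permutation merely reindexes the full
    off-diagonal sum. *)
Lemma sum_perm_pair n (r : 'I_n -> 'I_n -> R) (i j : 'I_n) : i != j ->
  ((n * n.-1)%:R * \sum_(s : {perm 'I_n}) r (s i) (s j) =
   n`!%:R * \sum_p \sum_(q | q != p) r p q)%R.
Proof.
move=> ij.
have sumE k l : l != k ->
    (\sum_(s : {perm 'I_n}) r (s k) (s l) = \sum_(s : {perm 'I_n}) r (s i) (s j))%R.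
  (* The permutation [t] sends [k] to [i] and [l] to [j], so translation by [t] moves one pair of
     positions to the other. *)
  move=> lk; pose l' := tperm k i l; pose t := (tperm k i * tperm l' j)%g.
  have l'i : l' != i by rewrite -[X in _ != X](tpermL k i) (inj_eq perm_inj).
  have tk : t k = i by rewrite permM tpermL tpermD// eq_sym.
  have tl : t l = j by rewrite permM tpermL.
  rewrite (reindex_inj (mulgI t)) /=.
  by apply: eq_bigr => s _; rewrite !(permM t s) tk tl.
transitivity (\sum_k \sum_(l | l != k) \sum_(s : {perm 'I_n}) r (s k) (s l))%R.
  transitivity (\sum_(k < n) \sum_(l < n | l != k)
    \sum_(s : {perm 'I_n}) r (s i) (s j))%R; last first.
    by apply: eq_bigr => k _; apply: eq_bigr => l lk; rewrite sumE.
  set X := (\sum_(s : {perm 'I_n}) _)%R.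
  under eq_bigr do rewrite sumr_const cardC1 card_ord.
  by rewrite sumr_const card_ord -mulrnA mulnC mulr_natl.
under eq_bigr do rewrite exchange_big/=.
rewrite exchange_big/=.
transitivity (\sum_(s : {perm 'I_n}) \sum_p \sum_(q | q != p) r p q)%R; last first.
  by rewrite sumr_const card_Sn mulr_natl.
apply: eq_bigr => s _.
rewrite [RHS](reindex_inj (@perm_inj _ s))/=; apply: eq_bigr => k _.
rewrite [RHS](reindex_inj (@perm_inj _ s))/=; apply: eq_bigl => l.
by rewrite (inj_eq perm_inj).
Qed.

Fixpoint pairs (T : Type) (s : seq T) : seq (T * T) :=
  if s is x :: y :: s' then (x, y) :: pairs s' else [::].

Lemma pairs_ind2 (T : Type) (P : seq T -> Prop) : P [::] -> (forall x, P [:: x]) ->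
  (forall x y s, P s -> P [:: x, y & s]) -> forall s, P s.
Proof.
move=> P0 P1 P2 s; have [n] := ubnP (size s); elim: n s => // n IH [//|x [//|y s]] /= ssn.
by apply: P2; apply: IH; rewrite ltnS in ssn; exact: ltnW.
Qed.

Lemma pairs_map (T S : Type) (f : T -> S) (s : seq T) :
  pairs (map f s) = map (fun p => (f p.1, f p.2)) (pairs s).
Proof. by elim/pairs_ind2: s => //= x y s ->. Qed.

Lemma size_pairs (T : Type) (s : seq T) : size (pairs s) = (size s)./2.
Proof. by elim/pairs_ind2: s => //= x y s ->. Qed.

Lemma pairs_neq (T : eqType) (s : seq T) p : uniq s -> p \in pairs s -> p.1 != p.2.
Proof.
elim/pairs_ind2: s => //= x y s IH /and3P[+ _ /IH{}IH].
by rewrite !inE negb_or => /andP[xy _] /predU1P[->//|/IH].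
Qed.

Lemma pairs_perm_tuple d (T : measurableType d) n (s : {perm 'I_n}) (t : n.-tuple T) :
  pairs (perm_tuple s t) =
  [seq (tnth t (s p.1), tnth t (s p.2)) | p <- pairs (enum 'I_n)].
Proof. exact: (pairs_map (fun i => tnth t (s i))). Qed.

End decoupling.

Section hoeffding.
Context d (T : measurableType d) (R : realType).
Variable nu : {sigma_finite_measure set T -> \bar R}.
Hypothesis nu_fin : nu setT < +oo.

Lemma measurable_prod_pairs n (f : T * T -> \bar R) :
  measurable_fun [set: _] f ->
  measurable_fun [set: n.-tuple T] (fun t => \prod_(p <- pairs t) f p).
Proof.
move=> mf; have [m] := ubnP n; elim: m n => // m IH [|[|n]] nm.
- rewrite (_ : (fun _ => _) = cst 1); first exact: measurable_cst.
  by apply/funext => t; rewrite tuple0 big_nil.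
- rewrite (_ : (fun _ => _) = cst 1); first exact: measurable_cst.
  by apply/funext => t; case/tupleP : t => x t; rewrite tuple0 big_nil.
rewrite (_ : (fun _ => _) = (fun t : n.+2.-tuple T => f (tnth t ord0, tnth t (lift ord0 ord0)) *
  \prod_(p <- pairs [tuple of behead [tuple of behead t]]) f p)); last first.
  apply/funext => t; case/tupleP : t => x t; case/tupleP : t => y t.
  by rewrite /= big_cons.
apply: emeasurable_funM.
  apply: measurableT_comp => //; apply: measurable_fun_pair; exact: measurable_tnth.
have IHn : measurable_fun [set: n.-tuple T] (fun t => \prod_(p <- pairs t) f p).
  by apply: IH; rewrite ltnS in nm; exact: ltnW.
apply: (@measurableT_comp _ _ _ _ _ _ (fun t : n.-tuple T => \prod_(p <- pairs t) f p)
  _ (fun t : n.+2.-tuple T => [tuple of behead [tuple of behead t]])) => //.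
apply: (@measurableT_comp _ _ _ _ _ _ (fun t : n.+1.-tuple T => [tuple of behead t])).
  exact: measurable_behead.
exact: measurable_behead.
Qed.

(** The pairs are disjoint, so Tonelli integrates them out two coordinates at a time. For odd [n]
    one coordinate lies in no pair. *)
Lemma ge0_integral_prod_pairs n (f : T * T -> \bar R) :
  measurable_fun [set: _] f -> (forall z, 0 <= f z) ->
  \int[tuple_measure nu n]_t (\prod_(p <- pairs t) f p) =
  (nu setT) ^+ odd n * (\int[nu \x nu]_z f z) ^+ n./2.
Proof.
move=> mf f0; have mP k := @measurable_prod_pairs k f mf.
have P0 (s : seq T) : 0 <= \prod_(p <- pairs s) f p.
  by elim/big_ind : _ => // x y; exact: mule_ge0.
have [m] := ubnP n; elim: m n => // m IH [|[|n]] nm.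
- by rewrite ge0_integral_tuple_measure0 big_nil mul1e.
- have P1 (t : 1.-tuple T) : \prod_(p <- pairs t) f p = 1.
    by case/tupleP : t => x t; rewrite tuple0 big_nil.
  transitivity (\int[tuple_measure nu 1]_t cst 1 t).
    by apply: eq_integral => t _; exact: P1.
  rewrite integral_cst// mul1e expe0 mule1; apply: etrans (tuple_measure_setT nu 1) _.
  by rewrite big_ord1.
have mPx x : measurable_fun [set: n.+1.-tuple T]
    (fun t => \prod_(p <- pairs [tuple of x :: t]) f p).
  apply: (@measurableT_comp _ _ _ _ _ _
    (fun t : n.+2.-tuple T => \prod_(p <- pairs t) f p) _
    (fun t : n.+1.-tuple T => [tuple of x :: t])).
    exact: mP.
  exact: measurable_cons.
rewrite ge0_integral_tuple_measureS//.
under eq_integral.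
  move=> x _.
  rewrite ge0_integral_tuple_measureS//.
  under eq_integral.
    move=> y _.
    under eq_integral do rewrite (big_cons _ _ (x, y)).
    rewrite ge0_integralZl//; last exact: mP.
    rewrite IH; last by rewrite ltnS in nm; exact: ltnW.
    over.
  over.
set c := nu setT ^+ odd n * (\int[nu \x nu]_z f z) ^+ n./2.
have c0 : 0 <= c.
  by apply: mule_ge0; apply: expe_ge0; [exact: measure_ge0|exact: integral_ge0].
under eq_integral.
  move=> x _.
  rewrite ge0_integralZr//; last first.
    by apply: measurableT_comp => //; exact: measurable_fun_pair.
  over.
rewrite ge0_integralZr//; last 2 first.
- exact: measurable_fun_fubini_tonelli_F.
- by move=> x _; exact: integral_ge0.
rewrite -(@fubini_tonelli1 _ _ _ _ _ nu nu f)//.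
by rewrite /c muleCA -expeS /= negbK.
Qed.

(* The pair sum is a mean over permutations of sums over [n./2] disjoint pairs;
   for odd [n] one coordinate is left over and contributes a factor [nu setT]. *)
Lemma hoeffding_decoupling n (h : T * T -> \bar R) :
  measurable_fun [set: _] h -> (forall z, h z < +oo) -> (1 < n)%N ->
  \int[tuple_measure nu n]_t
    expeR ((n.-1%:R^-1)%:E * \sum_(i < n) \sum_(j < n | j != i) h (tnth t i, tnth t j))
  <= (nu setT) ^+ odd n *
     (\int[nu \x nu]_z expeR ((n%:R / (n./2)%:R)%:E * h z)) ^+ n./2.
Proof.
move=> mh hoo n1; set m := n./2.
have m0 : (0 < m)%N by rewrite /m half_gt0.
have n0 : (0 < n)%N by exact: ltnW.
have n10 : (0 < n.-1)%N by case: n n1 {m m0 n0} => [|[]].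
pose f z := expeR ((n%:R / m%:R)%:E * h z).
have f0 z : 0 <= f z by exact: expeR_ge0.
have mf : measurable_fun setT f.
  by apply: (measurableT_comp (@measurable_expeR R)); exact: measurable_funeM.
rewrite -ge0_integral_prod_pairs//.
have mP := @measurable_prod_pairs n f mf.
have P0 (s : seq T) : 0 <= \prod_(p <- pairs s) f p.
  by elim/big_ind : _ => // x y; exact: mule_ge0.
have mPs (s : {perm 'I_n}) : measurable_fun [set: n.-tuple T]
    (fun t => \prod_(p <- pairs (perm_tuple s t)) f p).
  apply: (@measurableT_comp _ _ _ _ _ _ (fun t : n.-tuple T => \prod_(p <- pairs t) f p)) => //.
  exact: measurable_perm_tuple.
have nfact0 : (0 < n`!)%N by exact: fact_gt0.
(* Permutation invariance replaces the product over consecutive pairs by its average over all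
   permutations; the claim is then Jensen's inequality under the integral. *)
have <- : \int[tuple_measure nu n]_t ((n`!%:R^-1)%:E *
    \sum_(s : {perm 'I_n}) \prod_(p <- pairs (perm_tuple s t)) f p) =
    \int[tuple_measure nu n]_t \prod_(p <- pairs t) f p.
  rewrite ge0_integralZl//; last 2 first.
  - exact: emeasurable_sum.
  - by move=> t _; exact: sume_ge0.
  rewrite ge0_integral_sum//.
  under eq_bigr do rewrite (ge0_integral_perm_tuple _ nu_fin mP)//.
  have sumc (c : \bar R) : \sum_(s : {perm 'I_n}) c = (n`!%:R)%:E * c.
    transitivity (\sum_(s : {perm 'I_n}) 1%:E * c).
      by apply: eq_bigr => s _; rewrite mul1e.
    by rewrite -ge0_sume_distrl// sumEFin sumr_const card_Sn.
  rewrite sumc muleA -EFinM mulVf ?mul1e//.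
apply: ge0_le_integral => //.
- by move=> t _; exact: expeR_ge0.
- apply: (measurableT_comp (@measurable_expeR R)); apply: measurable_funeM.
  apply: emeasurable_sum => i; apply: emeasurable_sum_cond => j _.
  by apply: measurableT_comp => //; apply: measurable_fun_pair; exact: measurable_tnth.
- by apply: measurable_funeM; exact: emeasurable_sum.
move=> t _.
(* As [h] avoids [+oo], a single infinite value makes the whole sum [-oo] and the left integrand
   zero. Otherwise everything is real. *)
have [hfin|] := pselect (forall i j, j != i -> h (tnth t i, tnth t j) \is a fin_num); last first.
  move=> /existsNP[i /existsNP[j /not_implyP[ji hNfin]]].
  suff -> : \sum_(i < n) \sum_(j < n | j != i) h (tnth t i, tnth t j) = -oo.
    by rewrite gt0_muleNy ?lte_fin ?invr_gt0 ?ltr0n//=; rewrite mule_ge0//; exact: sume_ge0.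
  have hNy : h (tnth t i, tnth t j) = -oo.
    by move: hNfin (hoo (tnth t i, tnth t j)); case: (h _).
  apply/eqP; rewrite esum_eqNy; apply/existsP; exists i => /=.
  by rewrite esum_eqNy; apply/existsP; exists j; rewrite hNy eqxx andbT.
pose r i j := fine (h (tnth t i, tnth t j)).
have hE i j : j != i -> h (tnth t i, tnth t j) = (r i j)%:E.
  by move=> ji; rewrite /r fineK// hfin.
have -> : \sum_(i < n) \sum_(j < n | j != i) h (tnth t i, tnth t j) =
    (\sum_(i < n) \sum_(j < n | j != i) r i j)%:E.
  by rewrite -sumEFin; apply: eq_bigr => i _; rewrite -sumEFin; apply: eq_bigr => j /hE.
pose u (s : {perm 'I_n}) :=
  (\sum_(p <- pairs (enum 'I_n)) n%:R / m%:R * r (s p.1) (s p.2))%R.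
have -> : \sum_(s : {perm 'I_n}) \prod_(p <- pairs (perm_tuple s t)) f p =
    (\sum_(s : {perm 'I_n}) expR (u s))%:E.
  rewrite -sumEFin; apply: eq_bigr => s _; rewrite pairs_perm_tuple big_map.
  rewrite /u expR_sum -prodEFin big_seq [RHS]big_seq; apply: eq_bigr => p pp.
  by rewrite /f hE// (inj_eq perm_inj) eq_sym (pairs_neq _ pp)// enum_uniq.
rewrite -!EFinM lee_fin.
have := @expR_mean R _ u; rewrite card_Sn => /(_ nfact0); apply: le_trans.
rewrite ler_expR.
have [i [j ij]] : exists i j : 'I_n, i != j.
  by exists (Ordinal n0), (Ordinal n1).
have := sum_perm_pair r ij; set S := (\sum_(s : {perm 'I_n}) _)%R => SE.
(* All [m] pairs have the same permutation sum [S], and the factor [n/m] compensates for their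
   number. *)
have uE : (\sum_s u s = n%:R * S)%R.
  rewrite /u exchange_big/= big_seq.
  transitivity (\sum_(p <- pairs (enum 'I_n) | p \in pairs (enum 'I_n)) n%:R / m%:R * S)%R.
    apply: eq_bigr => p pp; rewrite -mulr_sumr; congr (_ * _)%R.
    apply: (@mulfI _ (n * n.-1)%:R%R); first by rewrite pnatr_eq0 -lt0n muln_gt0 n0.
    by rewrite SE sum_perm_pair// (pairs_neq _ pp)// enum_uniq.
  rewrite -big_seq big_const_seq count_predT size_pairs size_enum_ord -/m iter_addr_0.
  by rewrite -[(_ *+ m)%R]mulr_natr mulrAC divfK// pnatr_eq0 -lt0n.
rewrite uE; rewrite le_eqVlt; apply/orP; left; apply/eqP.
have nfact_neq0 : (n`!%:R != 0 :> R)%R by rewrite pnatr_eq0 -lt0n.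
have nn0 : (n%:R != 0 :> R)%R by rewrite pnatr_eq0 -lt0n.
have n1n0 : (n.-1%:R != 0 :> R)%R by rewrite pnatr_eq0 -lt0n.
apply: (mulfI nfact_neq0); rewrite mulVKf// mulrCA -SE natrM.
by rewrite [(_ * n.-1%:R)%R]mulrC -!mulrA mulKf.
Qed.

End hoeffding.

(** * Densities and entropy *)

Section young.
Context (R : realType).
Implicit Types s t : R.

(** Young's inequality for the conjugate functions [t ln t] and [e^(s-1)], obtained from
    [1 + y <= e^y] at [y = s - 1 - ln t]. *)
Lemma young_entropy s t : (0 <= t)%R -> (s * t <= t * ln t + expR (s - 1))%R.
Proof.
rewrite le_eqVlt => /predU1P[<-|t0]; first by rewrite mulr0 mul0r add0r expR_ge0.
have := expR_ge1Dx (s - 1 - ln t).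
rewrite expRB lnK ?posrE// ler_pdivlMr//; lra.
Qed.

Lemma xlnxD1_ge0 t : (0 <= t)%R -> (0 <= t * ln t + 1)%R.
Proof.
move=> t0; have := young_entropy 0 t0; rewrite mul0r add0r => /le_trans; apply.
by rewrite lerD2l -[leRHS]expR0 ler_expR lerN10.
Qed.

End young.

Section density.
Context d (T : measurableType d) (R : realType).
Variable nu : {sigma_finite_measure set T -> \bar R}.

Definition density (f : T -> R) := [/\ measurable_fun [set: T] f,
  forall x, (0 <= f x)%R & \int[nu]_x (f x)%:E = 1].

(* The added constant makes the integrand nonnegative. *)
Definition entropy1 (f : T -> R) := \int[nu]_x (f x * ln (f x) + 1)%:E.

Definition pair_integral (k : T * T -> \bar R) (f : T -> R) :=
  \int[nu \x nu]_z (k z * (f z.1 * f z.2)%:E).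

Lemma entropy1_ge0 f : (forall x, (0 <= f x)%R) -> 0 <= entropy1 f.
Proof. by move=> f0; apply: integral_ge0 => x _; rewrite lee_fin xlnxD1_ge0. Qed.

Lemma measurable_xlnx (f : T -> R) : measurable_fun [set: T] f ->
  measurable_fun [set: T] (fun x => f x * ln (f x))%R.
Proof. by move=> mf; apply: measurable_funM => //; exact: measurableT_comp. Qed.

Lemma measurable_xlnxD1 (f : T -> R) : measurable_fun [set: T] f ->
  measurable_fun [set: T] (fun x => (f x * ln (f x) + 1)%:E).
Proof.
move=> mf; apply/measurable_EFinP; apply: measurable_funD => //.
exact: measurable_xlnx.
Qed.

Lemma ge0_integral_tensor (a b : T -> \bar R) :
  measurable_fun [set: T] a -> measurable_fun [set: T] b ->
  (forall x, 0 <= a x) -> (forall x, 0 <= b x) ->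
  \int[nu \x nu]_z (a z.1 * b z.2) = \int[nu]_x a x * \int[nu]_x b x.
Proof.
move=> ma mb a0 b0.
have mab : measurable_fun [set: T * T] (fun z => a z.1 * b z.2).
  by apply: emeasurable_funM; [exact: (measurableT_comp ma)|exact: (measurableT_comp mb)].
rewrite fubini_tonelli1//=; last by move=> z; exact: mule_ge0.
rewrite /fubini_F/=; under eq_integral do rewrite ge0_integralZl//.
by rewrite ge0_integralZr// integral_ge0.
Qed.

Lemma measurable_tensor (f : T -> R) : measurable_fun [set: T] f ->
  measurable_fun [set: T * T] (fun z => f z.1 * f z.2)%R.
Proof.
by move=> mf; apply: measurable_funM; exact: (measurableT_comp mf).
Qed.

(** The entropy inequality: an exponential moment of [phi] under [nu] controls the mean of [phi]
    under every density of bounded entropy. *)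
Lemma integral_young (f : T -> R) (phi : T -> R) : density f ->
  measurable_fun [set: T] phi -> (forall x, 0 <= phi x)%R ->
  \int[nu]_x (phi x * f x)%:E <= entropy1 f + \int[nu]_x (expR (phi x))%:E.
Proof.
move=> [mf f0 _] mphi phi0.
have mx := measurable_xlnxD1 mf.
have me : measurable_fun [set: T] (fun x => (expR (phi x))%:E).
  by apply/measurable_EFinP; exact: measurableT_comp.
rewrite /entropy1 -ge0_integralD//; last by move=> x _; rewrite lee_fin xlnxD1_ge0.
apply: ge0_le_integral => //.
- by move=> x _; rewrite lee_fin mulr_ge0.
- by apply/measurable_EFinP; exact: measurable_funM.
- exact: emeasurable_funD.
move=> x _; rewrite -EFinD lee_fin.
have /le_trans := young_entropy (phi x) (f0 x); apply.
by rewrite -addrA lerD2l ler_wpDl// ler_expR gerBl.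
Qed.

(** Young's inequality on the product space with exponent [phi - k]. As [f] has mass one, the
    entropy of its tensor square is twice its own. Only [e^(phi - k)] has to be integrable, so the
    energy itself helps to control [phi]. *)
Lemma pair_integral_young (f : T -> R) (phi : T * T -> R) (k : T * T -> \bar R) :
  density f -> measurable_fun [set: T * T] phi -> (forall z, 0 <= phi z)%R ->
  measurable_fun [set: T * T] k -> (forall z, 0 <= k z) ->
  pair_integral (EFin \o phi) f <= 2%:E * entropy1 f + pair_integral k f +
    \int[nu \x nu]_z expeR ((phi z)%:E - k z).
Proof.
move=> [mf f0 f1] mphi phi0 mk k0.
pose g x := (f x * ln (f x) + 1)%R.
have g0 x : (0 <= g x)%R by exact: xlnxD1_ge0.
have mg : measurable_fun [set: T] (EFin \o g) by exact: measurable_xlnxD1.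
have mfE : measurable_fun [set: T] (EFin \o f) by exact/measurable_EFinP.
have mff : measurable_fun [set: T * T] (fun z => (f z.1 * f z.2)%:E).
  by apply/measurable_EFinP; exact: measurable_tensor.
have mgf : measurable_fun [set: T * T] (fun z => (g z.1)%:E * (f z.2)%:E).
  by apply: emeasurable_funM; [exact: (measurableT_comp mg)|exact: (measurableT_comp mfE)].
have mfg : measurable_fun [set: T * T] (fun z => (f z.1)%:E * (g z.2)%:E).
  by apply: emeasurable_funM; [exact: (measurableT_comp mfE)|exact: (measurableT_comp mg)].
have me : measurable_fun [set: T * T] (fun z => expeR ((phi z)%:E - k z)).
  apply: (measurableT_comp (@measurable_expeR R)); apply: emeasurable_funB => //.
  exact/measurable_EFinP.
have mkff : measurable_fun [set: T * T] (fun z => k z * (f z.1 * f z.2)%:E).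
  exact: emeasurable_funM.
have -> : 2%:E * entropy1 f = \int[nu \x nu]_z ((g z.1)%:E * (f z.2)%:E) +
    \int[nu \x nu]_z ((f z.1)%:E * (g z.2)%:E).
  rewrite (ge0_integral_tensor (a := EFin \o g) (b := EFin \o f))//.
  rewrite (ge0_integral_tensor (a := EFin \o f) (b := EFin \o g))//.
  by rewrite /= f1 mule1 mul1e -mule2n mule_natl.
have gf0 z : 0 <= (g z.1)%:E * (f z.2)%:E by rewrite mule_ge0 ?lee_fin.
have fg0 z : 0 <= (f z.1)%:E * (g z.2)%:E by rewrite mule_ge0 ?lee_fin.
have kff0 z : 0 <= k z * (f z.1 * f z.2)%:E by rewrite mule_ge0 ?lee_fin// mulr_ge0.
have e0 z : 0 <= expeR ((phi z)%:E - k z) by exact: expeR_ge0.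
have s10 z : 0 <= (g z.1)%:E * (f z.2)%:E + (f z.1)%:E * (g z.2)%:E.
  by rewrite adde_ge0.
have ms1 := emeasurable_funD mgf mfg.
have s20 z : 0 <= (g z.1)%:E * (f z.2)%:E + (f z.1)%:E * (g z.2)%:E +
    k z * (f z.1 * f z.2)%:E by rewrite adde_ge0.
have ms2 := emeasurable_funD ms1 mkff.
rewrite -ge0_integralD// -ge0_integralD// -ge0_integralD//.
apply: ge0_le_integral => //.
- by move=> z _ /=; rewrite lee_fin !mulr_ge0.
- by apply: emeasurable_funM => //; exact/measurable_EFinP.
- exact: emeasurable_funD.
move=> z _ /=.
(* Where the tensor vanishes so does the left side. Elsewhere both factors are positive, so the
   logarithm of the product splits. *)
have [t0|t0] := eqVneq (f z.1 * f z.2)%R 0%R.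
  by rewrite t0 !mule0 adde0 adde_ge0.
have tp : (0 < f z.1 * f z.2)%R by rewrite lt_neqAle eq_sym t0 mulr_ge0.
case: (k z) (k0 z) => [r r0|_|//]; last first.
  by rewrite gt0_mulye ?lte_fin// -!EFinM/= addey// leey.
rewrite -!EFinM -EFinB/= -!EFinD lee_fin.
have := young_entropy (phi z - r) (ltW tp).
have z1 : (0 < f z.1)%R by rewrite lt_neqAle f0 andbT; apply: contra_neq t0 => <-; rewrite mul0r.
have z2 : (0 < f z.2)%R by rewrite lt_neqAle f0 andbT; apply: contra_neq t0 => <-; rewrite mulr0.
rewrite lnM ?posrE// /g.
have : (expR (phi z - r - 1) <= expR (phi z - r))%R by rewrite ler_expR gerBl.
have := f0 z.1; have := f0 z.2; nra.
Qed.

End density.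

(** * Approximation by step kernels *)

Section step_approximation.
Context d (T : measurableType d) (R : realType).
Variable nu : {sigma_finite_measure set T -> \bar R}.
Hypothesis nu_fin : nu setT < +oo.

Import HBSimple.

Lemma nu2_fin : (nu \x nu) setT < +oo.
Proof.
rewrite -setXTT product_measure1E// lte_mul_pinfty//; last by rewrite ge0_fin_numE.
Qed.

(** The same finite partition serves both variables: the energy of a configuration under the step
    kernel then depends only on the word of cells visited, as the method of types requires. *)
Definition step_approx (k : T * T -> R) := forall e : R, (0 < e)%R ->
  exists (I : finType) (tau : T -> I) (g : I -> I -> R),
    (forall i, measurable (tau @^-1` [set i])) /\
    \int[nu \x nu]_z (`|k z - g (tau z.1) (tau z.2)|)%:E <= e%:E.

Lemma measurable_fun_finite_fibers d' (T' : measurableType d') (I : finType)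
    (tau : T' -> I) (g : I -> R) :
  (forall i, measurable (tau @^-1` [set i])) ->
  measurable_fun [set: T'] (g \o tau).
Proof.
move=> mtau _ Y mY; rewrite setTI.
rewrite (_ : _ @^-1` Y = \bigcup_(i in [set i : I | Y (g i)]) (tau @^-1` [set i])).
  by apply: fin_bigcup_measurable => //; exact: finite_finset.
by apply/seteqP; split=> [x Yx|x [i Yi /= ix]]; [exists (tau x)|rewrite /= ix].
Qed.

Lemma measurable_step (I : finType) (tau : T -> I) (g : I -> I -> R) :
  (forall i, measurable (tau @^-1` [set i])) ->
  measurable_fun [set: T * T] (fun z => g (tau z.1) (tau z.2)).
Proof.
move=> mtau.
apply: (@measurable_fun_finite_fibers _ _ (I * I)%type
  (fun z => (tau z.1, tau z.2)) (fun p => g p.1 p.2)) => -[i j].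
rewrite (_ : _ @^-1` _ = (tau @^-1` [set i]) `*` (tau @^-1` [set j])).
  exact: measurableX.
by apply/seteqP; split=> [z [<- <-]|z [/= <- <-]].
Qed.

Lemma step_approx_closed (k : T * T -> R) : measurable_fun [set: _] k ->
  (forall e : R, (0 < e)%R -> exists k', [/\ measurable_fun [set: _] k', step_approx k' &
    \int[nu \x nu]_z (`|k z - k' z|)%:E <= e%:E]) ->
  step_approx k.
Proof.
move=> mk happ e e0; have e20 : (0 < e / 2)%R by rewrite divr_gt0.
have [k' [mk' ak' kk']] := happ _ e20.
have [I [tau [g [mtau gtau]]]] := ak' _ e20.
exists I, tau, g; split => //; rewrite [e]splitr EFinD.
apply: (le_trans _ (leeD kk' gtau)).
have mg := measurable_step g mtau.
have mn (u v : T * T -> R) : measurable_fun setT u -> measurable_fun setT v ->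
    measurable_fun setT (fun z => (`|u z - v z|)%:E).
  move=> mu mv; apply/measurable_EFinP; apply: measurableT_comp => //.
  exact: measurable_funB.
rewrite -ge0_integralD//; [|exact: mn..].
apply: ge0_le_integral => //; [exact: mn|apply: emeasurable_funD; exact: mn|].
by move=> z _; rewrite -EFinD lee_fin (le_trans _ (ler_normD _ _))// addrA subrK.
Qed.

Lemma step_approxD (k1 k2 : T * T -> R) :
  measurable_fun [set: _] k1 -> measurable_fun [set: _] k2 ->
  step_approx k1 -> step_approx k2 -> step_approx (fun z => k1 z + k2 z)%R.
Proof.
move=> mk1 mk2 a1 a2 e e0; have e20 : (0 < e / 2)%R by rewrite divr_gt0.
have [I1 [t1 [g1 [mt1 h1]]]] := a1 _ e20.
have [I2 [t2 [g2 [mt2 h2]]]] := a2 _ e20.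
exists (I1 * I2)%type, (fun x => (t1 x, t2 x)),
  (fun i j => g1 i.1 j.1 + g2 i.2 j.2)%R; split.
  move=> [i j]; rewrite (_ : _ @^-1` _ = t1 @^-1` [set i] `&` t2 @^-1` [set j]).
    exact: measurableI.
  by apply/seteqP; split=> [z [<- <-]|z [/= <- <-]].
rewrite [e]splitr EFinD; apply: (le_trans _ (leeD h1 h2)).
have mn (u v : T * T -> R) : measurable_fun setT u -> measurable_fun setT v ->
    measurable_fun setT (fun z => (`|u z - v z|)%:E).
  move=> mu mv; apply/measurable_EFinP; apply: measurableT_comp => //.
  exact: measurable_funB.
have mg1 := measurable_step g1 mt1; have mg2 := measurable_step g2 mt2.
rewrite -ge0_integralD//; [|exact: mn..].
apply: ge0_le_integral => //=.
- by apply: mn; exact: measurable_funD.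
- by apply: emeasurable_funD; exact: mn.
by move=> z _; rewrite -EFinD lee_fin (le_trans _ (ler_normD _ _))// opprD addrACA.
Qed.

Lemma step_approx_cst (r : R) : step_approx (cst r).
Proof.
move=> e e0; exists unit, (fun=> tt), (fun _ _ => r); split.
  by move=> []; rewrite (_ : _ @^-1` _ = setT)//; apply/seteqP; split.
under eq_integral do rewrite subrr normr0.
by rewrite integral0 lee_fin ltW.
Qed.

Lemma step_approxZ (r : R) (k : T * T -> R) : measurable_fun [set: _] k ->
  step_approx k -> step_approx (fun z => r * k z)%R.
Proof.
move=> mk ak e e0; have er0 : (0 < e / (`|r| + 1))%R by rewrite divr_gt0// ltr_wpDl.
have [I [tau [g [mtau h]]]] := ak _ er0.
exists I, tau, (fun i j => r * g i j)%R; split => //.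
under eq_integral do rewrite -mulrBr normrM EFinM.
rewrite ge0_integralZl//; last first.
  apply/measurable_EFinP; apply: measurableT_comp => //; apply: measurable_funB => //.
  exact: (measurable_step g mtau).
apply: (@le_trans _ _ (`|r|%:E * (e / (`|r| + 1))%:E)).
  by rewrite lee_wpmul2l// lee_fin.
rewrite -EFinM lee_fin mulrCA ger_pMr// ler_pdivrMr ?ltr_wpDl// mul1r.
by rewrite lerDl.
Qed.

(** Dynkin's lemma on rectangles. Complements follow by linearity; a disjoint union is approximated
    in L1 by its finite subunions, because its tails [U n] decrease to the empty set under a finite
    measure. *)
Lemma step_approx_indic (E : set (T * T)) : measurable E -> step_approx (\1_E).
Proof.
move=> mE.
pose G : set (set (T * T)) :=
  [set A `*` B | A in [set A | measurable A] & B in [set B | measurable B]].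
apply: (@dynkin_induction _ _ G (fun E => step_approx (\1_E))).
- by rewrite measurable_prod_measurableType.
- move=> _ _ [A1 mA1 [B1 mB1 <-]] [A2 mA2 [B2 mB2 <-]].
  exists (A1 `&` A2); first exact: measurableI.
  by exists (B1 `&` B2); [exact: measurableI|rewrite setXI].
- by rewrite indicT; exact: step_approx_cst.
- move=> _ [A mA [B mB <-]] e e0.
  exists (bool * bool)%type, (fun x => (x \in A, x \in B)),
    (fun i j => (i.1 && j.2)%:R)%R; split.
    move=> [a b]; rewrite (_ : _ @^-1` _ =
        (if a then A else ~` A) `&` (if b then B else ~` B)).
      by apply: measurableI; case: ifP => // _; exact: measurableC.
    apply/seteqP; split=> [x [<- <-]|x [xa xb]] /=.
      by split; case: ifPn; rewrite ?inE// notin_setE.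
    congr (_, _).
      by case: a xa => xa; [rewrite mem_set|rewrite memNset].
    by case: b xb => xb; [rewrite mem_set|rewrite memNset].
  rewrite (eq_integral (cst 0)); first by rewrite integral0 lee_fin ltW.
  by move=> z _; rewrite /= indicE in_setX subrr normr0.
- move=> S mS aS; rewrite (_ : \1_(~` S) = (fun z => cst 1 z + (-1) * \1_S z)%R); last first.
    by apply/funext => z; rewrite !indicE in_setC /=; case: (_ \in _) => /=; lra.
  apply: step_approxD => //; [exact: measurable_funM|exact: step_approx_cst|].
  exact: step_approxZ.
- move=> F mF tF aF; apply: step_approx_closed.
    exact/measurable_indic/bigcupT_measurable.
  move=> e e0.
  pose U n := \bigcup_(k in [set k | (n <= k)%N]) F k.
  have mU n : measurable (U n) by apply: bigcup_measurable.
  have : (nu \x nu) (U n) @[n --> \oo] --> (nu \x nu) (\bigcap_n U n).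
    apply: nonincreasing_cvg_mu => //.
    - by apply: le_lt_trans nu2_fin; apply: le_measure; rewrite ?inE.
    - exact: bigcapT_measurable.
    - move=> m n mn; apply/subsetPset; apply: bigcup_subset => i /= ni.
      exact: leq_trans ni.
  have -> : \bigcap_n U n = set0.
    rewrite -subset0 => z Uz; have [i _ Fiz] := Uz 0%N Logic.I.
    have [j /= ij Fjz] := Uz i.+1 Logic.I.
    by move: ij; rewrite (tF i j)// ?ltnn//; exists z.
  rewrite measure0 => /fine_cvgP[_ /cvgrPdist_le/(_ _ e0)[N _ /(_ N (leqnn N))]] /=.
  rewrite sub0r normrN => UN.
  exists (fun z => \sum_(k < N) \1_(F k) z)%R; split.
  - by apply: measurable_sum => k; exact: measurable_indic.
  - elim: N {UN} => [|N IH].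
      by under eq_fun do rewrite big_ord0; exact: step_approx_cst.
    under eq_fun do rewrite big_ord_recr/=.
    apply: step_approxD => //.
    by apply: measurable_sum => k; exact: measurable_indic.
  apply: (@le_trans _ _ ((nu \x nu) (U N))); last first.
    rewrite -[leLHS]fineK; first by rewrite lee_fin (le_trans (ler_norm _)).
    rewrite ge0_fin_numE//; apply: le_lt_trans nu2_fin.
    by apply: le_measure; rewrite ?inE.
  rewrite (_ : (nu \x nu) (U N) = \int[nu \x nu]_z (\1_(U N) z)%:E); last first.
    by rewrite integral_indic// setIT.
  rewrite le_eqVlt; apply/orP; left; apply/eqP.
  apply: eq_integral => z _; congr (_%:E); rewrite [RHS]indicE.
  have [[i _ Fiz]|nF] := pselect ((\bigcup_k F k) z); last first.
    have nFk k : z \notin F k by apply/negP; rewrite inE => Fkz; apply: nF; exists k.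
    rewrite memNset; last by move=> [k _ Fkz]; apply: nF; exists k.
    rewrite indicE memNset// big1 ?subr0 ?normr0// => k _.
    by rewrite indicE (negbTE (nFk k)).
  have Fi k : F k z -> k = i by move=> Fkz; apply: tF => //; exists z.
  rewrite [X in (`|X - _|)%R]indicE mem_set; last by exists i.
  have [iN|Ni] := ltnP i N.
    rewrite memNset; last by move=> [k /= Nk /Fi ki]; move: Nk; rewrite ki leqNgt iN.
    rewrite (bigD1 (Ordinal iN))//= big1 => [|k ki].
      by rewrite indicE mem_set// addr0 subrr normr0.
    rewrite indicE memNset// => /Fi ki'; move/eqP: ki; apply; exact/val_inj.
  rewrite mem_set; last by exists i.
  rewrite big1 ?subr0 ?normr1// => k _; rewrite indicE memNset// => /Fi ki.
  by move: Ni; rewrite -ki leqNgt ltn_ord.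
by rewrite -measurable_prod_measurableType.
Qed.

Lemma clamp_dist (M k x : R) : (0 <= k <= M)%R ->
  (`|k - (if x < 0 then 0 else if M < x then M else x)| <= `|k - x|)%R.
Proof.
move=> /andP[k1 k2].
have := ler_norm (k - x); have := ler_norm (x - k); rewrite [(`|x - k|)%R]distrC.
by rewrite ler_norml; case: ltP => ?; [|case: ltP => ?]; lra.
Qed.

Lemma step_approx_integrable (k : T * T -> R) :
  (nu \x nu).-integrable [set: _] (EFin \o k) -> step_approx k.
Proof.
move=> ik; have mk : measurable_fun [set: _] k.
  by apply/measurable_EFinP; exact: measurable_int ik.
apply: step_approx_closed => // e e0.
have [g [_ _ gk]] := approximation_sfun_integrable measurableT ik.
move/fine_cvgP : gk => [+ /cvgrPdist_le/(_ _ e0)].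
move=> /filterI/[apply] -[N _ /(_ N (leqnn N))] /= [gfin].
rewrite sub0r normrN => gNe.
exists (g N); split => //.
- rewrite (_ : g N = (fun z => \sum_(y <- fset_set (range (g N))) y * \1_(g N @^-1` [set y]) z)%R :> (_ -> _)); last first.
    by apply/funext => z; rewrite fimfunE fsbig_finite.
  elim: (fset_set _ : seq R) => [|y s IH].
    by under eq_fun do rewrite big_nil; exact: step_approx_cst.
  under eq_fun do rewrite big_cons.
  apply: step_approxD => //.
  + exact: measurable_funM.
  + by apply: measurable_sum => r; exact: measurable_funM.
  + by apply: step_approxZ => //; exact: step_approx_indic.
- rewrite -[leLHS]fineK// lee_fin; exact: le_trans (ler_norm _) gNe.
Qed.

(** Clamping the step values to [[0, M]] does not increase the distance to [k]. The uniform bound is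
    what later turns L1 closeness into exponential closeness. *)
Lemma step_approx_bounded (k : T * T -> R) (M : R) : (0 <= M)%R -> measurable_fun [set: _] k ->
  (forall z, 0 <= k z <= M)%R ->
  forall e : R, (0 < e)%R ->
  exists (I : finType) (tau : T -> I) (g : I -> I -> R),
    [/\ forall i, measurable (tau @^-1` [set i]),
      forall i j, (0 <= g i j <= M)%R &
      \int[nu \x nu]_z (`|k z - g (tau z.1) (tau z.2)|)%:E <= e%:E].
Proof.
move=> M0 mk kM e e0.
have ik : (nu \x nu).-integrable [set: _] (EFin \o k).
  apply: measurable_bounded_integrable => //; first exact: nu2_fin.
  exists M; split; first exact: num_real.
  by move=> x Mx z _; have /andP[k1 k2] := kM z; rewrite /= ger0_norm// (le_trans k2)// ltW.
have [I [tau [g [mtau h]]]] := step_approx_integrable ik e0.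
pose g' i j := (if g i j < 0 then 0 else if M < g i j then M else g i j)%R.
exists I, tau, g'; split => //.
  by move=> i j; rewrite /g'; case: ltP => ?; [|case: ltP => ?]; apply/andP; split; lra.
have mn g0 : measurable_fun [set: T * T] (fun z => (`|k z - g0 (tau z.1) (tau z.2)|)%:E).
  apply/measurable_EFinP; apply: measurableT_comp => //; apply: measurable_funB => //.
  exact: (measurable_step g0 mtau).
apply: le_trans h; apply: ge0_le_integral => //.
by move=> z _; rewrite lee_fin clamp_dist.
Qed.

(** Quantization of the range: the cell of [x] is the integer part of [(q x + M) / e]. The
    approximation is uniform, hence valid for empirical means and under every density alike. *)
Lemma step_approx_unif (q : T -> R) (M : R) : measurable_fun [set: T] q ->
  (forall x, `|q x| <= M)%R -> forall e : R, (0 < e)%R ->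
  exists (I : finType) (tau : T -> I) (g : I -> R),
    (forall i, measurable (tau @^-1` [set i])) /\
    forall x, (`|q x - g (tau x)| <= e)%R.
Proof.
move=> mq qM e e0.
pose N := (Num.truncn (2 * M / e)).
pose v x := ((q x + M) / e)%R.
have v0 x : (0 <= v x)%R.
  apply: divr_ge0; last exact: ltW.
  by have := qM x; rewrite ler_norml => /andP[]; lra.
have vN x : (Num.truncn (v x) < N.+1)%N.
  rewrite ltnS; apply: le_truncn; rewrite ler_pM2r ?invr_gt0//.
  by have := qM x; rewrite ler_norml => /andP[_]; lra.
exists 'I_N.+1, (fun x => inord (Num.truncn (v x))), (fun i : 'I_N.+1 => e * (i : nat)%:R - M)%R; split.
  move=> i; rewrite (_ : _ @^-1` _ = v @^-1` [set r | i%:R <= r < i.+1%:R]%R).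
    rewrite -[X in measurable X]setTI.
    have mv : measurable_fun setT v.
      by apply: measurable_funM => //; exact: measurable_funD.
    apply: mv => //.
    have -> : [set r : R | (i%:R <= r < i.+1%:R)%R] = `[i%:R, i.+1%:R[%classic.
      by apply/seteqP; split=> r; rewrite /= in_itv.
    exact: measurable_itv.
  apply/seteqP; split=> x /=.
    by move=> <-; rewrite inordK//; exact: truncn_itv.
  move=> vi; apply/val_inj; rewrite /= inordK//; apply/eqP.
  by rewrite truncn_eq.
move=> x; rewrite inordK//.
have := truncn_itv (v0 x) => /andP[]; set n := (Num.truncn _)%:R => h1 h2.
have qE : (q x = e * v x - M)%R by rewrite /v mulrCA divff ?gt_eqF// mulr1 addrK.
rewrite qE opprB addrA subrK -mulrBr normrM gtr0_norm// ger_pMr// ler_norml.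
by move: h2; rewrite -natr1 -/n; lra.
Qed.

End step_approximation.

(** * Method of types *)

Lemma ge0_integral_finite_fibers d (T : measurableType d) (R : realType)
    (m : {measure set T -> \bar R}) (J : finType) (s : T -> J) (h : J -> \bar R) :
  (forall j, measurable (s @^-1` [set j])) -> (forall j, 0 <= h j) ->
  \int[m]_x h (s x) = \sum_j h j * m (s @^-1` [set j]).
Proof.
move=> ms h0.
transitivity (\int[m]_x \sum_j h j * (\1_(s @^-1` [set j]) x)%:E).
  apply: eq_integral => x _; rewrite (bigD1 (s x))//= indicE mem_set// mule1.
  rewrite big1 ?adde0// => j js; rewrite indicE memNset ?mule0//= => sj.
  by rewrite sj eqxx in js.
rewrite ge0_integral_sum//; last 2 first.
- by move=> j; apply: measurable_funeM; exact/measurable_EFinP/measurable_indic.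
- by move=> j x _; rewrite mule_ge0// lee_fin.
apply: eq_bigr => j _; rewrite ge0_integralZl//; last first.
  exact/measurable_EFinP/measurable_indic.
by rewrite integral_indic// setIT.
Qed.

Section words.
Context (R : realType) (I : finType) (n : nat).
Implicit Types w : {ffun 'I_n -> I}.

Definition word_freq w (i : I) : R := (#|[pred k | w k == i]|%:R / n%:R)%R.

Lemma word_freq_ge0 w i : (0 <= word_freq w i)%R.
Proof. by rewrite divr_ge0. Qed.

Lemma sum_word w (h : I -> R) : (0 < n)%N ->
  (\sum_k h (w k) = n%:R * \sum_i word_freq w i * h i)%R.
Proof.
move=> n0; rewrite (partition_big w xpredT)//= mulr_sumr; apply: eq_bigr => i _.
rewrite /word_freq mulrA mulrCA divff ?mulr1 ?pnatr_eq0 -?lt0n//.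
under eq_bigr => k /eqP -> do [].
by rewrite (sumr_const [pred k | w k == i]) mulr_natl.
Qed.

Lemma sum_word_freq w : (0 < n)%N -> (\sum_i word_freq w i = 1)%R.
Proof.
move=> n0; have := sum_word w (fun=> 1%R) n0.
rewrite sumr_const card_ord; under [in RHS]eq_bigr do rewrite mulr1.
have n0' : (n%:R != 0 :> R)%R by rewrite pnatr_eq0 -lt0n.
by move=> /(congr1 (fun x => n%:R^-1 * x)%R); rewrite mulKf// mulVf.
Qed.

Lemma sum_word2 w (h : I -> I -> R) : (0 < n)%N ->
  (\sum_k \sum_l h (w k) (w l) =
   n%:R ^+ 2 * \sum_i \sum_j word_freq w i * word_freq w j * h i j)%R.
Proof.
move=> n0; under eq_bigr do rewrite (sum_word w (h (w _)))//.
rewrite -mulr_sumr (sum_word w (fun i => \sum_j word_freq w j * h i j)%R)//.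
rewrite mulrA -expr2; congr (_ * _)%R; apply: eq_bigr => i _.
by rewrite mulr_sumr; apply: eq_bigr => j _; rewrite mulrA.
Qed.

(** Words of one type share their frequencies, and the product law built from these gives all words
    together mass one. Each type thus contributes at most one, and there are at most [(n+1)^#|I|]
    types. *)
Lemma sum_prod_word_freq : (0 < n)%N ->
  (\sum_w \prod_k word_freq w (w k) <= n.+1%:R ^+ #|I|)%R.
Proof.
move=> n0.
pose typ w : {ffun I -> 'I_n.+1} := [ffun i => inord #|[pred k | w k == i]|].
have typE w i : (typ w i : nat) = #|[pred k | w k == i]|.
  rewrite ffunE inordK// ltnS; apply: leq_trans (max_card _) _.
  by rewrite card_ord.
rewrite (partition_big typ xpredT)//=.
apply: (@le_trans _ _ (\sum_(c : {ffun I -> 'I_n.+1}) 1)%R); last first.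
  by rewrite sumr_const card_ffun card_ord -natrX.
apply: ler_sum => c _.
have [/existsP[w0 /eqP w0c]|/existsPn nw] := boolP [exists w, typ w == c]; last first.
  by rewrite big1 => [|w /eqP wc]; [exact: ler01|have := nw w; rewrite wc eqxx].
have freqE w i : typ w = c -> word_freq w i = word_freq w0 i.
  by move=> wc; rewrite /word_freq -!typE wc w0c.
apply: (@le_trans _ _ (\sum_(w : {ffun 'I_n -> I}) \prod_(k < n) word_freq w0 (w k))%R).
  rewrite [leLHS]big_mkcond; apply: ler_sum => w _; case: ifPn => [/eqP wc|_].
    by rewrite le_eqVlt; apply/orP; left; apply/eqP; apply: eq_bigr => k _; exact: freqE.
  by rewrite prodr_ge0// => k _; exact: word_freq_ge0.
rewrite -(bigA_distr_bigA (fun _ : 'I_n => word_freq w0))/=.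
by rewrite big1// => k _; exact: sum_word_freq.
Qed.

(* Method of types: the word [w] has probability [prod p] equal to the product
   of its own frequencies times [exp (- n H(freq | p))], and there are at most
   [(n + 1) ^ #|I|] types. *)
Lemma types_bound (p : I -> R) (P : pred {ffun 'I_n -> I}) (psi : {ffun 'I_n -> I} -> R)
    (theta : R) : (0 < n)%N -> (forall i, 0 <= p i)%R ->
  (forall w, P w -> (forall k, 0 < p (w k))%R ->
    (theta <= \sum_i word_freq w i * ln (word_freq w i / p i) + psi w)%R) ->
  (\sum_(w | P w) expR (- (n%:R * psi w)) * \prod_k p (w k) <=
   n.+1%:R ^+ #|I| * expR (- (n%:R * theta)))%R.
Proof.
move=> n0 p0 thetaP.
apply: (le_trans _ (ler_wpM2r (expR_ge0 _) (sum_prod_word_freq n0))).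
rewrite mulr_suml [leLHS]big_mkcond; apply: ler_sum => w _.
have rhs0 : (0 <= (\prod_(k < n) word_freq w (w k)) * expR (- (n%:R * theta)))%R.
  by rewrite mulr_ge0 ?expR_ge0// prodr_ge0// => k _; exact: word_freq_ge0.
case: ifPn => // Pw.
have [/forallP pw|/forallPn[k pk]] := boolP [forall k, 0 < p (w k)]%R; last first.
  rewrite (bigD1 k)//= (_ : p (w k) = 0)%R ?mul0r ?mulr0//.
  by apply/eqP; rewrite eq_le p0 andbT leNgt.
have freq0 k : (0 < word_freq w (w k))%R.
  rewrite /word_freq divr_gt0 ?ltr0n//; apply/card_gt0P; exists k.
  by rewrite inE.
have -> : (\prod_k p (w k) = \prod_k word_freq w (w k) *
    expR (- (n%:R * \sum_i word_freq w i * ln (word_freq w i / p i))))%R.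
  rewrite -(sum_word w (fun i => ln (word_freq w i / p i)))// -sumrN expR_sum -big_split/=.
  apply: eq_bigr => k _; have fp0 := divr_gt0 (freq0 k) (pw k); rewrite expRN lnK ?posrE//.
  by rewrite invf_div mulrCA divff ?mulr1 ?gt_eqF.
rewrite mulrCA ler_wpM2l//; first by rewrite prodr_ge0// => k _; exact: ltW.
rewrite -expRD ler_expR -opprD lerN2 -mulrDr addrC.
by rewrite ler_wpM2l//; exact: thetaP.
Qed.

End words.

(** One more power is enough: [e^x >= x^(k+1) / (k+1)!] at [x = n e], together with [n + 1 <= 2 n].
    The constant [B] is the resulting threshold for [n]. *)
Lemma polynomial_le_expR (R : realType) (C e : R) (k : nat) : (0 < e)%R ->
  exists n0, forall n, (n0 <= n)%N -> (C * n.+1%:R ^+ k <= expR (n%:R * e))%R.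
Proof.
move=> e0.
pose B := (`|C| * 2 ^+ k * k.+1`!%:R / e ^+ k.+1)%R.
exists (Num.truncn B).+1 => n nB.
have n0 : (0 < n)%N by exact: leq_trans nB.
have Bn : (B <= n%:R)%R.
  by apply: le_trans (ltW (truncnS_gt B)) _; rewrite ler_nat.
have ne0 : (0 <= n%:R * e)%R by rewrite mulr_ge0// ltW.
apply: (le_trans _ (expR_ge1Dxn k ne0)).
apply: (@le_trans _ _ ((n%:R * e) ^+ k.+1 / k.+1`!%:R)%R); last by rewrite lerDr.
rewrite ler_pdivlMr ?ltr0n ?fact_gt0// exprMn -ler_pdivrMr ?exprn_gt0//.
apply: (@le_trans _ _ (`|C| * (2 ^+ k * n%:R ^+ k) * k.+1`!%:R / e ^+ k.+1)%R).
  rewrite ler_pM2r ?invr_gt0 ?exprn_gt0// ler_pM2r ?ltr0n ?fact_gt0//.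
  apply: (@le_trans _ _ (`|C| * n.+1%:R ^+ k)%R).
    by rewrite ler_wpM2r ?exprn_ge0// ler_norm.
  rewrite ler_wpM2l// -exprMn lerXn2r ?nnegrE ?mulr_ge0//.
  by rewrite -natrM ler_nat mul2n -addnn -addn1 leq_add2l.
have -> : (`|C| * (2 ^+ k * n%:R ^+ k) * k.+1`!%:R / e ^+ k.+1 = B * n%:R ^+ k)%R.
  by rewrite /B; ring.
by rewrite exprS ler_wpM2r ?exprn_ge0.
Qed.

Section word_density.
Context d (T : measurableType d) (R : realType).
Variable nu : {sigma_finite_measure set T -> \bar R}.
Hypothesis nu_fin : nu setT < +oo.
Variables (I : finType) (tau : T -> I).
Hypothesis mtau : forall i, measurable (tau @^-1` [set i]).

Definition fiber_mass i : R := fine (nu (tau @^-1` [set i])).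

Lemma fiber_massE i : nu (tau @^-1` [set i]) = (fiber_mass i)%:E.
Proof.
rewrite fineK// ge0_fin_numE//; apply: le_lt_trans nu_fin.
by apply: le_measure; rewrite ?inE.
Qed.

Lemma fiber_mass_ge0 i : (0 <= fiber_mass i)%R.
Proof. by rewrite fine_ge0. Qed.

Lemma ge0_integral_step (h : I -> R) : (forall i, 0 <= h i)%R ->
  \int[nu]_x (h (tau x))%:E = (\sum_i h i * fiber_mass i)%:E.
Proof.
move=> h0; rewrite (ge0_integral_finite_fibers nu (h := EFin \o h) mtau)//.
by rewrite -sumEFin; apply: eq_bigr => i _; rewrite /= fiber_massE.
Qed.

Lemma sum_fiber_mass : (\sum_i fiber_mass i)%R = fine (nu setT).
Proof.
have := @ge0_integral_step (fun=> 1%R) (fun=> ler01).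
rewrite integral_cst// mul1e => ->/=.
by apply: eq_bigr => i _; rewrite mul1r.
Qed.

Lemma ge0_integral_step2 (h : I -> I -> R) : (forall i j, 0 <= h i j)%R ->
  \int[nu \x nu]_z (h (tau z.1) (tau z.2))%:E =
  (\sum_i \sum_j h i j * (fiber_mass i * fiber_mass j))%:E.
Proof.
move=> h0.
rewrite (@ge0_integral_finite_fibers _ _ _ (nu \x nu) (I * I)%type
  (fun z => (tau z.1, tau z.2)) (fun p => (h p.1 p.2)%:E)); last 2 first.
- move=> [i j]; rewrite (_ : _ @^-1` _ = (tau @^-1` [set i]) `*` (tau @^-1` [set j])).
    exact: measurableX.
  by apply/seteqP; split=> [z [<- <-]|z [/= <- <-]].
- by move=> p; rewrite lee_fin.
rewrite pair_bigA -sumEFin/=; apply: eq_bigr => -[i j] _ /=.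
rewrite (_ : _ @^-1` _ = (tau @^-1` [set i]) `*` (tau @^-1` [set j])); last first.
  by apply/seteqP; split=> [z [<- <-]|z [/= <- <-]].
transitivity ((h i j)%:E * (nu (tau @^-1` [set i]) * nu (tau @^-1` [set j]))).
  by rewrite -product_measure1E.
by rewrite (fiber_massE i) (fiber_massE j) -!EFinM.
Qed.

Variables (n : nat) (w : {ffun 'I_n -> I}).
Hypothesis n0 : (0 < n)%N.
Hypothesis pw : forall k, (0 < fiber_mass (w k))%R.

Let rho := @word_freq R I n w.

(** The law that gives each cell its empirical frequency and is proportional to [nu] inside cells.
    It turns every word into a competitor in the variational problem. *)
Definition word_density x := (rho (tau x) / fiber_mass (tau x))%R.

(** By [pw] no letter of the word is a cell of mass zero, so the default value of division by zero
    meets only zero frequencies. *)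
Lemma word_freq_fiberK i : (rho i / fiber_mass i * fiber_mass i = rho i)%R.
Proof.
have [p0|p0] := eqVneq (fiber_mass i) 0%R; last by rewrite divfK.
rewrite p0 mulr0 /rho /word_freq eq_card0 ?mul0r// => k; rewrite !inE.
by apply/negP => /eqP wk; have := pw k; rewrite wk p0 ltxx.
Qed.

Let fi_ge0 i : (0 <= rho i / fiber_mass i)%R.
Proof. by rewrite divr_ge0 ?word_freq_ge0// fiber_mass_ge0. Qed.

Lemma density_word_density : density nu word_density.
Proof.
split=> [||].
- exact: (measurable_fun_finite_fibers (fun i => rho i / fiber_mass i)%R mtau).
- by move=> x; exact: fi_ge0.
rewrite (@ge0_integral_step (fun i => rho i / fiber_mass i)%R)//.
by under eq_bigr do rewrite word_freq_fiberK; rewrite sum_word_freq.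
Qed.

Lemma entropy1_word_density : entropy1 nu word_density =
  (fine (nu setT) + \sum_i rho i * ln (rho i / fiber_mass i))%:E.
Proof.
rewrite /entropy1 (@ge0_integral_step
  (fun i => rho i / fiber_mass i * ln (rho i / fiber_mass i) + 1)%R); last first.
  by move=> i; rewrite xlnxD1_ge0.
congr (_%:E); rewrite -sum_fiber_mass -big_split/=; apply: eq_bigr => i _.
by rewrite mulrDl mul1r mulrAC word_freq_fiberK addrC.
Qed.

Lemma pair_integral_word_density (g : I -> I -> R) : (forall i j, 0 <= g i j)%R ->
  pair_integral nu (fun z => (g (tau z.1) (tau z.2))%:E) word_density =
  (\sum_i \sum_j rho i * rho j * g i j)%:E.
Proof.
move=> g0; rewrite /pair_integral.
under eq_integral do rewrite -EFinM.
rewrite (@ge0_integral_step2 (fun i j =>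
  g i j * (rho i / fiber_mass i * (rho j / fiber_mass j)))%R); last first.
  by move=> i j; apply: mulr_ge0 => //; apply: mulr_ge0; exact: fi_ge0.
congr (_%:E); apply: eq_bigr => i _; apply: eq_bigr => j _.
by rewrite -mulrA mulrACA !word_freq_fiberK mulrC.
Qed.

Lemma ge0_integral_word_density (h : I -> R) : (forall i, 0 <= h i)%R ->
  \int[nu]_x (h (tau x) * word_density x)%:E = (\sum_i rho i * h i)%:E.
Proof.
move=> h0; rewrite (@ge0_integral_step (fun i => h i * (rho i / fiber_mass i))%R).
  by congr (_%:E); apply: eq_bigr => i _; rewrite -mulrA word_freq_fiberK mulrC.
by move=> i; rewrite mulr_ge0.
Qed.

End word_density.

Section tuple_words.
Context d (T : measurableType d) (R : realType).
Variable nu : {sigma_finite_measure set T -> \bar R}.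
Hypothesis nu_fin : nu setT < +oo.
Variables (I : finType) (tau : T -> I).
Hypothesis mtau : forall i, measurable (tau @^-1` [set i]).

Definition word_of n (t : n.-tuple T) : {ffun 'I_n -> I} := [ffun k => tau (tnth t k)].

Lemma word_of_fiber n (w : {ffun 'I_n -> I}) :
  @word_of n @^-1` [set w] = [set t | forall k, (tau @^-1` [set w k]) (tnth t k)].
Proof.
apply/seteqP; split=> t /=; first by move=> <- k; rewrite ffunE.
by move=> tw; apply/ffunP => k; rewrite ffunE.
Qed.

Lemma ge0_integral_word_of n (h : {ffun 'I_n -> I} -> R) : (forall w, 0 <= h w)%R ->
  \int[tuple_measure nu n]_t (h (word_of t))%:E =
  (\sum_w h w * \prod_k fiber_mass nu tau (w k))%:E.
Proof.
move=> h0.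
rewrite (@ge0_integral_finite_fibers _ _ _ _ _ (@word_of n) (EFin \o h)); last 2 first.
- by move=> w; rewrite word_of_fiber; exact: (@measurable_box _ _ n (fun k => tau @^-1` [set w k])).
- by move=> w; rewrite lee_fin.
rewrite -sumEFin; apply: eq_bigr => w _; rewrite word_of_fiber/= EFinM; congr (_ * _).
rewrite (@tuple_measure_box _ _ _ nu n (fun k => tau @^-1` [set w k]))// -prodEFin.
by apply: eq_bigr => k _; rewrite fiber_massE.
Qed.

End tuple_words.

(** * Upper bound for bounded kernels *)

Section bounded_upper.
Context d (T : measurableType d) (R : realType).
Variable nu : {sigma_finite_measure set T -> \bar R}.
Hypothesis nu_fin : nu setT < +oo.

Definition pair_energy n (k : T * T -> \bar R) (t : n.-tuple T) : \bar R :=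
  ((2 * n%:R)^-1)%:E * \sum_(i < n) \sum_(j < n | j != i) k (tnth t i, tnth t j).

Lemma measurable_pair_energy n (k : T * T -> \bar R) :
  measurable_fun [set: T * T] k -> measurable_fun [set: _] (@pair_energy n k).
Proof.
move=> mk; apply: measurable_funeM; apply: emeasurable_sum => i.
apply: emeasurable_sum_cond => j _; apply: measurableT_comp => //.
by apply: measurable_fun_pair; exact: measurable_tnth.
Qed.

Lemma pair_energy_ge0 n (k : T * T -> \bar R) (t : n.-tuple T) :
  (forall z, 0 <= k z) -> 0 <= pair_energy k t.
Proof.
move=> k0; rewrite mule_ge0 ?lee_fin ?invr_ge0// sume_ge0// => i _.
by rewrite sume_ge0.
Qed.

Lemma le_pair_energy n (k1 k2 : T * T -> \bar R) (t : n.-tuple T) :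
  (forall z, k1 z <= k2 z) -> pair_energy k1 t <= pair_energy k2 t.
Proof.
move=> k12; rewrite lee_wpmul2l ?lee_fin ?invr_ge0// lee_sum// => i _.
by rewrite lee_sum.
Qed.

Definition rpair_energy n (k : T * T -> R) (t : n.-tuple T) : R :=
  ((2 * n%:R)^-1 * \sum_(i < n) \sum_(j < n | j != i) k (tnth t i, tnth t j))%R.

Lemma pair_energyE n (k : T * T -> R) (t : n.-tuple T) :
  pair_energy (EFin \o k) t = (rpair_energy k t)%:E.
Proof.
rewrite /pair_energy /rpair_energy EFinM -sumEFin; congr (_ * _).
by apply: eq_bigr => i _; rewrite -sumEFin.
Qed.

(** The factor in [h] converts the normalization [1/(n-1)] of the decoupling into [1/(2n)]. The
    exponent left on each pair is [lam (n-1) / (2 m)] with [m = n./2], which is at most [lam]. *)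
Lemma exp_pair_energy_hoeffding n (lam : R) (k : T * T -> R) :
  (1 < n)%N -> (0 <= lam)%R -> measurable_fun [set: _] k ->
  (forall z, 0 <= k z)%R ->
  \int[tuple_measure nu n]_t (expR (lam * rpair_energy k t))%:E <=
  nu setT ^+ odd n * (\int[nu \x nu]_z (expR (lam * k z))%:E) ^+ n./2.
Proof.
move=> n1 lam0 mk k0.
have n0 : (0 < n)%N by exact: ltnW.
have n10 : (0 < n.-1)%N by case: n n1 {n0} => [|[]].
have m0 : (0 < n./2)%N by rewrite half_gt0.
pose h z : \bar R := (lam * n.-1%:R / (2 * n%:R) * k z)%:E.
have mh : measurable_fun setT h by apply/measurable_EFinP; exact: measurable_funM.
have := hoeffding_decoupling nu_fin mh (fun=> ltry _) n1.
rewrite (eq_integral (fun t => (expR (lam * rpair_energy k t))%:E)) => [|t _]; last first.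
  rewrite (eq_bigr (fun i => (\sum_(j < n | j != i)
    lam * n.-1%:R / (2 * n%:R) * k (tnth t i, tnth t j))%:E)); last first.
    by move=> i _; rewrite -sumEFin.
  rewrite sumEFin -EFinM/=; congr (expR _)%:E.
  under eq_bigr do rewrite -mulr_sumr.
  rewrite -mulr_sumr !mulrA; congr (_ * _)%R.
  by field; rewrite !pnatr_eq0 -!lt0n n10 n0.
move=> /le_trans; apply.
apply: lee_wpmul2l; first by apply: expe_ge0; exact: measure_ge0.
have ge0int (u : T * T -> R) : 0 <= \int[nu \x nu]_z (expR (u z))%:E.
  by apply: integral_ge0 => z _; rewrite lee_fin expR_ge0.
have leX (x y : \bar R) m : 0 <= x -> x <= y -> x ^+ m <= y ^+ m.
  move=> x0 xy; elim: m => // m IH; rewrite !expeS lee_pmul//; exact: expe_ge0.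
apply: leX; first by apply: integral_ge0 => z _; exact: expeR_ge0.
apply: ge0_le_integral => //.
- by move=> z _; rewrite expeR_ge0.
- by apply: (measurableT_comp (@measurable_expeR R)); exact: measurable_funeM.
- by apply/measurable_EFinP; apply: measurableT_comp => //; exact: measurable_funM.
move=> z _; rewrite -EFinM lee_fin ler_expR mulrA ler_wpM2r//.
have -> : (n%:R / n./2%:R * (lam * n.-1%:R / (2 * n%:R)) =
    lam * (n.-1%:R / (2 * n./2%:R)))%R.
  by field; rewrite !pnatr_eq0 -!lt0n m0 n0.
rewrite -[leRHS]mulr1 ler_wpM2l// ler_pdivrMr ?mulr_gt0 ?ltr0n// mul1r -natrM ler_nat.
rewrite mul2n -subn1 leq_subLR -{1}(odd_double_half n) leq_add2r.
by case: odd.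
Qed.

(** From [(1 - x) e^x <= 1] one gets [e^x <= 1 + x e^x]; at [x = lam u] the last exponential is at
    most [e^(lam M)]. *)
Lemma expR_bounded_le (lam M u : R) : (0 <= lam)%R -> (0 <= u <= M)%R ->
  (expR (lam * u) <= 1 + lam * expR (lam * M) * u)%R.
Proof.
move=> lam0 /andP[u0 uM].
have h1 := expR_ge1Dx (- (lam * u)).
have e0 := expR_gt0 (lam * u).
have : ((1 - lam * u) * expR (lam * u) <= 1)%R.
  by rewrite -[leRHS](expRxMexpNx_1 (lam * u)) mulrC ler_wpM2l// ltW.
have : (expR (lam * u) <= expR (lam * M))%R by rewrite ler_expR ler_wpM2l.
have lu : (0 <= lam * u)%R by rewrite mulr_ge0.
by nra.
Qed.

End bounded_upper.

Lemma lee_wpexpe (R : realDomainType) (x y : \bar R) m : 0 <= x -> x <= y -> x ^+ m <= y ^+ m.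
Proof.
by move=> x0 xy; elim: m => // m IH; rewrite !expeS lee_pmul//; exact: expe_ge0.
Qed.

Section bounded_kernel.
Context d (T : measurableType d) (R : realType).
Variable nu : {sigma_finite_measure set T -> \bar R}.
Hypothesis nu_fin : nu setT < +oo.
Let z := fine (nu setT).

Let z0 : (0 <= z)%R. Proof. by rewrite fine_ge0. Qed.

Let nuE : nu setT = z%:E. Proof. by rewrite fineK// ge0_fin_numE. Qed.

Let nu2E : (nu \x nu) setT = (z ^+ 2)%:E.
Proof.
transitivity (nu setT * nu setT); first by rewrite -product_measure1E// setXTT.
by rewrite nuE.
Qed.

Variables (M : R) (k : T * T -> R).
Hypotheses (M0 : (0 <= M)%R) (mk : measurable_fun [set: T * T] k)
  (kM : forall x, (0 <= k x <= M)%R).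

(* Smallness in L1 becomes an exponential moment bound, through which Young's
   inequality controls [k - g] under every density of bounded entropy. *)
Lemma exp_dist_step (lam : R) (I : finType) (tau : T -> I) (g : I -> I -> R) :
  (0 < lam)%R -> (forall i, measurable (tau @^-1` [set i])) ->
  (forall i j, 0 <= g i j <= M)%R ->
  \int[nu \x nu]_x (`|k x - g (tau x.1) (tau x.2)|)%:E <= ((lam * expR (lam * M))^-1)%:E ->
  \int[nu \x nu]_x (expR (lam * `|k x - g (tau x.1) (tau x.2)|))%:E <= (z ^+ 2 + 1)%:E.
Proof.
move=> lam0 mtau gM kg.
have mdst : measurable_fun setT (fun x => `|k x - g (tau x.1) (tau x.2)|)%R.
  apply: measurableT_comp => //; apply: measurable_funB => //.
  exact: (measurable_step g mtau).
have c0 : (0 < lam * expR (lam * M))%R by rewrite mulr_gt0 ?expR_gt0.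
apply: (@le_trans _ _ (\int[nu \x nu]_x (1 + (lam * expR (lam * M))%:E *
    (`|k x - g (tau x.1) (tau x.2)|)%:E))).
  apply: ge0_le_integral => //.
  - by apply/measurable_EFinP; apply: measurableT_comp => //; exact: measurable_funM.
  - by apply: emeasurable_funD => //; apply: measurable_funeM; exact/measurable_EFinP.
  move=> x _; rewrite -EFinM -EFinD lee_fin; apply: expR_bounded_le; first exact: ltW.
  have /andP[? ?] := kM x; have /andP[? ?] := gM (tau x.1) (tau x.2).
  by rewrite normr_ge0/= ler_norml; apply/andP; split; lra.
rewrite ge0_integralD//; last 2 first.
- by move=> x _; rewrite -EFinM lee_fin mulr_ge0// ltW.
- by apply: measurable_funeM; exact/measurable_EFinP.
have -> : \int[nu \x nu]__ 1 = (z ^+ 2)%:E.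
  by rewrite -nu2E -[RHS]mul1e -integral_cst.
rewrite ge0_integralZl//; last 2 first.
- exact/measurable_EFinP.
- by rewrite lee_fin ltW.
rewrite EFinD leeD2l//; apply: (le_trans (lee_wpmul2l _ kg)).
  by rewrite lee_fin ltW.
by rewrite -EFinM divff// gt_eqF.
Qed.

(** The competitor is the word density: it meets the moment constraint within [e], so its free
    energy with kernel [k] is at least [theta]. Passing from [k] to the step kernel costs at most
    [eta], and [entropy1] of the word density is [z] plus the relative entropy of the
    frequencies. *)
Lemma variational_step (I : finType) (tau : T -> I) (g : I -> I -> R) (g2 : I -> R)
    (q : T -> R) (D : set R) (theta e lam eta : R) :
  (forall i, measurable (tau @^-1` [set i])) -> (forall i j, 0 <= g i j <= M)%R ->
  (forall i, 0 <= g2 i)%R -> measurable_fun [set: T] q -> (forall x, 0 <= q x)%R ->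
  (0 < e)%R -> (0 < lam)%R -> (2 * `|theta| + (z ^+ 2 + 1) < 2 * (lam * eta))%R ->
  (forall x, `|q x - g2 (tau x)| <= e / 2)%R ->
  \int[nu \x nu]_x (expR (lam * `|k x - g (tau x.1) (tau x.2)|))%:E <= (z ^+ 2 + 1)%:E ->
  (forall f y, density nu f -> D y ->
    (y - e)%:E <= \int[nu]_x (q x * f x)%:E <= (y + e)%:E ->
    theta%:E <= entropy1 nu f + (2^-1)%:E * pair_integral nu (EFin \o k) f) ->
  forall n (w : {ffun 'I_n -> I}) (y : R), (0 < n)%N ->
    (forall i, 0 < fiber_mass nu tau (w i))%R -> D y ->
    (`|y - n%:R^-1 * \sum_i g2 (w i)| <= e / 2)%R ->
    (theta - eta - z <= \sum_i word_freq R w i * ln (word_freq R w i / fiber_mass nu tau i) +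
      2^-1 * \sum_i \sum_j word_freq R w i * word_freq R w j * g i j)%R.
Proof.
move=> mtau gM g20 mq q0 e0 lam0 lameta qg2 expC0 thetaP n w y.
have g0 i j : (0 <= g i j)%R by have /andP[] := gM i j.
pose dst x := (`|k x - g (tau x.1) (tau x.2)|)%R.
have dst0 x : (0 <= dst x)%R by exact: normr_ge0.
have mdst : measurable_fun setT dst.
  apply: measurableT_comp => //; apply: measurable_funB => //.
  exact: (measurable_step g mtau).
move=> n0 pw Dy yg; set f := word_density nu tau w.
have Df : density nu f by exact: density_word_density.
have [mf f0 f1] := Df.
set H := (\sum_i _ * ln _)%R; set S := (\sum_i \sum_j _)%R.
have EE : entropy1 nu f = (z + H)%:E by exact: entropy1_word_density.
have SE : pair_integral nu (fun x => (g (tau x.1) (tau x.2))%:E) f = S%:E.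
  by exact: pair_integral_word_density.
have S0 : (0 <= S)%R.
  rewrite -lee_fin -SE integral_ge0// => x _; rewrite -EFinM lee_fin.
  by rewrite mulr_ge0// mulr_ge0.
have mqf (u : T -> R) : measurable_fun setT u ->
    measurable_fun setT (fun x => (u x * f x)%:E).
  by move=> mu; apply/measurable_EFinP; exact: measurable_funM.
have mg2 : measurable_fun setT (g2 \o tau) by exact: measurable_fun_finite_fibers.
have g2f c : (0 <= c)%R -> \int[nu]_x ((g2 (tau x) + c) * f x)%:E =
    (n%:R^-1 * \sum_i g2 (w i) + c)%:E.
  move=> c0; rewrite (@ge0_integral_word_density _ _ _ nu nu_fin _ _ mtau _ w pw (fun i => g2 i + c)%R).
    rewrite (sum_word w g2 n0) mulKf ?pnatr_eq0 -?lt0n//; congr (_%:E).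
    under eq_bigr do rewrite mulrDr.
    by rewrite big_split/= -mulr_suml sum_word_freq// mul1r.
  by move=> i; rewrite addr_ge0.
have e20' : (0 <= e / 2)%R by rewrite divr_ge0// ltW.
(* One half of [e] is the distance from [q] to its step version, the other the distance from [y] to
   the empirical mean of the step version. *)
have cond : (y - e)%:E <= \int[nu]_x (q x * f x)%:E <= (y + e)%:E.
  move: yg; rewrite ler_norml => /andP[yg1 yg2]; apply/andP; split; last first.
    apply: (@le_trans _ _ (\int[nu]_x ((g2 (tau x) + e / 2) * f x)%:E)); last first.
      by rewrite g2f// lee_fin; lra.
    apply: ge0_le_integral => //.
    - by move=> x _; rewrite lee_fin mulr_ge0.
    - exact: mqf.
    - by apply: mqf; exact: measurable_funD.
    move=> x _; rewrite lee_fin ler_wpM2r//.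
    by have := qg2 x; rewrite ler_norml => /andP[_]; lra.
  have : (n%:R^-1 * \sum_i g2 (w i) + 0)%:E <= \int[nu]_x (q x * f x)%:E + (e / 2)%:E.
    rewrite -g2f//.
    have -> : \int[nu]_x (q x * f x)%:E + (e / 2)%:E =
        \int[nu]_x ((q x * f x)%:E + (e / 2)%:E * (f x)%:E).
      have mf2 : measurable_fun setT (fun x => (e / 2)%:E * (f x)%:E).
        by apply: measurable_funeM; exact/measurable_EFinP.
      have f20 x : 0 <= (e / 2)%:E * (f x)%:E by rewrite -EFinM lee_fin mulr_ge0.
      have qf0 x : 0 <= (q x * f x)%:E by rewrite lee_fin mulr_ge0.
      rewrite ge0_integralD//; last exact: mqf.
      have -> : \int[nu]_x ((e / 2)%:E * (f x)%:E) = (e / 2)%:E * \int[nu]_x (f x)%:E.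
        apply: ge0_integralZl => //; first exact/measurable_EFinP.
        by move=> x _; rewrite lee_fin.
      by rewrite f1 mule1.
    apply: ge0_le_integral => //.
    - by move=> x _; rewrite lee_fin mulr_ge0// addr_ge0.
    - by apply: mqf; exact: measurable_funD.
    - apply: emeasurable_funD; first exact: mqf.
      by apply: measurable_funeM; exact/measurable_EFinP.
    move=> x _; rewrite -EFinM -EFinD lee_fin -mulrDl ler_wpM2r//.
    by have := qg2 x; rewrite ler_norml => /andP[+ _]; lra.
  by rewrite -leeBlDr// -EFinB; apply: le_trans; rewrite lee_fin; lra.
have := thetaP f y Df Dy cond; rewrite EE.
have mff := measurable_tensor mf.
have ff0 x : (0 <= f x.1 * f x.2)%R by rewrite mulr_ge0.
have kle : pair_integral nu (EFin \o k) f <= S%:E + pair_integral nu (EFin \o dst) f.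
  rewrite -SE -ge0_integralD//; last 4 first.
  - by move=> x _; rewrite -EFinM lee_fin mulr_ge0.
  - under eq_fun do rewrite -EFinM; apply/measurable_EFinP.
    by apply: measurable_funM => //; exact: (measurable_step g mtau).
  - by move=> x _; rewrite -EFinM lee_fin mulr_ge0.
  - under eq_fun do rewrite -EFinM; apply/measurable_EFinP.
    exact: measurable_funM.
  apply: ge0_le_integral => //.
  - by move=> x _; rewrite -EFinM lee_fin mulr_ge0//; have /andP[] := kM x.
  - by under eq_fun do rewrite -EFinM; apply/measurable_EFinP; exact: measurable_funM.
  - apply: emeasurable_funD; under eq_fun do rewrite -EFinM; apply/measurable_EFinP.
      by apply: measurable_funM => //; exact: (measurable_step g mtau).
    exact: measurable_funM.
  move=> x _; rewrite -!EFinM -EFinD lee_fin -mulrDl ler_wpM2r//.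
  by rewrite -lerBlDl ler_norm.
have := @pair_integral_young _ _ _ nu f (fun x => lam * dst x)%R (cst 0) Df.
move=> /(_ (measurable_funM (measurable_cst _) mdst)).
move=> /(_ (fun x => mulr_ge0 (ltW lam0) (dst0 x)) (measurable_cst _) (fun=> lexx _)).
rewrite EE.
rewrite [X in _ <= _ + X + _](_ : _ = 0); last first.
  by rewrite /pair_integral; under eq_integral do rewrite /= mul0e; rewrite integral0.
rewrite adde0.
under [X in _ <= _ + X]eq_integral do rewrite sube0/=.
rewrite (_ : pair_integral nu _ f = lam%:E * pair_integral nu (EFin \o dst) f); last first.
  rewrite -ge0_integralZl//; last 3 first.
  - by under eq_fun do rewrite -EFinM; apply/measurable_EFinP; exact: measurable_funM.
  - by move=> x _; rewrite -EFinM lee_fin mulr_ge0.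
  - by rewrite lee_fin ltW.
  by apply: eq_integral => x _; rewrite -!EFinM/= mulrA.
move=> /le_trans /(_ (leeD2l _ expC0)).
have : 0 <= pair_integral nu (EFin \o dst) f.
  by apply: integral_ge0 => x _; rewrite -EFinM lee_fin mulr_ge0.
case: (pair_integral nu (EFin \o dst) f) kle => [pd| |]//; last first.
  by move=> _ _; rewrite gt0_muley ?lte_fin//.
move=> kle; rewrite lee_fin => pd0; rewrite -!EFinM -!EFinD lee_fin => pdle.
move=> /le_trans /(_ (leeD2l _ (lee_wpmul2l _ kle))).
have half0 : 0 <= (2^-1)%:E :> \bar R by rewrite lee_fin invr_ge0.
move=> /(_ half0); rewrite -[S%:E + _]EFinD -EFinM -EFinD lee_fin => h.
(* If the bound failed, the entropy would be below [theta], while [pd], the mean distance of the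
   kernels, would exceed [2 eta]. Young's inequality bounds [lam * pd] by twice the entropy plus
   [z^2 + 1], which contradicts the choice of [lam * eta]. *)
rewrite leNgt; apply/negP => hlt.
have h2 : (2 * eta < pd)%R by lra.
have h3 : (2 * (lam * eta) < lam * pd)%R by rewrite mulrCA ltr_pM2l.
have h4 := ler_norm theta; have h5 := normr_ge0 theta.
have eta0 : (0 < eta)%R.
  by rewrite -(pmulr_rgt0 _ lam0); have := sqr_ge0 z; lra.
lra.
Qed.

(** Where the energy of the kernel distance is at most [n eta], the weight is compared with that of
    the step kernel and [types_bound] applies; this is [A]. Elsewhere the weight is bounded by one
    and the Chernoff factor [B] by decoupling. *)
Lemma bounded_upper_bound (Mq : R) (q : T -> R) (D : set R) (theta e : R) :
  measurable_fun [set: T] q -> (forall x, 0 <= q x <= Mq)%R ->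
  measurable D -> (0 < e)%R ->
  (forall f y, density nu f -> D y ->
    (y - e)%:E <= \int[nu]_x (q x * f x)%:E <= (y + e)%:E ->
    theta%:E <= entropy1 nu f + (2^-1)%:E * pair_integral nu (EFin \o k) f) ->
  exists n0, forall n, (n0 <= n)%N ->
    \int[tuple_measure nu n]_(t in [set t | D (n%:R^-1 * \sum_i q (tnth t i))%R])
      (expR (- rpair_energy k t))%:E <= (expR (- (n%:R * (theta - z - e))))%:E.
Proof.
move=> mq qMq mD e0 thetaP.
pose eta := (e / 4)%R; have eta0 : (0 < eta)%R by rewrite divr_gt0.
pose C0 := (z ^+ 2 + 1)%R.
have C01 : (1 <= C0)%R by rewrite lerDr sqr_ge0.
(* In [lam * eta], the term [ln C0] beats the decoupling bound [C0^n], the terms [2 |theta| + C0]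
   beat the target rate and meet the condition of [variational_step], and the final [1] leaves a
   factor [e^-n], at most one half. *)
pose lam := ((ln C0 + 2 * `|theta| + C0 + 1) / eta)%R.
have lnC0 : (0 <= ln C0)%R by rewrite ln_ge0.
have lameta : (lam * eta = ln C0 + 2 * `|theta| + C0 + 1)%R.
  by rewrite /lam divfK// gt_eqF.
have lam0 : (0 < lam)%R.
  by rewrite divr_gt0//; have := normr_ge0 theta; lra.
pose e' := ((lam * expR (lam * M))^-1)%R.
have e'0 : (0 < e')%R by rewrite invr_gt0 mulr_gt0 ?expR_gt0.
have [I1 [tau1 [g1 [mtau1 g1M kg1]]]] := step_approx_bounded nu_fin M0 mk kM e'0.
have e20 : (0 < e / 2)%R by rewrite divr_gt0.
have q0 x : (0 <= q x)%R by have /andP[] := qMq x.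
have [|I2 [tau2 [g2' [mtau2 qg2']]]] := @step_approx_unif _ _ _ q Mq mq _ _ e20.
  by move=> x; have /andP[? ?] := qMq x; rewrite ger0_norm.
pose I : finType := (I1 * I2)%type; pose tau x : I := (tau1 x, tau2 x).
pose g (i j : I) := g1 i.1 j.1.
pose g2 (i : I) := if (g2' i.2 < 0)%R then 0%R else g2' i.2.
have g20 i : (0 <= g2 i)%R by rewrite /g2; case: ltP.
have qg2 x : (`|q x - g2 (tau x)| <= e / 2)%R.
  apply: le_trans (qg2' x); rewrite /g2/=; case: ltP => // g20'.
  rewrite subr0 !ger0_norm//; have := q0 x; lra.
have mtau i : measurable (tau @^-1` [set i]).
  case: i => i j; rewrite (_ : _ @^-1` _ = tau1 @^-1` [set i] `&` tau2 @^-1` [set j]).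
    exact: measurableI.
  by apply/seteqP; split=> [x [<- <-]|x [/= <- <-]].
have gM i j : (0 <= g i j <= M)%R by exact: g1M.
have g0 i j : (0 <= g i j)%R by have /andP[] := gM i j.
have expC0 := exp_dist_step lam0 mtau gM kg1.
pose dst x := (`|k x - g (tau x.1) (tau x.2)|)%R.
have dst0 x : (0 <= dst x)%R by exact: normr_ge0.
have mdst : measurable_fun setT dst.
  apply: measurableT_comp => //; apply: measurable_funB => //.
  exact: (measurable_step g mtau).
have stepP := @variational_step I tau g g2 q D theta e lam eta mtau gM g20 mq q0 e0 lam0.
move: stepP; rewrite lameta => /(_ (ltac:(have := normr_ge0 theta; rewrite -/C0; lra)) qg2 expC0 thetaP) stepP.
(* Of the allowance [e], replacing the kernel takes [2 eta = e / 2]. The other half absorbs the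
   number of types, the diagonal terms and the factor two that leaves room for [B]. *)
have [n1 n1P] := @polynomial_le_expR R (2 * expR (M / 2)) (e / 2) #|I| e20.
exists (maxn 2 n1) => n; rewrite geq_max => /andP[n2 nn1].
have n0 : (0 < n)%N by exact: leq_trans n2.
have nR0 : (0 < n%:R :> R)%R by rewrite ltr0n.
set S := [set t | _].
have mS : measurable S.
  rewrite -[X in measurable X]setTI.
  have : measurable_fun [set: n.-tuple T] (fun t => n%:R^-1 * \sum_i q (tnth t i))%R.
    apply: measurable_funM => //; apply: measurable_sum => i.
    by apply: measurableT_comp => //; exact: measurable_tnth.
  by move=> /(_ measurableT _ mD).
pose P : pred {ffun 'I_n -> I} := fun w => `[< exists2 t, S t & word_of tau t = w >].
pose psi (w : {ffun 'I_n -> I}) := (2^-1 * \sum_i \sum_j word_freq R w i * word_freq R w j * g i j)%R.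
have mVk (u : T * T -> R) : measurable_fun setT u -> measurable_fun setT (fun t : n.-tuple T => rpair_energy u t).
  move=> mu; apply: measurable_funM => //; apply: measurable_sum => i.
  under eq_fun do rewrite big_mkcond; apply: measurable_sum => j; case: (j != i) => //.
  apply: measurableT_comp => //.
  by apply: measurable_fun_pair; exact: measurable_tnth.
pose A (t : n.-tuple T) := (expR (n%:R * eta + M / 2) * (if P (word_of tau t)
   then expR (- (n%:R * psi (word_of tau t))) else 0))%R.
pose B (t : n.-tuple T) := (expR (- (lam * eta * n%:R)) * expR (lam * rpair_energy dst t))%R.
have A0 t : (0 <= A t)%R by rewrite mulr_ge0 ?expR_ge0//; case: ifP => //; rewrite expR_ge0.
have B0 t : (0 <= B t)%R by rewrite mulr_ge0 ?expR_ge0.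
have mword (w : {ffun 'I_n -> I}) : measurable (@word_of _ _ I tau n @^-1` [set w]).
  rewrite word_of_fiber.
  exact: (@measurable_box _ _ n (fun j => tau @^-1` [set w j])).
have mA : measurable_fun setT A.
  exact: (measurable_fun_finite_fibers (fun w => expR (n%:R * eta + M / 2) *
    (if P w then expR (- (n%:R * psi w)) else 0))%R mword).
have mB : measurable_fun setT B.
  apply: measurable_funM => //; apply: measurableT_comp => //.
  by apply: measurable_funM => //; exact: mVk.
have kAB t : S t -> (expR (- rpair_energy k t) <= A t + B t)%R.
  move=> St; have Pw : P (word_of tau t) by apply/asboolP; exists t.
  rewrite /A Pw -expRD; set w := word_of tau t.
  pose Vg := rpair_energy (fun x => g (tau x.1) (tau x.2)) t.
  have h1 : (Vg <= rpair_energy k t + rpair_energy dst t)%R.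
    rewrite /rpair_energy -mulrDr ler_wpM2l// -big_split/=; apply: ler_sum => i _.
    rewrite -big_split/=; apply: ler_sum => j _; rewrite -lerBlDl /dst distrC.
    exact: ler_norm.
  (* The quadratic form [psi] also counts the [n] diagonal pairs, each at most [M]. With the weight
     [1 / (2n)] they amount to at most [M / 2]. *)
  have h2 : (n%:R * psi w - M / 2 <= Vg)%R.
    have split_diag : (\sum_i \sum_j g (w i) (w j) =
        \sum_i \sum_(j | j != i) g (w i) (w j) + \sum_i g (w i) (w i))%R.
      by rewrite -big_split/=; apply: eq_bigr => i _; rewrite (bigD1 i)//= addrC.
    have diagM : (\sum_i g (w i) (w i) <= n%:R * M)%R.
      apply: (@le_trans _ _ (\sum_(i < n) M)%R).
        by apply: ler_sum => i _; have /andP[] := gM (w i) (w i).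
      by rewrite sumr_const card_ord mulr_natl.
    have VgE : (2 * n%:R * Vg = \sum_i \sum_(j | j != i) g (w i) (w j))%R.
      rewrite /Vg /rpair_energy mulVKf ?mulf_neq0 ?gt_eqF//.
      by apply: eq_bigr => i _; apply: eq_bigr => j _; rewrite !ffunE.
    have := sum_word2 w g n0; rewrite split_diag -VgE => eqn.
    have psiE : (\sum_i \sum_j word_freq R w i * word_freq R w j * g i j = 2 * psi w)%R.
      by rewrite /psi mulVKf.
    rewrite psiE in eqn.
    rewrite -(ler_pM2l (_ : 0 < 2 * n%:R)%R) ?mulr_gt0//.
    by move: eqn diagM; rewrite expr2; nra.
  have Vk0 : (0 <= rpair_energy k t)%R.
    rewrite mulr_ge0// sumr_ge0// => i _; rewrite sumr_ge0// => j _.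
    by have /andP[] := kM (tnth t i, tnth t j).
  have [hd|hd] := leP (rpair_energy dst t) (n%:R * eta)%R.
    by apply: ler_wpDr => //; rewrite ler_expR; lra.
  apply: (@le_trans _ _ 1%R); first by rewrite -[leRHS]expR0 ler_expR oppr_le0.
  apply: ler_wpDl; first by rewrite expR_ge0.
  rewrite /B -expRD -[leLHS]expR0 ler_expR.
  by rewrite -mulrA [(eta * _)%R]mulrC -mulrN -mulrDr mulr_ge0 ?ltW//; lra.
have intA : \int[tuple_measure nu n]_(t in S) (A t)%:E <=
    (2^-1 * expR (- (n%:R * (theta - z - e))))%:E.
  apply: (@le_trans _ _ (\int[tuple_measure nu n]_t (A t)%:E)).
    apply: ge0_subset_integral => //; first exact/measurable_EFinP.
    by move=> t _; rewrite lee_fin.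
  rewrite (ge0_integral_word_of nu_fin mtau (h := fun w => expR (n%:R * eta + M / 2) *
    (if P w then expR (- (n%:R * psi w)) else 0))%R); last first.
    by move=> w; rewrite mulr_ge0 ?expR_ge0//; case: ifP => // _; rewrite expR_ge0.
  rewrite lee_fin.
  have -> : (\sum_w expR (n%:R * eta + M / 2) * (if P w then expR (- (n%:R * psi w)) else 0) *
      \prod_j fiber_mass nu tau (w j) = expR (n%:R * eta + M / 2) *
      \sum_(w | P w) expR (- (n%:R * psi w)) * \prod_j fiber_mass nu tau (w j))%R.
    rewrite [in RHS]big_mkcond mulr_sumr; apply: eq_bigr => w _.
    by case: ifP => _; rewrite ?mulr0 ?mul0r// mulrA.
  have := @types_bound R I n (fiber_mass nu tau) P psi (theta - eta - z)%R n0.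
  move=> /(_ (fun i => fiber_mass_ge0 nu tau i)).
  have Pstep w : P w -> (forall j, 0 < fiber_mass nu tau (w j))%R ->
      (theta - eta - z <= \sum_i word_freq R w i *
        ln (word_freq R w i / fiber_mass nu tau i) + psi w)%R.
    move=> /asboolP[t St tw] pw; apply: (stepP n w _ n0 pw St).
    rewrite -mulrBr -sumrB normrM gtr0_norm ?invr_gt0// ler_pdivrMl//.
    apply: (le_trans (ler_norm_sum _ _ _)).
    apply: (@le_trans _ _ (\sum_(i < n) (e / 2))%R).
      by apply: ler_sum => i _; rewrite -tw ffunE; exact: qg2.
    by rewrite sumr_const card_ord mulr_natl.
  move=> /(_ Pstep) tb.
  have := n1P n nn1; move=> np.
  apply: (le_trans (ler_wpM2l (expR_ge0 _) tb)).
  rewrite -(ler_pM2l (ltr0n R 2)) mulVKf// expRD.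
  have -> : (2%:R * (expR (n%:R * eta) * expR (M / 2) *
      (n.+1%:R ^+ #|I| * expR (- (n%:R * (theta - eta - z))))) =
      (2 * expR (M / 2) * n.+1%:R ^+ #|I|) *
      (expR (n%:R * eta) * expR (- (n%:R * (theta - eta - z)))))%R by ring.
  apply: (le_trans (ler_wpM2r _ np)); first by rewrite mulr_ge0 ?expR_ge0.
  rewrite -!expRD ler_expR le_eqVlt; apply/orP; left; apply/eqP.
  by rewrite /eta; field.
have intB : \int[tuple_measure nu n]_(t in S) (B t)%:E <=
    (2^-1 * expR (- (n%:R * (theta - z - e))))%:E.
  apply: (@le_trans _ _ (\int[tuple_measure nu n]_t (B t)%:E)).
    apply: ge0_subset_integral => //; first exact/measurable_EFinP.
    by move=> t _; rewrite lee_fin.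
  have mVd : measurable_fun setT (fun t : n.-tuple T => (expR (lam * rpair_energy dst t))%:E).
    apply/measurable_EFinP; apply: measurableT_comp => //.
    by apply: measurable_funM => //; exact: mVk.
  under eq_integral do rewrite EFinM.
  rewrite ge0_integralZl//.
  have hh := exp_pair_energy_hoeffding nu_fin n2 (ltW lam0) mdst dst0.
  have {hh} : \int[tuple_measure nu n]_t (expR (lam * rpair_energy dst t))%:E <= (C0 ^+ n)%:E.
    apply: (le_trans hh); rewrite nuE.
    apply: (@le_trans _ _ ((z%:E) ^+ odd n * (C0%:E) ^+ n./2)).
      rewrite lee_wpmul2l ?expe_ge0 ?lee_fin//; apply: lee_wpexpe => //.
      by apply: integral_ge0 => x _; rewrite lee_fin expR_ge0.
    rewrite -!EFin_expe -EFinM lee_fin.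
    apply: (@le_trans _ _ (C0 ^+ odd n * C0 ^+ n./2)%R).
      rewrite ler_wpM2r ?exprn_ge0 ?(le_trans ler01)//.
      by case: odd; rewrite ?expr0// !expr1 /C0; nra.
    rewrite -exprD ler_weXn2l//.
    by rewrite -[leqRHS]odd_double_half leq_add2l -addnn leq_addr.
  move=> hh; apply: (le_trans (lee_wpmul2l _ hh)); first by rewrite lee_fin expR_ge0.
  rewrite -EFinM lee_fin.
  have C0E : (C0 ^+ n = expR (n%:R * ln C0))%R.
    by rewrite expRM_natl lnK// posrE (lt_le_trans ltr01).
  rewrite C0E -expRD lameta.
  have en : (expR (- n%:R) <= 2^-1 :> R)%R.
    rewrite expRN lef_pV2 ?posrE ?expR_gt0//.
    apply: le_trans (expR_ge1Dx _).
    by rewrite -[leLHS]natr1 addrC lerD2l ler1n.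
  apply: (@le_trans _ _ (expR (- n%:R) * expR (- (n%:R * (theta - z - e))))%R); last first.
    by rewrite ler_wpM2r ?expR_ge0.
  rewrite -expRD ler_expR.
  have h4 := ler_norm theta; have h5 := normr_ge0 theta.
  have h6 : (0 <= n%:R * (2 * `|theta| + C0 - theta + z + e))%R.
    by have h7 := z0; rewrite mulr_ge0//; lra.
  by lra.
apply: (@le_trans _ _ (\int[tuple_measure nu n]_(t in S) ((A t)%:E + (B t)%:E))).
  apply: ge0_le_integral => //.
  - apply/measurable_EFinP; apply: measurable_funTS; apply: measurableT_comp => //.
    by apply: measurableT_comp => //; exact: mVk.
  - apply: measurable_funTS.
    by apply: emeasurable_funD; exact/measurable_EFinP.
rewrite ge0_integralD//; last 4 first.
- by move=> t _; rewrite lee_fin.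
- by apply: measurable_funTS; exact/measurable_EFinP.
- by move=> t _; rewrite lee_fin.
- by apply: measurable_funTS; exact/measurable_EFinP.
apply: (le_trans (leeD intA intB)); rewrite -EFinD lee_fin -mulrDl.
by rewrite ler_piMl ?expR_ge0//; lra.
Qed.

End bounded_kernel.

(** * Compactness of densities of bounded entropy *)

Lemma ultra_cvg_bounded (R : realType) (U : set_system nat) (UU : UltraFilter U)
    (u : nat -> R) (a b : R) : (forall n, a <= u n <= b)%R ->
  exists2 l : R, (a <= l <= b)%R & u @ U --> l.
Proof.
move=> uab.
have Uab : U (u @^-1` `[a, b]%classic) by apply: filterE => n; rewrite /= in_itv/=; exact: uab.
have := @segment_compact R a b => /(_ (u @ U) _ Uab)[l [lab lU]].
exists l; first by move: lab; rewrite /= in_itv.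
move=> B lB; have [//|UC] := in_ultra_setVsetC (u @^-1` B) UU.
by have [x [nBx Bx]] := lU (~` B) B UC lB.
Qed.

Section setwise_limit.
Context d (T : measurableType d) (R : realType).
Variable nu : {sigma_finite_measure set T -> \bar R}.
Hypothesis nu_fin : nu setT < +oo.
Let z := fine (nu setT).
Let z0 : (0 <= z)%R. Proof. by rewrite fine_ge0. Qed.
Let nuE : nu setT = z%:E. Proof. by rewrite fineK// ge0_fin_numE. Qed.
Let nuA_fin A : measurable A -> nu A \is a fin_num.
Proof.
move=> mA; rewrite ge0_fin_numE//; apply: le_lt_trans nu_fin.
by apply: le_measure; rewrite ?inE.
Qed.

(** Young's inequality with test function [lam] times the indicator of [E]. The choice
    [delta = e^-lam] makes [e^lam * nu E] at most one, and [lam] makes the remaining quotient at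
    most [e]. *)
Lemma entropy_uniform_continuity (C e : R) : (0 < e)%R -> exists2 delta : R, (0 < delta)%R &
  forall f E, density nu f -> entropy1 nu f <= C%:E -> measurable E ->
    nu E <= delta%:E -> \int[nu]_(x in E) (f x)%:E <= e%:E.
Proof.
move=> e0.
pose lam := ((`|C| + z + 1) / e)%R.
have lam0 : (0 < lam)%R by rewrite divr_gt0// addrC ltr_pwDl// addr_ge0.
exists (expR (- lam)); first exact: expR_gt0.
move=> f E Df fC mE nuEd; have [mf f0 f1] := Df.
have mlam : measurable_fun setT (fun x => lam * \1_E x)%R.
  by apply: measurable_funM => //; exact: measurable_indic.
have lam1 x : (0 <= lam * \1_E x)%R by rewrite mulr_ge0// ltW.
have := integral_young Df mlam lam1.
have -> : \int[nu]_x (lam * \1_E x * f x)%:E = lam%:E * \int[nu]_(x in E) (f x)%:E.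
  rewrite [in RHS]integral_mkcond -ge0_integralZl//; last 3 first.
  - apply/(measurable_restrictT _ _).1 => //.
    by apply: measurable_funTS; exact/measurable_EFinP.
  - by move=> x _; rewrite /patch; case: ifP => // _; rewrite lee_fin.
  - by rewrite lee_fin ltW.
  apply: eq_integral => x _; rewrite /patch indicE -mulrA EFinM; congr (_ * _).
  by case: (_ \in _); rewrite ?mul1r ?mul0r.
have e2 : \int[nu]_x (expR (lam * \1_E x))%:E <= (z + 1)%:E.
  apply: (@le_trans _ _ (\int[nu]_x (1%:E + (expR lam)%:E * (\1_E x)%:E))).
    apply: ge0_le_integral => //.
    - by apply/measurable_EFinP; exact: measurableT_comp.
    - apply: emeasurable_funD => //; apply: measurable_funeM.
      exact/measurable_EFinP/measurable_indic.
    move=> x _; rewrite -EFinM -EFinD lee_fin indicE; case: (_ \in _).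
      by rewrite !mulr1 lerDr.
    by rewrite !mulr0 expR0 addr0.
  rewrite ge0_integralD//; last first.
    by apply: measurable_funeM; exact/measurable_EFinP/measurable_indic.
  rewrite EFinD; apply: leeD.
    have -> : \int[nu]__ 1 = z%:E by rewrite -nuE -[RHS]mul1e -integral_cst.
    by [].
  rewrite ge0_integralZl//; last exact/measurable_EFinP/measurable_indic.
  rewrite integral_indic// setIT; apply: (le_trans (lee_wpmul2l _ nuEd)).
    by rewrite lee_fin expR_ge0.
  by rewrite -EFinM expRxMexpNx_1.
move=> /le_trans /(_ (leeD fC e2)); rewrite -EFinD -lee_pdivlMl// => /le_trans; apply.
rewrite -EFinM lee_fin mulrC ler_pdivrMr// /lam mulrCA divff ?gt_eqF// mulr1.
by rewrite addrA lerD2r lerD2r ler_norm.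
Qed.

Variables (U : set_system nat) (UU : UltraFilter U) (f : nat -> T -> R) (C : R).
Hypotheses (Df : forall n, density nu (f n)) (fC : forall n, entropy1 nu (f n) <= C%:E).

(** The value zero off the measurable sets keeps [mass n E] in [[0, 1]] for every [E], so the limit
    along the ultrafilter is defined without side conditions. *)
Definition mass n (E : set T) : R :=
  if `[< measurable E >] then fine (\int[nu]_(x in E) (f n x)%:E) else 0%R.

Let mfE n : measurable_fun setT (fun x => (f n x)%:E).
Proof. by apply/measurable_EFinP; have [] := Df n. Qed.

Let intf_le1 n E : measurable E -> \int[nu]_(x in E) (f n x)%:E <= 1.
Proof.
move=> mE; have [_ f0 f1] := Df n; rewrite -f1; apply: ge0_subset_integral => //.
by move=> x _; rewrite lee_fin.
Qed.

Let massE n E : measurable E -> (mass n E)%:E = \int[nu]_(x in E) (f n x)%:E.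
Proof.
move=> mE; rewrite /mass asboolT// fineK// ge0_fin_numE.
  by apply: le_lt_trans (intf_le1 n mE) _; exact: ltry.
by apply: integral_ge0 => x _; rewrite lee_fin; have [] := Df n.
Qed.

Let mass_bnd E n : (0 <= mass n E <= 1)%R.
Proof.
have [mE|nmE] := pselect (measurable E); last by rewrite /mass asboolF// lexx ler01.
rewrite -!lee_fin massE// intf_le1// andbT.
by apply: integral_ge0 => x _; rewrite lee_fin; have [] := Df n.
Qed.

Definition limit_mass E : R := sval (cid2 (ultra_cvg_bounded UU (mass_bnd E))).

Lemma limit_mass_bnd E : (0 <= limit_mass E <= 1)%R.
Proof. by rewrite /limit_mass; case: cid2. Qed.

Lemma cvg_limit_mass E : mass n E @[n --> U] --> limit_mass E.
Proof. by rewrite /limit_mass; case: cid2. Qed.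

Lemma limit_massU A B : measurable A -> measurable B -> A `&` B = set0 ->
  limit_mass (A `|` B) = (limit_mass A + limit_mass B)%R.
Proof.
move=> mA mB AB.
apply: (@cvg_unique _ _ (mass n (A `|` B) @[n --> U])) => //.
  exact: cvg_limit_mass.
rewrite (_ : (fun n => mass n (A `|` B)) = (fun n => mass n A + mass n B)%R).
  by apply: cvgD; exact: cvg_limit_mass.
apply/funext => n; apply: EFin_inj; rewrite EFinD !massE//; last exact: measurableU.
rewrite ge0_integral_setU//.
- exact: measurable_funTS.
- by move=> x _; rewrite lee_fin; have [] := Df n.
- by apply/disj_setPS; rewrite AB.
Qed.

Lemma limit_mass_continuity (e : R) : (0 < e)%R -> exists2 delta : R, (0 < delta)%R &
  forall E, measurable E -> nu E <= delta%:E -> (limit_mass E <= e)%R.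
Proof.
move=> e0; have [delta d0 hd] := entropy_uniform_continuity C e0.
exists delta => // E mE nuEd; apply: (cvgr_to_le (@cvg_limit_mass E)).
by apply: filterE => n; rewrite -lee_fin massE// hd.
Qed.

Lemma limit_massT : limit_mass setT = 1%R.
Proof.
apply: (@cvg_unique _ _ (mass n setT @[n --> U])) => //; first exact: cvg_limit_mass.
rewrite (_ : mass^~ setT = cst 1%R); first exact: cvg_cst.
by apply/funext => n; apply: EFin_inj; rewrite massE//; have [] := Df n.
Qed.

Definition limit_measure E : \bar R := (limit_mass E)%:E.

Let limit_mass0 : limit_mass set0 = 0%R.
Proof.
have := @limit_massU set0 set0 measurable0 measurable0 (setI0 _).
by rewrite setU0; lra.
Qed.

Let limit_measure0 : limit_measure set0 = 0.
Proof. by rewrite /limit_measure limit_mass0. Qed.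

Let limit_measure_ge0 E : 0 <= limit_measure E.
Proof. by rewrite lee_fin; have /andP[] := limit_mass_bnd E. Qed.

Let limit_measure_sigma_additive : semi_sigma_additive limit_measure.
Proof.
move=> F mF tF mUF; rewrite /limit_measure; under eq_fun do rewrite sumEFin.
apply: cvg_EFin; first exact: nearW.
(* Finite additivity reduces the claim to the tails [G n]. Their [nu]-mass tends to zero, and the
   limit mass inherits the uniform continuity of the densities. *)
pose G n := \bigcup_(k in [set k | (n <= k)%N]) F k.
have mG n : measurable (G n) by apply: bigcup_measurable.
have split n : limit_mass (\bigcup_k F k) = (\sum_(0 <= i < n) limit_mass (F i) + limit_mass (G n))%R.
  elim: n => [|n IH].
    rewrite big_geq// add0r; congr limit_mass.
    by apply/seteqP; split=> x [k _ Fk]; exists k.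
  rewrite IH big_nat_recr//= -addrA; congr (_ + _)%R; rewrite -limit_massU//; last first.
    rewrite -subset0 => x [Fnx [k /= nk Fkx]].
    by move: nk; rewrite (tF n k)// ?ltnn//; exists x.
  congr limit_mass; apply/seteqP; split=> x.
    move=> [k /= nk Fkx]; case: (eqVneq n k) Fkx => [<-|nk'] Fkx; first by left.
    by right; exists k => //=; rewrite ltn_neqAle nk'.
  by move=> [Fnx|[k /= nk Fkx]]; [exists n => //=|exists k => //=; exact: ltnW].
apply/cvgrPdist_le => e e0.
have [delta d0 hd] := limit_mass_continuity e0.
have : nu (G n) @[n --> \oo] --> nu (\bigcap_n G n).
  apply: nonincreasing_cvg_mu => //.
  - by rewrite -ge0_fin_numE//; exact: nuA_fin.
  - exact: bigcapT_measurable.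
  - move=> m n mn; apply/subsetPset; apply: bigcup_subset => i /= ni.
    exact: leq_trans ni.
have -> : \bigcap_n G n = set0.
  rewrite -subset0 => x Gx; have [i _ Fix] := Gx 0%N Logic.I.
  have [j /= ij Fjx] := Gx i.+1 Logic.I.
  by move: ij; rewrite (tF i j)// ?ltnn//; exists x.
rewrite measure0 => /fine_cvgP[_ /cvgrPdist_le/(_ _ d0)[N _ NP]].
exists N => // n /NP /=; rewrite sub0r normrN => Gn.
rewrite (split n) addrAC subrr add0r ger0_norm; last by have /andP[] := limit_mass_bnd (G n).
by apply: hd => //; rewrite -(fineK (nuA_fin (mG n))) lee_fin (le_trans (ler_norm _)).
Qed.

HB.instance Definition _ := isMeasure.Build _ _ _ limit_measure
  limit_measure0 limit_measure_ge0 limit_measure_sigma_additive.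

Let limit_measure_fin : fin_num_fun limit_measure.
Proof. by []. Qed.

HB.instance Definition _ := Measure_isFinite.Build _ _ _ limit_measure limit_measure_fin.

Lemma limit_measure_dominates : limit_measure `<< nu.
Proof.
apply/null_content_dominatesP => E mE nuE0; rewrite /limit_measure; congr (_%:E).
apply/eqP; rewrite eq_le; apply/andP; split; last by have /andP[] := limit_mass_bnd E.
apply/ler_addgt0Pl => e e0; rewrite addr0.
have [delta d0 hd] := limit_mass_continuity e0.
by apply: hd => //; rewrite nuE0 lee_fin ltW.
Qed.

Lemma setwise_limit_density : exists2 g, density nu g &
  forall E, measurable E -> fine (\int[nu]_(x in E) (f n x)%:E) @[n --> U] -->
    fine (\int[nu]_(x in E) (g x)%:E).
Proof.
have dom := limit_measure_dominates.
(* This version of the derivative is finite and nonnegative at every point, so [fine] loses nothing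
   and no null set has to be removed. *)
pose h := Radon_Nikodym_SigmaFinite.f limit_measure nu.
have h0 : forall x, 0 <= h x := Radon_Nikodym_SigmaFinite.f_ge0 dom.
have hfin : forall x, h x \is a fin_num := Radon_Nikodym_SigmaFinite.f_fin_num dom.
have hint := Radon_Nikodym_SigmaFinite.f_integrable dom.
have hE := Radon_Nikodym_SigmaFinite.f_integral dom.
have hK x : (fine (h x))%:E = h x by rewrite fineK.
have gE E : \int[nu]_(x in E) (fine (h x))%:E = \int[nu]_(x in E) h x.
  by apply: eq_integral => x _.
exists (fun x => fine (h x)).
  split=> [|x|].
  - apply/measurable_EFinP; rewrite (_ : _ \o _ = h); first exact: measurable_int hint.
    by apply/funext => x; exact: hK.
  - by rewrite fine_ge0.
  - by rewrite gE -hE//= /limit_measure limit_massT.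
move=> E mE; rewrite gE -hE//=.
have := @cvg_limit_mass E; rewrite (_ : (fun n => mass n E) =
  (fun n => fine (\int[nu]_(x in E) (f n x)%:E)))//.
by apply/funext => n; rewrite /mass asboolT.
Qed.

End setwise_limit.

Lemma cvg_fin_sum (R : realType) (U : set_system nat) (UU : Filter U) (I : finType)
    (u : I -> nat -> R) (l : I -> R) : (forall i, u i n @[n --> U] --> l i) ->
  (\sum_i u i n)%R @[n --> U] --> (\sum_i l i)%R.
Proof.
move=> ul; elim: (index_enum I) => [|i s IH].
  by under eq_fun do rewrite big_nil; rewrite big_nil; exact: cvg_cst.
under eq_fun do rewrite big_cons; rewrite big_cons; exact: cvgD.
Qed.

Section density_limits.
Context d (T : measurableType d) (R : realType).
Variable nu : {sigma_finite_measure set T -> \bar R}.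
Hypothesis nu_fin : nu setT < +oo.
Let z := fine (nu setT).
Let z0 : (0 <= z)%R. Proof. by rewrite fine_ge0. Qed.
Let nuE : nu setT = z%:E. Proof. by rewrite fineK// ge0_fin_numE. Qed.

Lemma le_integral_density (f : T -> R) (phi psi : T -> R) (e : R) : density nu f ->
  measurable_fun setT phi -> measurable_fun setT psi ->
  (forall x, 0 <= phi x)%R -> (forall x, 0 <= psi x)%R -> (0 <= e)%R ->
  (forall x, phi x <= psi x + e)%R ->
  \int[nu]_x (phi x * f x)%:E <= \int[nu]_x (psi x * f x)%:E + e%:E.
Proof.
move=> [mf f0 f1] mphi mpsi phi0 psi0 e0 le.
have mE (u : T -> R) : measurable_fun setT u -> measurable_fun setT (fun x => (u x * f x)%:E).
  by move=> mu; apply/measurable_EFinP; exact: measurable_funM.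
have -> : \int[nu]_x (psi x * f x)%:E + e%:E = \int[nu]_x ((psi x * f x)%:E + (e * f x)%:E).
  rewrite ge0_integralD//; last 4 first.
  - by move=> x _; rewrite lee_fin mulr_ge0.
  - exact: mE.
  - by move=> x _; rewrite lee_fin mulr_ge0.
  - by apply: (mE (cst e)).
  congr (_ + _); under eq_integral do rewrite EFinM.
  rewrite ge0_integralZl//; last 2 first.
  - exact/measurable_EFinP.
  - by move=> x _; rewrite lee_fin.
  by rewrite f1 mule1.
apply: ge0_le_integral => //.
- by move=> x _; rewrite lee_fin mulr_ge0.
- exact: mE.
- by apply: emeasurable_funD; [exact: mE|exact: (mE (cst e))].
by move=> x _; rewrite -EFinD lee_fin -mulrDl ler_wpM2r.
Qed.

Lemma integral_density_bounded (f phi : T -> R) (B : R) : density nu f ->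
  measurable_fun setT phi -> (forall x, 0 <= phi x <= B)%R ->
  \int[nu]_x (phi x * f x)%:E \is a fin_num.
Proof.
move=> Df mphi phiB; have [mf f0 f1] := Df.
have phi0 x : (0 <= phi x)%R by have /andP[] := phiB x.
rewrite ge0_fin_numE; last by apply: integral_ge0 => x _; rewrite lee_fin mulr_ge0.
(* A point of [T] is needed to see that [B] is nonnegative; over an empty space the integral is
   zero. *)
have [[x0 _]|/forallNP T0] := pselect (exists x : T, True); last first.
  rewrite (_ : [set: T] = set0) ?integral_set0//.
  by rewrite -subset0 => x _; exact: (T0 x).
have B0 : (0 <= B)%R by have /andP[/le_trans] := phiB x0; apply.
apply: (@le_lt_trans _ _ (\int[nu]_x (0 * f x)%:E + B%:E)).
  apply: (@le_integral_density f phi (cst 0%R)) => // x.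
  by rewrite add0r; have /andP[] := phiB x.
under eq_integral do rewrite mul0r.
by rewrite integral0 add0e ltry.
Qed.

Lemma integral_step_density (f : T -> R) (I : finType) (tau : T -> I) (h : I -> R) :
  density nu f -> (forall i, measurable (tau @^-1` [set i])) -> (forall i, 0 <= h i)%R ->
  fine (\int[nu]_x (h (tau x) * f x)%:E) =
  (\sum_i h i * fine (\int[nu]_(x in tau @^-1` [set i]) (f x)%:E))%R.
Proof.
move=> [mf f0 f1] mtau h0.
have mfE : measurable_fun setT (EFin \o f) by exact/measurable_EFinP.
pose m := mdensity nu mf f0.
have -> : \int[nu]_x (h (tau x) * f x)%:E = \int[m]_x (h (tau x))%:E.
  rewrite ge0_integral_mdensity//.
    by apply/measurable_EFinP; exact: (measurable_fun_finite_fibers h mtau).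
  by move=> x; rewrite lee_fin.
rewrite (ge0_integral_finite_fibers m (h := EFin \o h) mtau)//.
rewrite -[RHS]/(fine (_%:E)) -sumEFin; congr fine; apply: eq_bigr => i _.
rewrite EFinM fineK// ge0_fin_numE; last by apply: integral_ge0 => x _; rewrite lee_fin.
apply: (@le_lt_trans _ _ 1); last exact: ltry.
by rewrite -f1; apply: ge0_subset_integral => // x _; rewrite lee_fin.
Qed.

Variables (U : set_system nat) (UU : UltraFilter U) (f : nat -> T -> R) (g : T -> R).
Hypotheses (Df : forall n, density nu (f n)) (Dg : density nu g)
  (fg : forall E, measurable E -> fine (\int[nu]_(x in E) (f n x)%:E) @[n --> U] -->
    fine (\int[nu]_(x in E) (g x)%:E)).

Lemma cvg_integral_density (phi : T -> R) (B : R) : measurable_fun setT phi ->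
  (forall x, 0 <= phi x <= B)%R ->
  fine (\int[nu]_x (phi x * f n x)%:E) @[n --> U] --> fine (\int[nu]_x (phi x * g x)%:E).
Proof.
move=> mphi phiB; apply/cvgrPdist_le => e e0.
have phi0 x : (0 <= phi x)%R by have /andP[] := phiB x.
have e30 : (0 < e / 3)%R by rewrite divr_gt0.
have e30' : (0 <= e / 3)%R by exact: ltW.
have [|I [tau [h' [mtau phih']]]] := @step_approx_unif _ _ _ phi B mphi _ _ e30.
  by move=> x; have /andP[? ?] := phiB x; rewrite ger0_norm.
pose h i := (if h' i < 0 then 0 else h' i)%R.
have h0 i : (0 <= h i)%R by rewrite /h; case: ltP.
have phih x : (`|phi x - h (tau x)| <= e / 3)%R.
  apply: le_trans (phih' x); rewrite /h; case: ltP => // h'0.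
  by rewrite subr0 !ger0_norm//; have := phi0 x; lra.
have mh : measurable_fun setT (h \o tau) by exact: measurable_fun_finite_fibers.
have hB x : (0 <= (h \o tau) x <= B + e / 3)%R.
  have /andP[_ ?] := phiB x; have := phih x; rewrite ler_norml /= h0 => /andP[? ?].
  by lra.
have key u : density nu u -> (`|fine (\int[nu]_x (phi x * u x)%:E) -
    fine (\int[nu]_x (h (tau x) * u x)%:E)| <= e / 3)%R.
  move=> Du.
  have f1 := integral_density_bounded Du mphi phiB.
  have f2 := integral_density_bounded Du mh hB.
  have := @le_integral_density u phi (h \o tau) _ Du mphi mh phi0 (fun x => h0 _) e30'.
  move=> /(_ _)/wrap[|l1]; first by move=> x; have := phih x; rewrite ler_norml => /andP[_] /=; lra.
  have := @le_integral_density u (h \o tau) phi _ Du mh mphi (fun x => h0 _) phi0 e30'.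
  move=> /(_ _)/wrap[|l2]; first by move=> x; have := phih x; rewrite ler_norml => /andP[+ _] /=; lra.
  move: l1 l2; rewrite -(fineK f1) -(fineK f2) -!EFinD !lee_fin => l1 l2.
  by rewrite ler_norml; apply/andP; split; lra.
have cvgS : fine (\int[nu]_x (h (tau x) * f n x)%:E) @[n --> U] -->
    fine (\int[nu]_x (h (tau x) * g x)%:E).
  rewrite integral_step_density//; under eq_fun do rewrite integral_step_density//.
  by apply: cvg_fin_sum => i; apply: cvgM; [exact: cvg_cst|exact: fg].
move/cvgrPdist_le : cvgS => /(_ _ e30); apply: filterS => n hn.
have k1 := key _ (Df n); have k2 := key _ Dg.
move: hn k1 k2; rewrite !ler_norml => /andP[? ?] /andP[? ?] /andP[? ?].
by apply/andP; split; lra.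
Qed.

(** For a step kernel the pair integral is a finite quadratic form in the masses of the cells, and
    these converge. *)
Lemma cvg_pair_step_density (I : finType) (tau : T -> I) (h : I -> I -> R) :
  (forall i, measurable (tau @^-1` [set i])) -> (forall i j, 0 <= h i j)%R ->
  fine (pair_integral nu (fun x => (h (tau x.1) (tau x.2))%:E) (f n)) @[n --> U] -->
  fine (pair_integral nu (fun x => (h (tau x.1) (tau x.2))%:E) g).
Proof.
move=> mtau h0.
have hE u : density nu u -> fine (pair_integral nu (fun x => (h (tau x.1) (tau x.2))%:E) u) =
    (\sum_i \sum_j h i j * (fine (\int[nu]_(x in tau @^-1` [set i]) (u x)%:E) *
      fine (\int[nu]_(x in tau @^-1` [set j]) (u x)%:E)))%R.
  move=> Du; have [mu u0 u1] := Du.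
  have muE : measurable_fun setT (EFin \o u) by exact/measurable_EFinP.
  pose m i := fine (\int[nu]_(x in tau @^-1` [set i]) (u x)%:E).
  have m0 i : (0 <= m i)%R.
    by rewrite fine_ge0// integral_ge0// => x _; rewrite lee_fin.
  have intE (c : I -> R) : (forall i, 0 <= c i)%R ->
      \int[nu]_x (c (tau x) * u x)%:E = (\sum_i c i * m i)%:E.
    move=> c0; rewrite -(integral_step_density Du mtau c0) fineK//.
    apply: (@integral_density_bounded u (c \o tau) (\sum_i c i)%R) => //.
      exact: measurable_fun_finite_fibers.
    move=> x; by rewrite c0/= (bigD1 (tau x))//= lerDl sumr_ge0.
  rewrite /pair_integral fubini_tonelli1//=; last 2 first.
  - under eq_fun do rewrite -EFinM; apply/measurable_EFinP; apply: measurable_funM.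
      exact: (measurable_step h mtau).
    exact: measurable_tensor.
  - by move=> x; rewrite -EFinM lee_fin mulr_ge0// mulr_ge0.
  rewrite /fubini_F/=.
  have -> : \int[nu]_x \int[nu]_y ((h (tau x) (tau y))%:E * (u x * u y)%:E) =
      \int[nu]_x ((\sum_j h (tau x) j * m j) * u x)%:E.
    apply: eq_integral => x _.
    transitivity (\int[nu]_y ((u x)%:E * (h (tau x) (tau y) * u y)%:E)).
      by apply: eq_integral => y _; rewrite -!EFinM mulrCA.
    rewrite ge0_integralZl//; last 3 first.
    - apply/measurable_EFinP; apply: measurable_funM => //.
      exact: (measurable_fun_finite_fibers (h (tau x)) mtau).
    - by move=> y _; rewrite lee_fin mulr_ge0.
    - by rewrite lee_fin.
    by rewrite intE// -EFinM mulrC.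
  rewrite (intE (fun i => \sum_j h i j * m j)%R).
    rewrite /=; apply: eq_bigr => i _; rewrite mulr_suml; apply: eq_bigr => j _.
    by rewrite -mulrA [(m j * _)%R]mulrC.
  by move=> i; rewrite sumr_ge0// => j _; rewrite mulr_ge0.
rewrite hE//; under eq_fun do rewrite hE//.
apply: cvg_fin_sum => i; apply: cvg_fin_sum => j; apply: cvgM; first exact: cvg_cst.
by apply: cvgM; exact: fg.
Qed.

Lemma pair_integral_bounded (u : T -> R) (k : T * T -> R) (M : R) : density nu u ->
  measurable_fun setT k -> (forall x, 0 <= k x <= M)%R -> (0 <= M)%R ->
  pair_integral nu (EFin \o k) u \is a fin_num.
Proof.
move=> Du mk kM M0; have [mu u0 u1] := Du.
have muE : measurable_fun setT (EFin \o u) by exact/measurable_EFinP.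
have mt := measurable_tensor mu.
have k0 x : (0 <= k x)%R by have /andP[] := kM x.
rewrite ge0_fin_numE; last first.
  by apply: integral_ge0 => x _; rewrite -EFinM lee_fin mulr_ge0// mulr_ge0.
apply: (@le_lt_trans _ _ (\int[nu \x nu]_x (M%:E * (u x.1 * u x.2)%:E))).
  apply: ge0_le_integral => //.
  - by move=> x _; rewrite -EFinM lee_fin mulr_ge0// mulr_ge0.
  - by under eq_fun do rewrite -EFinM; apply/measurable_EFinP; exact: measurable_funM.
  - by apply: measurable_funeM; exact/measurable_EFinP.
  by move=> x _; rewrite -!EFinM lee_fin ler_wpM2r ?mulr_ge0//; have /andP[] := kM x.
rewrite ge0_integralZl//; last 2 first.
- exact/measurable_EFinP.
- by move=> x _; rewrite lee_fin mulr_ge0.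
under eq_integral do rewrite EFinM.
rewrite (@ge0_integral_tensor _ _ _ nu (EFin \o u) (EFin \o u))//=.
by rewrite u1 !mule1 ltry.
Qed.

(** The step kernel must be close to [k] uniformly over the densities involved. [exp_dist_step] and
    Young's inequality give this under the common entropy bound [C]. *)
Lemma cvg_pair_density (C : R) (k : T * T -> R) (M : R) :
  (forall n, entropy1 nu (f n) <= C%:E) -> entropy1 nu g <= C%:E ->
  (0 <= M)%R -> measurable_fun setT k -> (forall x, 0 <= k x <= M)%R ->
  fine (pair_integral nu (EFin \o k) (f n)) @[n --> U] -->
  fine (pair_integral nu (EFin \o k) g).
Proof.
move=> fC gC M0 mk kM; apply/cvgrPdist_le => e e0.
have e30 : (0 < e / 3)%R by rewrite divr_gt0.
(* The right side of Young's inequality: twice the entropy bound plus the exponential moment.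
   Dividing it by [lam] gives [e / 3]. *)
pose C1 := (2 * `|C| + (z ^+ 2 + 1))%R.
have C10 : (0 < C1)%R by rewrite ltr_wpDl ?mulr_ge0// ltr_wpDl ?sqr_ge0.
pose lam := (C1 / (e / 3))%R.
have lam0 : (0 < lam)%R by rewrite divr_gt0.
pose e' := ((lam * expR (lam * M))^-1)%R.
have e'0 : (0 < e')%R by rewrite invr_gt0 mulr_gt0 ?expR_gt0.
have [I [tau [h [mtau hM kh]]]] := step_approx_bounded nu_fin M0 mk kM e'0.
have h0 i j : (0 <= h i j)%R by have /andP[] := hM i j.
have expC1 := exp_dist_step nu_fin mk kM lam0 mtau hM kh.
pose dst x := (`|k x - h (tau x.1) (tau x.2)|)%R.
pose hk x := h (tau x.1) (tau x.2).
have mh : measurable_fun setT hk by exact: (measurable_step h mtau).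
have mdst : measurable_fun setT dst.
  by apply: measurableT_comp => //; exact: measurable_funB.
have dst0 x : (0 <= dst x)%R by exact: normr_ge0.
have k0 x : (0 <= k x)%R by have /andP[] := kM x.
have key u : density nu u -> entropy1 nu u <= C%:E ->
    (`|fine (pair_integral nu (EFin \o k) u) - fine (pair_integral nu (EFin \o hk) u)| <= e / 3)%R.
  move=> Du uC; have [mu u0 u1] := Du; have mt := measurable_tensor mu.
  have pk := pair_integral_bounded Du mk kM M0.
  have ph := @pair_integral_bounded u hk M Du mh (fun x => hM _ _) M0.
  have t0 x : (0 <= u x.1 * u x.2)%R by rewrite mulr_ge0.
  have mm (v : T * T -> R) : measurable_fun setT v ->
      measurable_fun setT (fun x => (EFin \o v) x * (u x.1 * u x.2)%:E).
    by move=> mv; under eq_fun do rewrite -EFinM; apply/measurable_EFinP; exact: measurable_funM.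
  have vt0 (v : T * T -> R) : (forall x, 0 <= v x)%R ->
      forall x, 0 <= (EFin \o v) x * (u x.1 * u x.2)%:E.
    by move=> v0 x; rewrite -EFinM lee_fin mulr_ge0.
  have le3 (v w : T * T -> R) : (forall x, 0 <= v x)%R -> (forall x, 0 <= w x)%R ->
      measurable_fun setT v -> measurable_fun setT w -> (forall x, v x <= w x + dst x)%R ->
      pair_integral nu (EFin \o v) u <=
      pair_integral nu (EFin \o w) u + pair_integral nu (EFin \o dst) u.
    move=> v0 w0 mv mw vw; rewrite -ge0_integralD//; last 4 first.
    - by move=> x _; exact: vt0.
    - exact: mm.
    - by move=> x _; exact: vt0.
    - exact: mm.
    apply: ge0_le_integral => //.
    - by move=> x _; exact: vt0.
    - exact: mm.
    - by apply: emeasurable_funD; exact: mm.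
    by move=> x _; rewrite -!EFinM -EFinD lee_fin -mulrDl ler_wpM2r.
  have pdst : pair_integral nu (EFin \o dst) u <= (e / 3)%:E.
    have := @pair_integral_young _ _ _ nu u (fun x => lam * dst x)%R (cst 0) Du.
    move=> /(_ (measurable_funM (measurable_cst _) mdst)).
    move=> /(_ (fun x => mulr_ge0 (ltW lam0) (dst0 x)) (measurable_cst _) (fun=> lexx _)).
    rewrite [X in _ <= _ + X + _](_ : _ = 0); last first.
      by rewrite /pair_integral; under eq_integral do rewrite /= mul0e; rewrite integral0.
    rewrite adde0.
    under [X in _ <= _ + X]eq_integral do rewrite sube0/=.
    rewrite (_ : pair_integral nu _ u = lam%:E * pair_integral nu (EFin \o dst) u); last first.
      rewrite -ge0_integralZl//; last 3 first.
      - exact: mm.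
      - by move=> x _; exact: vt0.
      - by rewrite lee_fin ltW.
      by apply: eq_integral => x _; rewrite -!EFinM/= mulrA.
    have h2 : 0 <= 2%:E :> \bar R by rewrite lee_fin.
    move=> /le_trans /(_ (leeD (lee_wpmul2l h2 uC) expC1)).
    rewrite -EFinM -EFinD -lee_pdivlMl// => /le_trans; apply.
    rewrite -EFinM lee_fin mulrC ler_pdivrMr// /lam mulrCA divff ?gt_eqF// mulr1 /C1.
    by rewrite lerD2r ler_pM2l// ler_norm.
  have pdfin : pair_integral nu (EFin \o dst) u \is a fin_num.
    rewrite ge0_fin_numE; first exact: le_lt_trans pdst (ltry _).
    by apply: integral_ge0 => x _; exact: vt0.
  have l1 := le3 k hk k0 (fun x => h0 _ _) mk mh _.
  have {l1} := l1 (fun x => _); move=> /(_ _)/wrap[|l1].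
    by move=> x; rewrite -lerBlDl /dst /hk ler_norm.
  have l2 := le3 hk k (fun x => h0 _ _) k0 mh mk _.
  have {l2} := l2 (fun x => _); move=> /(_ _)/wrap[|l2].
    by move=> x; rewrite -lerBlDl /dst /hk distrC ler_norm.
  move: l1 l2 pdst; rewrite -(fineK pk) -(fineK ph) -(fineK pdfin) -!EFinD !lee_fin => l1 l2 l3.
  by rewrite ler_norml; apply/andP; split; lra.
have := cvg_pair_step_density mtau h0.
move/cvgrPdist_le => /(_ _ e30); apply: filterS => n hn.
have k1 := key _ (Df n) (fC n); have k2 := key _ Dg gC.
move: hn k1 k2; rewrite !ler_norml => /andP[? ?] /andP[? ?] /andP[? ?].
by apply/andP; split; lra.
Qed.

End density_limits.

(** * Lower semicontinuity of the free energy *)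

Lemma integralZ_density d (T : measurableType d) (R : realType)
    (nu : {sigma_finite_measure set T -> \bar R}) (f : T -> R) (B : R) : density nu f ->
  (0 <= B)%R -> \int[nu]_x (B%:E * (f x)%:E) = B%:E.
Proof.
move=> [mf f0 f1] B0; rewrite ge0_integralZl_EFin ?f1 ?mule1//.
- by move=> x _; rewrite lee_fin.
- exact/measurable_EFinP.
Qed.

Section entropy_lsc.
Context d (T : measurableType d) (R : realType).
Variable nu : {sigma_finite_measure set T -> \bar R}.
Hypothesis nu_fin : nu setT < +oo.
Let z := fine (nu setT).
Let z0 : (0 <= z)%R. Proof. by rewrite fine_ge0. Qed.
Let nuE : nu setT = z%:E. Proof. by rewrite fineK// ge0_fin_numE. Qed.

(** Clipping makes the logarithm bounded. The shift by two puts the lower end at or below one half,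
    which the positivity of the tangents below uses. *)
Definition cutoff (j : nat) (t : R) : R :=
  (if t < j.+2%:R^-1 then j.+2%:R^-1 else if j.+2%:R < t then j.+2%:R else t)%R.

Lemma cutoff_gt0 j t : (0 < cutoff j t)%R.
Proof.
rewrite /cutoff; case: (ltP t) => [_|jt]; first by rewrite invr_gt0.
by case: (ltP _ t) => // _; apply: lt_le_trans jt; rewrite invr_gt0.
Qed.

Lemma cutoff_le j t : (cutoff j t <= j.+2%:R)%R.
Proof.
have j1 : (1 <= j.+2%:R :> R)%R by rewrite ler1n.
rewrite /cutoff; case: ltP => [_|jt]; last by case: ltP.
by apply: (le_trans _ j1); rewrite invf_le1// ltr0n.
Qed.

Lemma ln_cutoff_ge j t : (- ln j.+2%:R <= ln (cutoff j t))%R.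
Proof.
have j0 : (0 < j.+2%:R :> R)%R by rewrite ltr0n.
rewrite -lnV ?posrE// ler_ln ?posrE ?invr_gt0 ?cutoff_gt0//.
rewrite /cutoff; case: ltP => // jt; case: ltP => // _.
by apply: (@le_trans _ _ 1%R); [rewrite invf_le1// ler1n|rewrite ler1n].
Qed.

Lemma measurable_cutoff j : measurable_fun setT (cutoff j).
Proof.
apply: measurable_fun_ifT => //; first exact: measurable_fun_ltr.
by apply: measurable_fun_ifT => //; exact: measurable_fun_ltr.
Qed.

(** With [u = cutoff j t], the expression is one plus the value at [t] of the tangent to [x ln x] at
    [u]. Near zero the bounds [x ln x >= -1/e >= -1/2] and [u <= 1/2] are used. *)
Lemma cutoff_xlnx_ge0 j t : (0 <= t)%R ->
  (0 <= t * ln (cutoff j t) + 1 + t - cutoff j t)%R.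
Proof.
move=> t0; rewrite /cutoff.
have j2 : (2 <= j.+2%:R :> R)%R by rewrite ler_nat.
have j0 : (0 < j.+2%:R :> R)%R by rewrite ltr0n.
have ij2 : (j.+2%:R^-1 <= 2^-1 :> R)%R by rewrite lef_pV2 ?posrE.
have ij0 : (0 < j.+2%:R^-1 :> R)%R by rewrite invr_gt0.
case: ltP => [tj|jt].
  have h1 := young_entropy 0 (ltW ij0); rewrite mul0r sub0r in h1.
  have h2 : (expR (-1) <= 2^-1 :> R)%R.
    rewrite expRN lef_pV2 ?posrE ?expR_gt0//.
    by have := @expR_ge1Dx R 1; lra.
  have h3 : (ln (j.+2%:R^-1) <= 0 :> R)%R.
    by apply: ln_le0; rewrite invf_le1// ler1n.
  have h4 : (j.+2%:R^-1 * ln (j.+2%:R^-1) <= t * ln (j.+2%:R^-1) :> R)%R.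
    by rewrite ler_wnM2r// ltW.
  move: h1 h2 h4 ij2 ij0.
  move: (j.+2%:R^-1)%R (expR (-1))%R => p E; move: (p * ln p)%R (t * ln p)%R => x y.
  lra.
case: ltP => [jt'|tj].
  have : (0 <= t * ln (j.+2%:R))%R by rewrite mulr_ge0// ln_ge0//; lra.
  lra.
by have := xlnxD1_ge0 t0; lra.
Qed.

Lemma cutoff_xlnx_cvg t : (0 <= t)%R ->
  (t * ln (cutoff j t) + 1 + t - cutoff j t)%:E @[j --> \oo] --> (t * ln t + 1)%:E.
Proof.
rewrite le_eqVlt => /predU1P[<-|t0].
  apply: cvg_EFin; first exact: nearW.
  rewrite (_ : _ \o _ = (fun j => 1 - j.+2%:R^-1)%R); last first.
    apply/funext => j /=; rewrite mul0r add0r addr0 /cutoff ifT// invr_gt0.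
  rewrite mul0r add0r -[X in _ --> X]subr0; apply: cvgB; first exact: cvg_cst.
  have := @cvg_harmonic R; rewrite -(cvg_shiftS _); exact: cvg_trans.
have it0 : (0 < t^-1)%R by rewrite invr_gt0.
apply: (@cvg_near_cst _ _ _ _ _); exists (Num.truncn (t + t^-1)).+1 => // j /= jt.
have h : (t + t^-1 <= j.+2%:R)%R.
  apply: le_trans (ltW (truncnS_gt _)) _; rewrite ler_nat.
  by rewrite (leq_trans jt)// -addn2 leq_addr.
rewrite /cutoff ifF; last first.
  apply/negbTE; rewrite -leNgt -[leRHS]invrK lef_pV2 ?posrE ?ltr0n//; lra.
rewrite ifF; last by apply/negbTE; rewrite -leNgt; lra.
by congr (_%:E); lra.
Qed.

Variables (U : set_system nat) (UU : UltraFilter U) (f : nat -> T -> R) (g : T -> R).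
Hypotheses (Df : forall n, density nu (f n)) (Dg : density nu g)
  (fg : forall E, measurable E -> fine (\int[nu]_(x in E) (f n x)%:E) @[n --> U] -->
    fine (\int[nu]_(x in E) (g x)%:E)).

(** Entropy is a supremum of affine functionals. The tangents at the clipped limit density have
    bounded slope, so their integrals pass to the limit along [U]; Young's inequality puts them
    below the entropies of the [f n], and Fatou's lemma removes the clipping. *)
Lemma entropy1_lsc (C e : R) : (forall n, entropy1 nu (f n) <= C%:E) ->
  fine (entropy1 nu (f n)) @[n --> U] --> e -> entropy1 nu g <= e%:E.
Proof.
move=> fC fe; have [mg g0 g1] := Dg.
pose h j x : \bar R := (g x * ln (cutoff j (g x)) + 1 + g x - cutoff j (g x))%:E.
have mcg j : measurable_fun setT (fun x => cutoff j (g x)).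
  by apply: measurableT_comp => //; exact: measurable_cutoff.
have mlc j : measurable_fun setT (fun x => ln (cutoff j (g x))).
  exact: measurableT_comp.
have mh j : measurable_fun setT (h j).
  apply/measurable_EFinP; apply: measurable_funB => //; apply: measurable_funD => //.
  by apply: measurable_funD => //; exact: measurable_funM.
have h0 j x : 0 <= h j x by rewrite lee_fin cutoff_xlnx_ge0.
have hE x : (g x * ln (g x) + 1)%:E = limn_einf (h ^~ x).
  by apply/esym; have [] := cvg_limn_einf_sup (cutoff_xlnx_cvg (g0 x)).
rewrite /entropy1; under eq_integral do rewrite hE.
apply: (le_trans (fatou nu measurableT mh (fun n x _ => h0 n x))).
suff hle j : \int[nu]_x h j x <= e%:E.
  rewrite limn_einf_lim; apply: lime_le; first exact: is_cvg_einfs.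
  apply: nearW => n; apply: ereal_inf_le; exists (\int[nu]_x h n x) => //.
  by exists n => //=.
pose B := ln (j.+2%:R : R); have B0 : (0 <= B)%R by rewrite ln_ge0// ler1n.
(* The slope of the tangent, raised by [B] to be nonnegative. The shift is compensated by the
   integral of [B] times a density, which is [B]. *)
pose phi x := (1 + ln (cutoff j (g x)) + B)%R.
have mphi : measurable_fun setT phi.
  by apply: measurable_funD => //; apply: measurable_funD.
have phiB x : (0 <= phi x <= 1 + B + B)%R.
  have h1 := ln_cutoff_ge j (g x).
  have h2 : (ln (cutoff j (g x)) <= B)%R.
    by rewrite ler_ln ?posrE ?cutoff_gt0 ?ltr0n//; exact: cutoff_le.
  by rewrite /phi /B in h1 h2 *; apply/andP; split; lra.
have phi0 x : (0 <= phi x)%R by have /andP[] := phiB x.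
pose A := \int[nu]_x (cutoff j (g x))%:E.
have mcgE : measurable_fun setT (fun x => (cutoff j (g x))%:E) by exact/measurable_EFinP.
have cg0 x : 0 <= (cutoff j (g x))%:E by rewrite lee_fin ltW// cutoff_gt0.
have cstE (r : \bar R) : \int[nu]_x cst r x = r * z%:E by rewrite -nuE -integral_cst.
have Afin : A \is a fin_num.
  rewrite ge0_fin_numE; last exact: integral_ge0.
  apply: (@le_lt_trans _ _ (\int[nu]_x (cst (j.+2%:R)%:E x))).
    by apply: ge0_le_integral => // x _; rewrite lee_fin cutoff_le.
  by rewrite cstE -EFinM ltry.
have one : \int[nu]_x (cst 1 x) = z%:E by rewrite cstE mul1e.
have fn1 n : \int[nu]_x (phi x * f n x)%:E + z%:E <= entropy1 nu (f n) + A + B%:E.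
  have [mf f0 f1] := Df n.
  have mphif : measurable_fun setT (fun x => (phi x * f n x)%:E).
    by apply/measurable_EFinP; exact: measurable_funM.
  have phif0 x : 0 <= (phi x * f n x)%:E by rewrite lee_fin mulr_ge0.
  have mx := measurable_xlnxD1 mf.
  have x0 x : 0 <= (f n x * ln (f n x) + 1)%:E by rewrite lee_fin xlnxD1_ge0.
  have mfE : measurable_fun setT (EFin \o f n) by exact/measurable_EFinP.
  have mBf : measurable_fun setT (fun x => B%:E * (f n x)%:E) by exact: measurable_funeM.
  have Bf0 x : 0 <= B%:E * (f n x)%:E by rewrite -EFinM lee_fin mulr_ge0.
  have -> : B%:E = \int[nu]_x (B%:E * (f n x)%:E).
    by rewrite integralZ_density.
  rewrite -one -!ge0_integralD//; last 2 first.
  - by move=> x _; rewrite adde_ge0.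
  - exact: emeasurable_funD.
  apply: ge0_le_integral => //.
  - by move=> x _; rewrite adde_ge0//= lee_fin.
  - exact: emeasurable_funD.
  - by apply: emeasurable_funD => //; exact: emeasurable_funD.
  move=> x _ /=; rewrite -EFinM -!EFinD lee_fin.
  have := young_entropy (1 + ln (cutoff j (g x))) (f0 x).
  rewrite addrAC subrr add0r lnK ?posrE ?cutoff_gt0// /phi; lra.
have hI : \int[nu]_x h j x + A + B%:E = \int[nu]_x (phi x * g x)%:E + z%:E.
  have mgE : measurable_fun setT (EFin \o g) by exact/measurable_EFinP.
  have mBg : measurable_fun setT (fun x => B%:E * (g x)%:E) by exact: measurable_funeM.
  have Bg0 x : 0 <= B%:E * (g x)%:E by rewrite -EFinM lee_fin mulr_ge0.
  have mphig : measurable_fun setT (fun x => (phi x * g x)%:E).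
    by apply/measurable_EFinP; exact: measurable_funM.
  have phig0 x : 0 <= (phi x * g x)%:E by rewrite lee_fin mulr_ge0.
  have -> : B%:E = \int[nu]_x (B%:E * (g x)%:E).
    by rewrite integralZ_density.
  rewrite -one -!ge0_integralD//; last 2 first.
  - by move=> x _; rewrite adde_ge0.
  - exact: emeasurable_funD.
  by apply: eq_integral => x _; rewrite /h/= -EFinM -!EFinD /phi; congr (_%:E); ring.
have Efin n : entropy1 nu (f n) \is a fin_num.
  rewrite ge0_fin_numE; first exact: le_lt_trans (fC n) (ltry _).
  by apply: entropy1_ge0; have [] := Df n.
have pfin u (Du : density nu u) := integral_density_bounded Du mphi phiB.
have cv := cvg_integral_density UU Df Dg fg mphi phiB.
have : (fine (\int[nu]_x (phi x * g x)%:E) + z <= e + fine A + B)%R.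
  rewrite -subr_ge0.
  have cvD : (fine (entropy1 nu (f n)) + fine A + B -
      (fine (\int[nu]_x (phi x * f n x)%:E) + z))%R @[n --> U] -->
      (e + fine A + B - (fine (\int[nu]_x (phi x * g x)%:E) + z))%R.
    apply: cvgB; last by apply: cvgD => //; exact: cvg_cst.
    by apply: cvgD; [apply: cvgD => //; exact: cvg_cst|exact: cvg_cst].
  apply: (cvgr_to_ge cvD).
  apply: filterE => n; rewrite subr_ge0 -lee_fin !EFinD (fineK (Efin n)) (fineK Afin).
  by rewrite (fineK (pfin _ (Df n))); exact: fn1.
rewrite -lee_fin !EFinD (fineK Afin) (fineK (pfin _ Dg)).
by rewrite -hI !leeD2rE.
Qed.

End entropy_lsc.

Section truncation.
Context d (T : measurableType d) (R : realType).
Variable K : T * T -> \bar R.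
Hypotheses (mK : measurable_fun [set: T * T] K) (K0 : forall x, 0 <= K x).

Definition trunc_kernel (M : R) x : R := fine (mine (K x) M%:E).

Lemma trunc_kernelE M x : (0 <= M)%R -> (trunc_kernel M x)%:E = mine (K x) M%:E.
Proof.
move=> M0; rewrite /trunc_kernel fineK// fin_numElt lt_min gt_min ltry orbT andbT.
by rewrite (lt_le_trans (ltNyr 0) (K0 x)) ltNyr.
Qed.

Lemma trunc_kernel_bnd M x : (0 <= M)%R -> (0 <= trunc_kernel M x <= M)%R.
Proof.
move=> M0; rewrite -!lee_fin trunc_kernelE// le_min K0 ge_min lexx orbT andbT.
by rewrite lee_fin M0.
Qed.

Lemma trunc_kernel_le M x : (0 <= M)%R -> (trunc_kernel M x)%:E <= K x.
Proof. by move=> M0; rewrite trunc_kernelE// ge_min lexx. Qed.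

Lemma trunc_kernel_mono M M' x : (0 <= M)%R -> (M <= M')%R ->
  (trunc_kernel M x <= trunc_kernel M' x)%R.
Proof.
move=> M0 MM'; rewrite -lee_fin !trunc_kernelE ?(le_trans M0)//.
by rewrite le_min !ge_min lexx/= lee_fin MM' orbT.
Qed.

Lemma measurable_trunc_kernel M : measurable_fun setT (trunc_kernel M).
Proof.
apply: measurableT_comp => //; apply: measurable_mine => //.
Qed.

Lemma trunc_kernel_cvg x : (trunc_kernel n%:R x)%:E @[n --> \oo] --> K x.
Proof.
under eq_fun do rewrite trunc_kernelE//.
case Kx : (K x) (K0 x) => [r|//|//] r0; last first.
  rewrite (_ : (fun _ => _) = (fun n => n%:R%:E)); last first.
    by apply/funext => n; rewrite min_r ?leey.
  by apply/cvgenyP; exact: cvg_id.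
apply: (@cvg_near_cst _ _ _ _ _); exists (Num.truncn r).+1 => // n /= nr.
apply: min_l; rewrite lee_fin; apply: le_trans (ltW (truncnS_gt _)) _.
by rewrite ler_nat.
Qed.

End truncation.

Section functional.
Context d (T : measurableType d) (R : realType).
Variable nu : {sigma_finite_measure set T -> \bar R}.
Hypothesis nu_fin : nu setT < +oo.
Let z := fine (nu setT).
Let z0 : (0 <= z)%R. Proof. by rewrite fine_ge0. Qed.
Let nuE : nu setT = z%:E. Proof. by rewrite fineK// ge0_fin_numE. Qed.
Variable K : T * T -> \bar R.
Hypotheses (mK : measurable_fun [set: T * T] K) (K0 : forall x, 0 <= K x).

Definition free_energy (k : T * T -> \bar R) (f : T -> R) : \bar R :=
  entropy1 nu f + (2^-1)%:E * pair_integral nu k f.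

Lemma pair_integral_ge0 (k : T * T -> \bar R) f : (forall x, 0 <= k x) ->
  (forall x, 0 <= f x)%R -> 0 <= pair_integral nu k f.
Proof.
move=> k0 f0; apply: integral_ge0 => x _; apply: mule_ge0 => //.
by rewrite lee_fin mulr_ge0.
Qed.

Lemma half_pair_integral_ge0 (k : T * T -> \bar R) f : (forall x, 0 <= k x) ->
  (forall x, 0 <= f x)%R -> 0 <= (2^-1)%:E * pair_integral nu k f.
Proof.
by move=> k0 f0; rewrite mule_ge0 ?lee_fin ?invr_ge0//; exact: pair_integral_ge0.
Qed.

Lemma free_energy_ge0 (k : T * T -> \bar R) f : (forall x, 0 <= k x) ->
  (forall x, 0 <= f x)%R -> 0 <= free_energy k f.
Proof.
by move=> k0 f0; rewrite adde_ge0 ?entropy1_ge0//; exact: half_pair_integral_ge0.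
Qed.

Lemma le_pair_integral (k k' : T * T -> \bar R) f : measurable_fun setT k ->
  measurable_fun setT k' -> (forall x, 0 <= k x) -> (forall x, k x <= k' x) ->
  density nu f -> pair_integral nu k f <= pair_integral nu k' f.
Proof.
move=> mk mk' k0 kk' [mf f0 f1].
have mff : measurable_fun setT (fun x => (f x.1 * f x.2)%:E).
  by apply/measurable_EFinP; exact: measurable_tensor.
have ff0 x : 0 <= (f x.1 * f x.2)%:E by rewrite lee_fin mulr_ge0.
apply: ge0_le_integral => //.
- by move=> x _; rewrite mule_ge0.
- exact: emeasurable_funM.
- exact: emeasurable_funM.
by move=> x _; exact: lee_wpmul2r.
Qed.

(** For fixed [M] the truncation at [M] is below the truncation at [n] as soon as [n >= M], an event
    in [U]. The bound at level [M] therefore passes to the limit density, and [M] then tends to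
    infinity by monotone convergence. *)
Lemma gamma_limit (U : set_system nat) (UU : UltraFilter U) (f : nat -> T -> R) (theta : R) :
  \oo `<=` U -> (forall n, density nu (f n)) ->
  (forall n, free_energy (EFin \o trunc_kernel K n%:R) (f n) <= theta%:E) ->
  exists g, [/\ density nu g, free_energy K g <= theta%:E &
    forall (phi : T -> R) (B : R), measurable_fun setT phi -> (forall x, 0 <= phi x <= B)%R ->
      fine (\int[nu]_x (phi x * f n x)%:E) @[n --> U] -->
      fine (\int[nu]_x (phi x * g x)%:E)].
Proof.
move=> ooU Df ftheta.
have f0 n x : (0 <= f n x)%R by have [] := Df n.
have tk0 M x : (0 <= M)%R -> 0 <= (EFin \o trunc_kernel K M) x.
  by move=> M0; rewrite lee_fin; have /andP[] := trunc_kernel_bnd K0 x M0.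
have mtk M : measurable_fun setT (trunc_kernel K M) by exact: measurable_trunc_kernel.
have mtkE M : measurable_fun setT (EFin \o trunc_kernel K M) by exact/measurable_EFinP.
have Etheta n : entropy1 nu (f n) <= theta%:E.
  apply: le_trans (ftheta n); rewrite leeDl// half_pair_integral_ge0// => x.
  exact: tk0.
have Efin n : entropy1 nu (f n) \is a fin_num.
  by rewrite ge0_fin_numE ?entropy1_ge0//; exact: le_lt_trans (Etheta n) (ltry _).
have [g Dg fg] := setwise_limit_density nu_fin UU Df Etheta.
have [mg g0 g1] := Dg.
have Ebnd n : (0 <= fine (entropy1 nu (f n)) <= theta)%R.
  by rewrite fine_ge0 ?entropy1_ge0//= -lee_fin fineK.
(* The entropies also converge along [U]. Their limit [e] dominates the entropy of [g], so the limit
   of the sums can be split. *)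
have [e e0 fe] := ultra_cvg_bounded UU Ebnd.
have Eg := entropy1_lsc nu_fin UU Df Dg fg Etheta fe.
have gtheta : entropy1 nu g <= theta%:E.
  by apply: (le_trans Eg); rewrite lee_fin; have /andP[] := e0.
have Egfin : entropy1 nu g \is a fin_num.
  by rewrite ge0_fin_numE ?entropy1_ge0//; exact: le_lt_trans Eg (ltry _).
exists g; split => //; last first.
  by move=> phi B mphi phiB; exact: (cvg_integral_density UU Df Dg fg mphi phiB).
have trunc_le M : (2^-1)%:E * pair_integral nu (EFin \o trunc_kernel K M%:R) g <=
    theta%:E - entropy1 nu g.
  have M0 : (0 <= M%:R :> R)%R by [].
  have pf u : density nu u -> pair_integral nu (EFin \o trunc_kernel K M%:R) u \is a fin_num.
    move=> Du; apply: pair_integral_bounded Du (mtk _) _ M0 => x.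
    exact: trunc_kernel_bnd.
  have cv := cvg_pair_density nu_fin UU Df Dg fg Etheta gtheta M0 (mtk M%:R)
    (fun x => trunc_kernel_bnd K0 x M0).
  have cvD : (theta - (fine (entropy1 nu (f n)) +
      2^-1 * fine (pair_integral nu (EFin \o trunc_kernel K M%:R) (f n))))%R @[n --> U] -->
      (theta - (e + 2^-1 * fine (pair_integral nu (EFin \o trunc_kernel K M%:R) g)))%R.
    apply: cvgB; first exact: cvg_cst.
    by apply: cvgD => //; apply: cvgM => //; exact: cvg_cst.
  have : (0 <= theta - (e + 2^-1 * fine (pair_integral nu (EFin \o trunc_kernel K M%:R) g)))%R.
    apply: (cvgr_to_ge cvD); apply: ooU; exists M => // n /= Mn.
    rewrite subr_ge0 -lee_fin EFinD EFinM !fineK//; last exact: pf.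
    apply: le_trans (ftheta n); rewrite leeD2l//; apply: lee_wpmul2l.
      by rewrite lee_fin invr_ge0.
    apply: le_pair_integral => // [x|x]; first exact: tk0.
    by rewrite lee_fin trunc_kernel_mono// ler_nat.
  rewrite subr_ge0 -lee_fin EFinD EFinM fineK; last exact: pf.
  by move=> h; rewrite leeBrDl//; apply: le_trans h; rewrite leeD2r.
rewrite /free_energy addeC -leeBrDr//.
have mff : measurable_fun setT (fun x => (g x.1 * g x.2)%:E).
  by apply/measurable_EFinP; exact: measurable_tensor.
have ff0 x : 0 <= (g x.1 * g x.2)%:E by rewrite lee_fin mulr_ge0.
have cvK : pair_integral nu (EFin \o trunc_kernel K n%:R) g @[n --> \oo] --> pair_integral nu K g.
  rewrite (_ : pair_integral nu K g = \int[nu \x nu]_x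
      limn (fun n => (trunc_kernel K n%:R x)%:E * (g x.1 * g x.2)%:E)).
    apply: cvg_monotone_convergence => //.
    - by move=> n; exact: emeasurable_funM.
    - by move=> n x _; rewrite mule_ge0//; exact: tk0.
    - move=> x _ m n mn; apply: lee_wpmul2r => //.
      by rewrite lee_fin trunc_kernel_mono// ler_nat.
  apply: eq_integral => x _; apply/esym/cvg_lim => //.
  by apply: cvgeZr => //; exact: trunc_kernel_cvg.
have : (2^-1)%:E * pair_integral nu (EFin \o trunc_kernel K n%:R) g @[n --> \oo] -->
    (2^-1)%:E * pair_integral nu K g by exact: cvgeZl.
by move=> /cvge_to_le; apply; exact: nearW.
Qed.

End functional.

(** * Uniform integrability of the moment *)

Section moment.
Context d (T : measurableType d) (R : realType).
Variable nu : {sigma_finite_measure set T -> \bar R}.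

Definition moment (g f : T -> R) : \bar R := \int[nu]_x (g x * f x)%:E.

Lemma moment_ge0 g f : (forall x, 0 <= g x)%R -> density nu f -> 0 <= moment g f.
Proof. by move=> g0 [_ f0 _]; apply: integral_ge0 => x _; rewrite lee_fin mulr_ge0. Qed.

Lemma pair_integral_sum (g f : T -> R) (lam : R) : measurable_fun setT g ->
  (forall x, 0 <= g x)%R -> density nu f -> (0 <= lam)%R ->
  pair_integral nu (EFin \o (fun x => lam * (g x.1 + g x.2))%R) f = (2 * lam)%:E * moment g f.
Proof.
move=> mg g0 [mf f0 f1] lam0.
have mgf : measurable_fun setT (fun x => (g x * f x)%:E).
  by apply/measurable_EFinP; exact: measurable_funM.
have mfE : measurable_fun setT (EFin \o f) by exact/measurable_EFinP.
have gf0 x : 0 <= (g x * f x)%:E by rewrite lee_fin mulr_ge0.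
have m1 : measurable_fun setT (fun x : T * T => (g x.1 * f x.1)%:E * (f x.2)%:E).
  by apply: emeasurable_funM; [exact: (measurableT_comp mgf)|exact: (measurableT_comp mfE)].
have m2 : measurable_fun setT (fun x : T * T => (f x.1)%:E * (g x.2 * f x.2)%:E).
  by apply: emeasurable_funM; [exact: (measurableT_comp mfE)|exact: (measurableT_comp mgf)].
have p1 (x : T * T) : 0 <= (g x.1 * f x.1)%:E * (f x.2)%:E by rewrite -EFinM lee_fin !mulr_ge0.
have p2 (x : T * T) : 0 <= (f x.1)%:E * (g x.2 * f x.2)%:E by rewrite -EFinM lee_fin !mulr_ge0.
rewrite /pair_integral (eq_integral (fun x : T * T => lam%:E *
    ((g x.1 * f x.1)%:E * (f x.2)%:E + (f x.1)%:E * (g x.2 * f x.2)%:E))); last first.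
  by move=> x _; rewrite -!EFinM; congr (_%:E) => /=; ring.
rewrite ge0_integralZl_EFin//; last 2 first.
- by move=> x _; rewrite adde_ge0.
- exact: emeasurable_funD.
rewrite ge0_integralD//.
rewrite (@ge0_integral_tensor _ _ _ nu (fun x => (g x * f x)%:E) (EFin \o f))//.
rewrite (@ge0_integral_tensor _ _ _ nu (EFin \o f) (fun x => (g x * f x)%:E))//.
by rewrite /= f1 mule1 mul1e -mule2n -mule_natl muleA -EFinM mulrC.
Qed.

End moment.

Section head_tail.
Context d (T : measurableType d) (R : realType).
Variable nu : {sigma_finite_measure set T -> \bar R}.
Variable q : T -> R.
Hypotheses (mq : measurable_fun [set: T] q) (q0 : forall x, (0 <= q x)%R).

Definition head_part (r : R) x : R := (if q x <= r then q x else 0)%R.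
Definition tail_part (r : R) x : R := (if q x <= r then 0 else q x)%R.

Lemma head_tailE r x : (q x = head_part r x + tail_part r x)%R.
Proof. by rewrite /head_part /tail_part; case: ifP; rewrite ?addr0 ?add0r. Qed.

Lemma tail_part_ge0 r x : (0 <= tail_part r x)%R.
Proof. by rewrite /tail_part; case: ifP. Qed.

Lemma tail_part_le r x : (tail_part r x <= q x)%R.
Proof. by rewrite /tail_part; case: ifP. Qed.

Lemma tail_part_mono r r' x : (r <= r')%R -> (tail_part r' x <= tail_part r x)%R.
Proof.
move=> rr'; rewrite /tail_part; case: ifP => [_|/negbT]; first by case: ifP.
rewrite -ltNge => r'q; rewrite ifF//; apply/negbTE; rewrite -ltNge.
exact: le_lt_trans rr' r'q.
Qed.

Lemma head_part_bnd r x : (0 <= r)%R -> (0 <= head_part r x <= r)%R.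
Proof. by move=> r0; rewrite /head_part; case: ifP => [->|_]; rewrite ?lexx ?r0 ?q0. Qed.

Lemma measurable_head_part r : measurable_fun setT (head_part r).
Proof. by apply: measurable_fun_ifT => //; exact: measurable_fun_ler. Qed.

Lemma measurable_tail_part r : measurable_fun setT (tail_part r).
Proof. by apply: measurable_fun_ifT => //; exact: measurable_fun_ler. Qed.

Lemma moment_head_tail r f : (0 <= r)%R -> density nu f ->
  moment nu q f = moment nu (head_part r) f + moment nu (tail_part r) f.
Proof.
move=> r0 [mf f0 _]; have mh := measurable_head_part r; have mt := measurable_tail_part r.
rewrite /moment -ge0_integralD//.
- by apply: eq_integral => x _; rewrite -EFinD -mulrDl -head_tailE.
- by move=> x _; rewrite lee_fin mulr_ge0//; have /andP[] := head_part_bnd x r0.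
- by apply/measurable_EFinP; exact: measurable_funM.
- by move=> x _; rewrite lee_fin mulr_ge0// tail_part_ge0.
- by apply/measurable_EFinP; exact: measurable_funM.
Qed.

End head_tail.

Section uniform_integrability.
Context d (T : measurableType d) (R : realType).
Variable nu : {sigma_finite_measure set T -> \bar R}.
Hypothesis nu_fin : nu setT < +oo.
Let z := fine (nu setT).
Let z0 : (0 <= z)%R. Proof. by rewrite fine_ge0. Qed.
Let nuE : nu setT = z%:E. Proof. by rewrite fineK// ge0_fin_numE. Qed.
Variable K : T * T -> \bar R.
Hypotheses (mK : measurable_fun [set: T * T] K) (K0 : forall x, 0 <= K x).
Variable q : T -> R.
Hypotheses (mq : measurable_fun [set: T] q) (q0 : forall x, (0 <= q x)%R).
Hypothesis expint : forall lam : R,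
  \int[nu \x nu]_x expeR ((lam * (q x.1 + q x.2))%:E - K x) < +oo.

Let nu2E : (nu \x nu) setT = (z ^+ 2)%:E.
Proof.
transitivity (nu setT * nu setT); first by rewrite -product_measure1E// setXTT.
by rewrite nuE.
Qed.

Let mphi (g : T -> R) (lam : R) : measurable_fun setT g ->
  measurable_fun [set: T * T] (fun x => lam * (g x.1 + g x.2))%R.
Proof.
move=> mg; apply: measurable_funM => //; apply: measurable_funD.
  exact: (measurableT_comp mg).
exact: (measurableT_comp mg).
Qed.

Let mexp (g : T -> R) (lam : R) : measurable_fun setT g ->
  measurable_fun [set: T * T] (fun x => expeR ((lam * (g x.1 + g x.2))%:E - K x)).
Proof.
move=> mg; apply: (measurableT_comp (@measurable_expeR R)); apply: emeasurable_funB => //.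
by apply/measurable_EFinP; exact: mphi.
Qed.

Let exp_fin (r : R) x : expeR (r%:E - K x) \is a fin_num.
Proof. by case: (K x) (K0 x) => [k _|_|]. Qed.

(** As [r] grows the tails vanish pointwise and the integrand tends to [e^-K <= 1], whose integral
    is at most [z^2]. The integral without truncation dominates. *)
Lemma tail_exp_integral (lam : R) : (0 <= lam)%R -> exists R0 : R, (0 <= R0)%R /\
  forall r, (R0 <= r)%R ->
  \int[nu \x nu]_x expeR ((lam * (tail_part q r x.1 + tail_part q r x.2))%:E - K x) <=
    (z ^+ 2 + 1)%:E.
Proof.
move=> lam0.
have cv := @dominated_cvg _ _ _ (nu \x nu) setT measurableT
  (fun n x => expeR ((lam * (tail_part q n%:R x.1 + tail_part q n%:R x.2))%:E - K x))
  (fun x => expeR (- K x)) (fun x => expeR ((lam * (q x.1 + q x.2))%:E - K x)).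
have int1 : \int[nu \x nu]_x expeR (- K x) <= (z ^+ 2)%:E.
  apply: (@le_trans _ _ (\int[nu \x nu]_x cst 1 x)).
    apply: ge0_le_integral => //.
    - by move=> x _; exact: expeR_ge0.
    - by apply: (measurableT_comp (@measurable_expeR R)); exact: measurableT_comp.
    by move=> x _; rewrite -expeR0 lee_expeR oppe_le0.
  have -> : \int[nu \x nu]_x cst 1 x = (z ^+ 2)%:E.
    by rewrite -nu2E -[RHS]mul1e -integral_cst.
  exact: lexx.
have mt n := measurable_tail_part mq n.
have [||||||n0 _ hn0] := cv _ _ _ _ _ [set y | y < (z ^+ 2 + 1)%:E].
- by move=> n; apply: mexp; exact: mt.
- move=> x _; apply: (@cvg_near_cst _ _ _ _ _).
  exists (Num.truncn (q x.1 + q x.2)).+1 => // n /= nq.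
  have h : (q x.1 + q x.2 <= n%:R)%R.
    by apply: le_trans (ltW (truncnS_gt _)) _; rewrite ler_nat.
  rewrite /tail_part !ifT; last 2 first.
  - by apply: le_trans h; rewrite lerDr.
  - by apply: le_trans h; rewrite lerDl.
  by rewrite addr0 mulr0 add0e.
- by move=> x _; exact: exp_fin.
- apply/integrableP; split; first exact: mexp.
  by under eq_integral do rewrite gee0_abs ?expeR_ge0//; exact: expint.
- move=> n x _; rewrite gee0_abs ?expeR_ge0// lee_expeR leeD2r// lee_fin.
  by rewrite ler_wpM2l// lerD// tail_part_le.
- apply: open_ereal_lt'; apply: le_lt_trans int1 _.
  by rewrite lte_fin ltrDl.
exists n0%:R; split => // r n0r.
apply: le_trans (ltW (hn0 n0 (leqnn _))); apply: ge0_le_integral => //.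
- by move=> x _; exact: expeR_ge0.
- exact: mexp.
- exact: mexp.
move=> x _; rewrite lee_expeR leeD2r// lee_fin.
by rewrite ler_wpM2l// lerD// tail_part_mono.
Qed.

(** Apply [pair_integral_young] to the tails with kernel [K]: twice the entropy plus the pair
    integral is twice the free energy. Hence [2 lam] times the tail moment is at most
    [2 C + z^2 + 1], and [lam] is chosen so that the quotient is at most [eta]. *)
Lemma uniform_tail_moment (C eta : R) : (0 < eta)%R -> exists R0 : R, (0 <= R0)%R /\
  forall r f, (R0 <= r)%R -> density nu f -> free_energy nu K f <= C%:E ->
  moment nu (tail_part q r) f <= eta%:E.
Proof.
move=> eta0.
pose lam := ((`|C| * 2 + z ^+ 2 + 1) / (2 * eta))%R.
have num0 : (0 < `|C| * 2 + z ^+ 2 + 1)%R.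
  by rewrite ltr_wpDl// addr_ge0 ?sqr_ge0// mulr_ge0.
have lam0 : (0 < lam)%R by rewrite divr_gt0// mulr_gt0.
have [R0 [R00 hR0]] := tail_exp_integral (ltW lam0).
exists R0; split => // r f R0r Df fC; have [mf f0 f1] := Df.
have mt := measurable_tail_part mq r.
have := pair_integral_young Df (mphi lam mt) _ mK K0.
move=> /(_ _)/le_trans; rewrite pair_integral_sum ?(ltW lam0)//; last first.
  by move=> x; exact: tail_part_ge0.
move=> H.
have E0 := entropy1_ge0 nu f0; have P0 := half_pair_integral_ge0 nu K0 f0.
have : (2 * lam)%:E * moment nu (tail_part q r) f <= (2 * C + (z ^+ 2 + 1))%:E.
  apply: H => [x|]; first by rewrite mulr_ge0 ?(ltW lam0)// addr_ge0// tail_part_ge0.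
  rewrite [leRHS]EFinD; apply: leeD; last exact: hR0.
  rewrite EFinM -[X in _ + X](_ : 2%:E * ((2^-1)%:E * pair_integral nu K f) = _).
    by rewrite -ge0_muleDr//; exact: lee_wpmul2l.
  by rewrite muleA -EFinM divff// mul1e.
have := moment_ge0 (tail_part_ge0 q0 r) Df.
case: (moment nu (tail_part q r) f) => [m| |] m0 //; last first.
  by rewrite gt0_muley// lte_fin mulr_gt0.
rewrite -EFinM !lee_fin => h.
have : (2 * lam * m <= 2 * lam * eta)%R.
  have -> : (2 * lam * eta = `|C| * 2 + z ^+ 2 + 1)%R by rewrite /lam; field; rewrite gt_eqF.
  by have := ler_norm C; lra.
by rewrite (ler_pM2l (mulr_gt0 (ltr0Sn R 1) lam0)).
Qed.

Lemma moment_fin_num (C : R) f : density nu f -> free_energy nu K f <= C%:E ->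
  moment nu q f \is a fin_num.
Proof.
move=> Df fC; have [R0 [R00 /(_ R0 f (lexx _) Df fC) h]] := uniform_tail_moment C ltr01.
rewrite (moment_head_tail mq q0 R00 Df) fin_numD.
rewrite (integral_density_bounded Df (measurable_head_part mq R0)
  (fun x => head_part_bnd q0 x R00))/=.
rewrite ge0_fin_numE ?moment_ge0//; first exact: le_lt_trans h (ltry _).
exact: tail_part_ge0.
Qed.

Lemma uniform_head_moment (C eta : R) : (0 < eta)%R -> exists R0 : R, (0 <= R0)%R /\
  forall r f, (R0 <= r)%R -> density nu f -> free_energy nu K f <= C%:E ->
  (fine (moment nu (head_part q r) f) <= fine (moment nu q f) <=
    fine (moment nu (head_part q r) f) + eta)%R.
Proof.
move=> eta0; have [R0 [R00 hR0]] := uniform_tail_moment C eta0.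
exists R0; split => // r u R0r Du uC; have h := hR0 r u R0r Du uC.
have r0 := le_trans R00 R0r.
have hf := integral_density_bounded Du (measurable_head_part mq r)
  (fun x => head_part_bnd q0 x r0).
have t0 := moment_ge0 (tail_part_ge0 q0 r) Du; rewrite -/(moment nu _ u) in hf.
have tf : moment nu (tail_part q r) u \is a fin_num.
  by rewrite ge0_fin_numE//; exact: le_lt_trans h (ltry _).
rewrite (moment_head_tail mq q0 r0 Du) (fineD hf tf).
have tr : (0 <= fine (moment nu (tail_part q r) u) <= eta)%R.
  by rewrite fine_ge0//= -lee_fin fineK.
move: tr; move: (fine (moment nu (tail_part q r) u)) => p1.
by move: (fine (moment nu (head_part q r) u)) => p2 /andP[? ?]; apply/andP; split; lra.
Qed.

(** Truncations lie below [K], so [gamma_limit] applies to a single kernel. The unbounded moment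
    converges because its head does and its tail is uniformly small on free energy sublevels. *)
Lemma free_energy_compact (U : set_system nat) (UU : UltraFilter U) (f : nat -> T -> R)
    (C : R) : \oo `<=` U -> (forall n, density nu (f n)) ->
  (forall n, free_energy nu K (f n) <= C%:E) ->
  exists g, [/\ density nu g, free_energy nu K g <= C%:E &
    fine (moment nu q (f n)) @[n --> U] --> fine (moment nu q g)].
Proof.
move=> ooU Df fC.
have [|g [Dg gC gcv]] := gamma_limit (theta := C) nu_fin mK K0 UU ooU Df.
  move=> n; apply: le_trans (fC n); rewrite leeD2l// lee_wpmul2l ?lee_fin//.
  apply: le_pair_integral => //.
  - by apply/measurable_EFinP; exact: measurable_trunc_kernel.
  - by move=> x /=; rewrite lee_fin; have /andP[] := trunc_kernel_bnd K0 x (ler0n R n).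
  - by move=> x; exact: trunc_kernel_le.
exists g; split => //; apply/cvgrPdist_le => e e0.
have e30 : (0 < e / 3)%R by rewrite divr_gt0.
have [R0 [R00 hR0]] := uniform_head_moment C e30.
have close u := hR0 R0 u (lexx _).
have cvh := gcv _ _ (measurable_head_part mq R0) (fun x => head_part_bnd q0 x R00).
move/cvgrPdist_le : cvh => /(_ _ e30); apply: filterS => n.
have /andP[] := close _ Dg gC; have /andP[] := close _ (Df n) (fC n).
rewrite -/(moment _ _ _) !ler_norml.
move: (fine (moment nu q (f n))) (fine (moment nu q g)) => x y.
rewrite /moment.
move: (fine (integral _ _ (fun x => (head_part q R0 x * f n x)%:E))) => x'.
move: (fine (integral _ _ (fun x => (head_part q R0 x * g x)%:E))) => y'.
by move=> h1 h2 h3 h4 /andP[h5 h6]; apply/andP; split; lra.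
Qed.

End uniform_integrability.

(** * Upper bound *)

Lemma ge0_integral_setU_le d (T : measurableType d) (R : realType)
    (mu : {measure set T -> \bar R}) (A B C : set T) (f : T -> \bar R) :
  measurable A -> measurable B -> measurable C -> measurable_fun setT f ->
  (forall x, 0 <= f x) -> C `<=` A `|` B ->
  \int[mu]_(x in C) f x <= \int[mu]_(x in A) f x + \int[mu]_(x in B) f x.
Proof.
move=> mA mB mC mf f0 CAB.
have mBA : measurable (B `\` A) by exact: measurableD.
apply: (@le_trans _ _ (\int[mu]_(x in A `|` (B `\` A)) f x)).
  apply: ge0_subset_integral => //; first exact: measurableU.
    exact: measurable_funTS.
  by move=> x /CAB[Ax|Bx]; [left|have [Ax|nAx] := pselect (A x); [left|right]].
rewrite ge0_integral_setU//; last 2 first.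
- exact: measurable_funTS.
- by rewrite disj_set2E; apply/eqP; rewrite setDE setICA setICr setI0.
rewrite leeD2l//; apply: ge0_subset_integral => //.
exact: measurable_funTS.
Qed.

Section mean.
Context d (T : measurableType d) (R : realType).

Definition mean n (q : T -> R) (t : n.-tuple T) : R :=
  (n%:R^-1 * \sum_(i < n) q (tnth t i))%R.

Lemma measurable_mean n (q : T -> R) : measurable_fun setT q ->
  measurable_fun [set: n.-tuple T] (mean q).
Proof.
move=> mq; apply: measurable_funM => //; apply: measurable_sum => i.
by apply: measurableT_comp => //; exact: measurable_tnth.
Qed.

Lemma measurable_mean_preimage n (q : T -> R) (D : set R) : measurable_fun setT q ->
  measurable D -> measurable [set t : n.-tuple T | D (mean q t)].
Proof.
by move=> mq mD; rewrite -[X in measurable X]setTI; exact: (measurable_mean mq).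
Qed.

Lemma mean_head_tail n (q : T -> R) r (t : n.-tuple T) :
  mean q t = (mean (head_part q r) t + mean (tail_part q r) t)%R.
Proof.
rewrite /mean -mulrDr -big_split/=; congr (_ * _)%R.
by apply: eq_bigr => i _; exact: head_tailE.
Qed.

End mean.

(** Each index occurs in [2 (n - 1)] ordered pairs. This writes a sum over single points as a pair
    sum, to which decoupling applies. *)
Lemma sum_pairs_single (R : realType) n (a : 'I_n -> R) : (1 < n)%N ->
  (n.-1%:R^-1 * \sum_(i < n) \sum_(j < n | j != i) (a i + a j) = 2 * \sum_i a i)%R.
Proof.
move=> n1; have n10 : (n.-1%:R != 0 :> R)%R by rewrite pnatr_eq0; case: n n1 {a} => [|[]].
have c1 (i : 'I_n) : (\sum_(j < n | j != i) (1 : R) = n.-1%:R)%R.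
  by rewrite sumr_const cardC1 card_ord.
have -> : (\sum_(i < n) \sum_(j < n | j != i) (a i + a j) =
    2 * (n.-1%:R * \sum_i a i))%R.
  under eq_bigr do rewrite big_split/=.
  rewrite big_split/= [X in (_ + X)%R](exchange_big_dep predT)//=.
  rewrite [X in (_ + X)%R](eq_bigr (fun i => n.-1%:R * a i)%R); last first.
    move=> i _; under eq_bigl do rewrite eq_sym.
    by rewrite -(c1 i) mulr_suml; apply: eq_bigr => j _; rewrite mul1r.
  rewrite [X in (X + _)%R](eq_bigr (fun i => n.-1%:R * a i)%R); last first.
    move=> i _; rewrite -(c1 i) mulr_suml; apply: eq_bigr => j _; rewrite mul1r//.
  by rewrite -mulr_sumr; ring.
by rewrite mulrCA mulKf.
Qed.

Section upper_bound.
Context d (T : measurableType d) (R : realType).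
Variable nu : {sigma_finite_measure set T -> \bar R}.
Hypothesis nu_fin : nu setT < +oo.
Let z := fine (nu setT).
Let z0 : (0 <= z)%R. Proof. by rewrite fine_ge0. Qed.
Let nuE : nu setT = z%:E. Proof. by rewrite fineK// ge0_fin_numE. Qed.
Variable K : T * T -> \bar R.
Hypotheses (mK : measurable_fun [set: T * T] K) (K0 : forall x, 0 <= K x).
Variable q : T -> R.
Hypotheses (mq : measurable_fun [set: T] q) (q0 : forall x, (0 <= q x)%R).
Hypothesis expint : forall lam : R,
  \int[nu \x nu]_x expeR ((lam * (q x.1 + q x.2))%:E - K x) < +oo.

Let nu2E : (nu \x nu) setT = (z ^+ 2)%:E.
Proof.
transitivity (nu setT * nu setT); first by rewrite -product_measure1E// setXTT.
by rewrite nuE.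
Qed.

Let mexpK n : measurable_fun [set: n.-tuple T] (fun t => expeR (- pair_energy K t)).
Proof.
apply: (measurableT_comp (@measurable_expeR R)); apply: measurableT_comp => //.
exact: measurable_pair_energy.
Qed.

Lemma half_ratio_bounds n : (1 < n)%N ->
  [/\ (n%:R / n./2%:R <= 3 :> R)%R, (2^-1 <= n.-1%:R / (2 * n./2%:R) :> R)%R &
    (n.-1%:R / (2 * n./2%:R) <= 1 :> R)%R].
Proof.
move=> n1; have m0 : (0 < n./2%:R :> R)%R by rewrite ltr0n half_gt0.
have m1 : (1 <= n./2%:R :> R)%R by rewrite ler1n half_gt0.
have nE : (n%:R = (odd n)%:R + 2 * n./2%:R :> R)%R.
  by rewrite -{1}(odd_double_half n) natrD -mul2n natrM.
have n1E : (n.-1%:R = n%:R - 1 :> R)%R by rewrite -[n in RHS]prednK ?(ltnW n1)// -natr1 addrK.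
have o1 : ((odd n)%:R <= 1 :> R)%R by case: odd.
have o0 : (0 <= (odd n)%:R :> R)%R by [].
split.
- by rewrite ler_pdivrMr//; lra.
- by rewrite ler_pdivlMr ?mulr_gt0//; lra.
- by rewrite ler_pdivrMr ?mulr_gt0//; lra.
Qed.

(* [e^{l s - t k}] with [t] in [[1/2, 1]] is at most [1 + e^{2 l s - k}], so the
   parity-dependent ratios produced by the decoupling are harmless. *)
Lemma expeR_le1D (s u l : R) (k : \bar R) : (0 <= s)%R -> (0 <= l)%R -> 0 <= k ->
  (2^-1 <= u)%R -> expeR ((l * s)%:E - u%:E * k) <= 1 + expeR ((2 * l * s)%:E - k).
Proof.
move=> s0 l0; case: k => [k| |]// k0 u2; last first.
  rewrite gt0_muley ?lte_fin; last by lra.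
  by rewrite /= lee_fin addr0.
rewrite -EFinM -!EFinB/= -EFinD lee_fin; rewrite lee_fin in k0.
have h1 : (l * s - u * k <= 2^-1 * (2 * l * s - k))%R.
  by have : (2^-1 * k <= u * k)%R; [exact: ler_wpM2r|lra].
have [y0|y0] := ler0P (2 * l * s - k)%R.
  rewrite ler_wpDr ?expR_ge0// -[leRHS]expR0 ler_expR; lra.
by rewrite ler_wpDl// ler_expR; lra.
Qed.

(** Decoupling multiplies [lam / 2] by [n / n./2], which is at most three, and [expeR_le1D] doubles
    the result: hence [3 lam] in the hypothesis. Its summand one integrates to [z^2], and [1 + z]
    bounds the factor of the unpaired coordinate. *)
Lemma tail_exp_hoeffding n (r lam C : R) : (1 < n)%N -> (0 <= lam)%R ->
  \int[nu \x nu]_x expeR ((3 * lam * (tail_part q r x.1 + tail_part q r x.2))%:E - K x)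
    <= C%:E ->
  \int[tuple_measure nu n]_t
    expeR ((lam * \sum_(i < n) tail_part q r (tnth t i))%:E - pair_energy K t) <=
  ((1 + z) * (z ^+ 2 + C) ^+ n./2)%:E.
Proof.
move=> n1 lam0 hC.
have n0 : (0 < n)%N by exact: ltnW.
have n10 : (0 < n.-1%:R :> R)%R by rewrite ltr0n -ltnS prednK.
have m0 : (0 < n./2%:R :> R)%R by rewrite ltr0n half_gt0.
have t0 := tail_part_ge0 q0 r.
have mt := measurable_tail_part mq r.
have mS : measurable_fun [set: T * T] (fun x => tail_part q r x.1 + tail_part q r x.2)%R.
  by apply: measurable_funD; exact: (measurableT_comp mt).
pose h (x : T * T) : \bar R := (lam / 2 * (tail_part q r x.1 + tail_part q r x.2))%:E -
  (n.-1%:R / (2 * n%:R))%:E * K x.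
have mh : measurable_fun [set: T * T] h.
  apply: emeasurable_funB; last exact: measurable_funeM.
  by apply/measurable_EFinP; exact: measurable_funM.
have hy x : h x < +oo.
  rewrite /h; case: (K x) (K0 x) => [k _| |]//; first by rewrite -EFinM -EFinB ltry.
  by rewrite gt0_muley ?lte_fin// divr_gt0// mulr_gt0// ltr0n.
have hsum (t : n.-tuple T) :
    (lam * \sum_(i < n) tail_part q r (tnth t i))%:E - pair_energy K t =
    (n.-1%:R^-1)%:E * \sum_(i < n) \sum_(j < n | j != i) h (tnth t i, tnth t j).
  have hE x : h x = (lam / 2 * tail_part q r x.1 + lam / 2 * tail_part q r x.2)%:E +
      (- (n.-1%:R / (2 * n%:R)))%:E * K x by rewrite /h EFinN mulNe mulrDr.
  under [in RHS]eq_bigr do under eq_bigr do rewrite hE.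
  under [in RHS]eq_bigr do rewrite big_split/= -ge0_sume_distrr// sumEFin.
  rewrite big_split/= sumEFin -ge0_sume_distrr; last first.
    by move=> i _; rewrite sume_ge0.
  rewrite muleDr; [|by []|exact: fin_num_adde_defr].
  rewrite muleA -!EFinM (sum_pairs_single (fun i => lam / 2 * tail_part q r (tnth t i))%R)//.
  rewrite -mulr_sumr /pair_energy -mulNe -EFinN; congr (_ + _ * _).
    by congr (_%:E); field.
  by congr (_%:E); field; rewrite (gt_eqF n10) pnatr_eq0 -lt0n n0.
have hscale x : (n%:R / n./2%:R)%:E * h x =
    (n%:R / n./2%:R * (lam / 2 * (tail_part q r x.1 + tail_part q r x.2)))%:E -
    (n.-1%:R / (2 * n./2%:R))%:E * K x.
  rewrite /h; case: (K x) (K0 x) => [k _| |]//; last first.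
    rewrite !gt0_muley ?lte_fin; last 2 first.
    - by rewrite divr_gt0// mulr_gt0// ltr0n.
    - by rewrite divr_gt0// mulr_gt0// ltr0n.
    by rewrite !addeNy gt0_muleNy// lte_fin divr_gt0// ltr0n.
  rewrite -!EFinM -!EFinB; congr (_%:E); field.
  by rewrite !gt_eqF// ltr0n.
under eq_integral do rewrite hsum.
apply: (le_trans (hoeffding_decoupling nu_fin mh hy n1)).
have [nm3 u1 u2] := half_ratio_bounds n1.
have int_le : \int[nu \x nu]_x expeR ((n%:R / n./2%:R)%:E * h x) <= (z ^+ 2 + C)%:E.
  have me : measurable_fun [set: T * T] (fun x =>
      expeR ((3 * lam * (tail_part q r x.1 + tail_part q r x.2))%:E - K x)).
    apply: (measurableT_comp (@measurable_expeR R)); apply: emeasurable_funB => //.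
    by apply/measurable_EFinP; exact: measurable_funM.
  apply: (@le_trans _ _ (\int[nu \x nu]_x (cst 1 x +
      expeR ((3 * lam * (tail_part q r x.1 + tail_part q r x.2))%:E - K x)))).
    apply: ge0_le_integral => //.
    - by move=> x _; exact: expeR_ge0.
    - by apply: (measurableT_comp (@measurable_expeR R)); exact: measurable_funeM.
    - exact: emeasurable_funD.
    move=> x _; rewrite hscale.
    have s0 : (0 <= tail_part q r x.1 + tail_part q r x.2)%R by rewrite addr_ge0.
    have l0 : (0 <= 3 * lam / 2)%R by rewrite divr_ge0// mulr_ge0.
    have /= := expeR_le1D s0 l0 (K0 x) u1.
    rewrite (_ : 2 * (3 * lam / 2) = 3 * lam)%R; last by field.
    apply: le_trans; rewrite lee_expeR leeD2r// lee_fin mulrA ler_wpM2r//.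
    by rewrite mulrA ler_wpM2r ?invr_ge0// ler_wpM2r.
  rewrite ge0_integralD//; last by move=> x _; exact: expeR_ge0.
  have -> : \int[nu \x nu]_x cst 1 x = (z ^+ 2)%:E.
    by rewrite -nu2E -[RHS]mul1e -integral_cst.
  by rewrite EFinD leeD2l.
have C0 : (0 <= z ^+ 2 + C)%R.
  rewrite -lee_fin; apply: le_trans int_le; apply: integral_ge0 => x _; exact: expeR_ge0.
rewrite nuE [leRHS]EFinM; apply: lee_pmul.
- by rewrite -EFin_expe lee_fin exprn_ge0.
- by rewrite expe_ge0// integral_ge0// => x _; exact: expeR_ge0.
- by rewrite -EFin_expe lee_fin; case: odd; rewrite ?expr1 ?expr0 ?lerDl ?lerDr.
rewrite EFin_expe; apply: lee_wpexpe => //.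
by apply: integral_ge0 => x _; exact: expeR_ge0.
Qed.

(** Chernoff's bound. In [lam * delta], [|L|] reaches the target rate, [ln C] beats the growth
    [C^n], and the extra one absorbs [1 + z <= e^n], valid once [n >= z]. *)
Lemma tail_event (L delta : R) : (0 < delta)%R -> exists R0 : R, (0 <= R0)%R /\
  forall r, (R0 <= r)%R -> exists n0, forall n, (n0 <= n)%N ->
  \int[tuple_measure nu n]_(t in [set t | (delta <= mean (tail_part q r) t)%R])
    expeR (- pair_energy K t) <= (expR (- (n%:R * L)))%:E.
Proof.
move=> delta0.
pose C := (2 * z ^+ 2 + 1)%R.
have C1 : (1 <= C)%R by rewrite lerDr mulr_ge0// sqr_ge0.
pose lam := ((`|L| + ln C + 1) / delta)%R.
have lam0 : (0 <= lam)%R by rewrite divr_ge0 ?(ltW delta0)// !addr_ge0// ln_ge0.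
have [R0 [R00 hR0]] := tail_exp_integral nu_fin mK K0 mq q0 expint
  (mulr_ge0 (ler0n R 3) lam0).
exists R0; split => // r /hR0 hr.
exists (Num.truncn z).+2 => n nz.
have n1 : (1 < n)%N by apply: leq_trans nz.
have nr0 : (0 < n%:R :> R)%R by rewrite ltr0n ltnW.
have zn : (z <= n%:R)%R.
  by apply: le_trans (ltW (truncnS_gt _)) _; rewrite ler_nat ltnW.
have mt := measurable_tail_part mq r.
have mev : measurable [set t : n.-tuple T | (delta <= mean (tail_part q r) t)%R].
  apply: (@measurable_mean_preimage _ _ _ n _ [set y | (delta <= y)%R] mt).
  by apply: closed_measurable; exact: closed_ge.
have := tail_exp_hoeffding n1 lam0 hr.
pose g (t : n.-tuple T) :=
  expeR ((lam * \sum_(i < n) tail_part q r (tnth t i))%:E - pair_energy K t).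
rewrite -/(g _).
have mg : measurable_fun [set: n.-tuple T] g.
  apply: (measurableT_comp (@measurable_expeR R)); apply: emeasurable_funB.
    apply/measurable_EFinP; apply: measurable_funM => //; apply: measurable_sum => i.
    by apply: measurableT_comp => //; exact: measurable_tnth.
  exact: measurable_pair_energy.
have g0 t : 0 <= g t by exact: expeR_ge0.
move=> hg.
apply: (@le_trans _ _ ((expR (- (lam * delta * n%:R)))%:E *
    \int[tuple_measure nu n]_t g t)).
  rewrite -ge0_integralZl_EFin ?expR_ge0//.
  apply: (@le_trans _ _ (\int[tuple_measure nu n]_(t in
      [set t | (delta <= mean (tail_part q r) t)%R])
      ((expR (- (lam * delta * n%:R)))%:E * g t))).
    apply: ge0_le_integral => //.
    - by move=> t _; exact: expeR_ge0.
    - by apply: measurable_funTS; exact: mexpK.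
    - by apply: measurable_funTS; exact: measurable_funeM.
    move=> t /= ht; rewrite -[(expR _)%:E]/(expeR (_%:E)) -expeRD lee_expeR addeA -EFinD.
    rewrite leeDr// lee_fin addrC subr_ge0 -mulrA ler_wpM2l//.
    by rewrite -ler_pdivlMr// mulrC.
  apply: ge0_subset_integral => //.
  - exact: measurable_funeM.
  - by move=> t _; rewrite mule_ge0// lee_fin expR_ge0.
apply: (@le_trans _ _ ((expR (- (lam * delta * n%:R)))%:E * ((1 + z) * C ^+ n)%:E)).
  rewrite lee_wpmul2l ?lee_fin ?expR_ge0//; apply: le_trans hg _.
  rewrite lee_fin; apply: ler_wpM2l; first by rewrite addr_ge0.
  rewrite (_ : z ^+ 2 + (z ^+ 2 + 1) = C)%R; last by rewrite /C; ring.
  by rewrite ler_weXn2l// -{2}(odd_double_half n) -addnn addnA leq_addl.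
rewrite -EFinM lee_fin.
have CE : (C ^+ n = expR (n%:R * ln C))%R.
  by rewrite expRM_natl lnK// posrE (lt_le_trans ltr01 C1).
have z1 : (1 + z <= expR n%:R)%R by apply: le_trans (expR_ge1Dx z) _; rewrite ler_expR.
rewrite CE mulrCA -expRD.
apply: (@le_trans _ _ (expR n%:R * expR (- (lam * delta * n%:R) + n%:R * ln C))%R).
  by rewrite ler_wpM2r ?expR_ge0.
rewrite -expRD ler_expR /lam divfK ?gt_eqF//.
have : (n%:R * L <= n%:R * `|L|)%R by rewrite ler_pM2l// ler_norm.
lra.
Qed.

(** Compactness by contradiction in two passes. At fixed [r], letting [M] grow yields by
    [gamma_limit] a density with small free energy for [K] itself. Then [r] grows:
    [free_energy_compact] gives a limit whose full moment lies in the closed set [C2], although its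
    free energy is at most [theta - e]. *)
Lemma truncated_gap (C2 : set R) (theta e : R) : closed C2 -> (0 < e)%R ->
  (forall f, density nu f -> C2 (fine (moment nu q f)) -> theta%:E <= free_energy nu K f) ->
  exists delta R0 : R, [/\ (0 < delta)%R, (0 <= R0)%R & forall r, (R0 <= r)%R ->
  exists M : nat, forall f c, density nu f -> C2 c ->
    (`|fine (moment nu (head_part q r) f) - c| <= delta)%R ->
    (theta - e)%:E <= free_energy nu (EFin \o trunc_kernel K M%:R) f].
Proof.
move=> cC2 e0 thetaP; apply: contrapT => H.
have [U [UU ooU]] := ultraFilterLemma (F := \oo) _.
have inv0 k : (0 < k.+1%:R^-1 :> R)%R by rewrite invr_gt0.
(* One [1/(k+1)] is the violation of the constraint by the sequence, the other the distance between
   the head moments of [g] and of a term [f M]; hence the factor two. *)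
have S1 k : exists g, exists r c : R, [/\ density nu g, free_energy nu K g <= (theta - e)%:E,
    (k%:R <= r)%R, C2 c & (`|fine (moment nu (head_part q r) g) - c| <= 2 * k.+1%:R^-1)%R].
  have : exists r : R, (k%:R <= r)%R /\ forall M : nat, exists f c, [/\ density nu f, C2 c,
      (`|fine (moment nu (head_part q r) f) - c| <= k.+1%:R^-1)%R &
      free_energy nu (EFin \o trunc_kernel K M%:R) f <= (theta - e)%:E].
    apply: contrapT => h; apply: H; exists k.+1%:R^-1%R, k%:R; split => // r kr.
    apply: contrapT => h2; apply: h; exists r; split => // M.
    apply: contrapT => h3; apply: h2; exists M => f c Df Cc fc.
    rewrite leNgt; apply/negP => lt; apply: h3; exists f, c; split => //.
    exact: ltW.
  move=> [r [kr /choice[f /choice[c hf]]]].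
  have r0 : (0 <= r)%R by apply: le_trans kr.
  have [||g [Dg gC gcv]] := gamma_limit (theta := (theta - e)%R) (f := f) nu_fin mK K0 UU ooU.
  - by move=> n; have [] := hf n.
  - by move=> n; have [] := hf n.
  have := gcv _ _ (measurable_head_part mq r) (fun x => head_part_bnd q0 x r0).
  move=> /cvgrPdist_le/(_ _ (inv0 k)) hU.
  have [M hM] : exists M, (`|fine (moment nu (head_part q r) g) -
      fine (moment nu (head_part q r) (f M))| <= k.+1%:R^-1)%R.
    by have /filter_ex := hU.
  exists g, r, (c M); have [_ ? h _] := hf M; split => //.
  rewrite mulr_natl mulr2n.
  by apply: le_trans (ler_distD (fine (moment nu (head_part q r) (f M))) _ _) _; exact: lerD.
have [g /choice[r /choice[c hg]]] := choice S1.
have [||h [Dh hC hcv]] := free_energy_compact (C := (theta - e)%R) (f := g)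
  nu_fin mK K0 mq q0 expint UU ooU.
- by move=> n; have [] := hg n.
- by move=> n; have [] := hg n.
have : C2 (fine (moment nu q h)).
  apply: (@closed_cvg _ _ U _ c C2) => //; first by apply: filterE => n; have [] := hg n.
  apply/cvgrPdist_le => eps eps0.
  have e40 : (0 < eps / 4)%R by rewrite divr_gt0.
  have [R0 [R00 hR0]] := uniform_head_moment nu_fin mK K0 mq q0 expint (theta - e) e40.
  have ev1 : \forall n \near U, (R0 <= r n)%R.
    apply: ooU; exists (Num.truncn R0).+1 => // n /= nR.
    have [_ _ kr _ _] := hg n; apply: le_trans kr.
    by apply: le_trans (ltW (truncnS_gt _)) _; rewrite ler_nat.
  have ev2 : \forall n \near U, (2 * n.+1%:R^-1 <= eps / 4)%R.
    apply: ooU; exists (Num.truncn (2 / (eps / 4))) => // n /= nR.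
    rewrite ler_pdivrMr ?ltr0n// mulrC -ler_pdivrMr//.
    by apply: le_trans (ltW (truncnS_gt _)) _; rewrite ler_nat.
  move/cvgrPdist_le : hcv => /(_ _ e40).
  apply: filterS3 ev1 ev2 => n Rr n2 mm.
  have [Dg gC kr Cc hc] := hg n.
  have := hR0 (r n) (g n) Rr Dg gC.
  move: hc n2 mm; rewrite !ler_norml.
  move: (fine (moment nu (head_part q (r n)) (g n))) (fine (moment nu q (g n))) => x1 x2.
  move: (fine (moment nu q h)) (2 * n.+1%:R^-1)%R (c n) => x3 x4 x5.
  by move=> /andP[? ?] ? /andP[? ?] /andP[? ?]; apply/andP; split; lra.
move=> /(thetaP _ Dh) /le_trans /(_ hC); rewrite lee_fin; lra.
Qed.

(** Either the tail mean is at least [delta / 4], which is rare by [tail_event], or the head mean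
    lies near [C2]. In the second case the kernel is lowered to its truncation and
    [bounded_upper_bound] applies with the gap from [truncated_gap]. *)
Lemma upper_bound (C2 : set R) (theta e : R) : closed C2 -> (0 < e)%R ->
  (forall f, density nu f -> C2 (fine (moment nu q f)) -> theta%:E <= free_energy nu K f) ->
  exists n0, forall n, (n0 <= n)%N ->
    \int[tuple_measure nu n]_(t in [set t | C2 (mean q t)]) expeR (- pair_energy K t) <=
    (expR (- (n%:R * (theta - z - e))))%:E.
Proof.
move=> cC2 e0 thetaP.
have e30 : (0 < e / 3)%R by rewrite divr_gt0.
have [delta [R1 [delta0 R10 hR1]]] := truncated_gap cC2 e30 thetaP.
have d40 : (0 < delta / 4)%R by rewrite divr_gt0.
have [R2 [R20 hR2]] := tail_event (theta - z) d40.
pose r := Num.max R1 R2.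
have rR1 : (R1 <= r)%R by rewrite le_max lexx.
have rR2 : (R2 <= r)%R by rewrite le_max lexx orbT.
have [M hM] := hR1 r rR1.
have [n1 hn1] := hR2 r rR2.
have r0 : (0 <= r)%R by apply: le_trans rR1.
(* The radius [delta / 2] and the tolerance [e' <= delta / 2] together stay within the [delta]
   allowed by [truncated_gap]. *)
pose D := \bigcup_(c in C2) ball c (delta / 2)%R.
have oD : open D by apply: bigcup_open => c _; exact: ball_open.
have mD : measurable D by exact: open_measurable.
pose e' := Num.min (e / 3)%R (delta / 2)%R.
have e'0 : (0 < e')%R by rewrite lt_min e30 divr_gt0.
have e'e : (e' <= e / 3)%R by rewrite ge_min lexx.
have e'd : (e' <= delta / 2)%R by rewrite ge_min lexx orbT.
have mk := measurable_trunc_kernel mK M%:R.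
have [|n2 hn2] := bounded_upper_bound (theta := (theta - e / 3)%R) (D := D)
    nu_fin (ler0n R M) mk (fun x => trunc_kernel_bnd K0 x (ler0n R M))
    (measurable_head_part mq r) (fun x => head_part_bnd q0 x r0) mD e'0.
  move=> f y Df [c Cc]; rewrite -ball_normE/= => cy.
  have hf := integral_density_bounded Df (measurable_head_part mq r)
    (fun x => head_part_bnd q0 x r0).
  rewrite -(fineK hf) !lee_fin => ye; apply: (hM f c Df Cc).
  rewrite /moment; move: cy ye; rewrite ltr_norml ler_norml.
  move: (fine _) => x; move: e'd => ? /andP[? ?] /andP[? ?]; apply/andP; split; lra.
(* The last threshold gives [n e / 3 >= 1], so each of the two terms is smaller than the target by a
   factor [e^-1 <= 1/2]. *)
exists (maxn (maxn n1 n2) (Num.truncn (3 / e)).+1) => n.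
rewrite !geq_max => /andP[/andP[/hn1 {}hn1 /hn2 {}hn2] ne].
have mt := measurable_tail_part mq r; have mh := measurable_head_part mq r.
have mA : measurable [set t : n.-tuple T | (delta / 4 <= mean (tail_part q r) t)%R].
  apply: (@measurable_mean_preimage _ _ _ n _ [set y | (delta / 4 <= y)%R] mt).
  by apply: closed_measurable; exact: closed_ge.
have mB : measurable [set t : n.-tuple T | D (mean (head_part q r) t)].
  exact: measurable_mean_preimage.
have mC : measurable [set t : n.-tuple T | C2 (mean q t)].
  by apply: measurable_mean_preimage => //; exact: closed_measurable.
apply: (le_trans (ge0_integral_setU_le (tuple_measure nu n) mA mB mC (mexpK (n := n)) _ _)).
- by move=> t; exact: expeR_ge0.
- move=> t /= Ct; have [h|h] := leP (delta / 4)%R (mean (tail_part q r) t); first by left.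
  right; exists (mean q t) => //; rewrite -ball_normE/= (mean_head_tail q r) addrAC subrr add0r.
  rewrite ger0_norm; first by lra.
  rewrite mulr_ge0 ?invr_ge0// sumr_ge0// => i _; exact: tail_part_ge0.
have hB : \int[tuple_measure nu n]_(t in [set t | D (mean (head_part q r) t)])
    expeR (- pair_energy K t) <= (expR (- (n%:R * (theta - e / 3 - z - e'))))%:E.
  apply: le_trans hn2; apply: ge0_le_integral => //.
  - by move=> t _; exact: expeR_ge0.
  - by apply: measurable_funTS; exact: mexpK.
  - apply: measurable_funTS; apply/measurable_EFinP; apply: measurableT_comp => //.
    apply: measurableT_comp => //; apply/measurable_EFinP.
    rewrite (_ : _ \o _ = pair_energy (EFin \o trunc_kernel K M%:R)); last first.
      by apply/funext => t; rewrite pair_energyE.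
    by apply: measurable_pair_energy; exact/measurable_EFinP.
  move=> t _; rewrite -[(expR _)%:E]/(expeR (_%:E)) lee_expeR EFinN leeN2 -pair_energyE.
  by apply: le_pair_energy => x; exact: trunc_kernel_le.
apply: (le_trans (leeD hn1 hB)).
rewrite -EFinD lee_fin.
have n0 : (0 <= n%:R :> R)%R by [].
have ne1 : (1 <= n%:R * (e / 3))%R.
  rewrite -[(e / 3)%R]invf_div ler_pdivlMr ?mul1r ?divr_gt0//.
  by apply: le_trans (ltW (truncnS_gt _)) _; rewrite ler_nat.
set w := (n%:R * (theta - z - e))%R.
have h1 : (- (n%:R * (theta - z)) <= - w - 1)%R.
  rewrite /w mulrBr; have : (n%:R * (e / 3) <= n%:R * e)%R by rewrite ler_wpM2l//; lra.
  lra.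
have h2 : (- (n%:R * (theta - e / 3 - z - e')) <= - w - 1)%R.
  have : (n%:R * e' <= n%:R * (e / 3))%R by rewrite ler_wpM2l.
  rewrite /w !mulrBr; lra.
apply: (@le_trans _ _ (expR (- w - 1) + expR (- w - 1))%R).
  by apply: lerD; rewrite ler_expR.
rewrite expRD -mulrDr -[leRHS]mulr1 ler_pM2l ?expR_gt0//.
have : (expR (-1) <= 2^-1 :> R)%R.
  rewrite expRN lef_pV2 ?posrE ?expR_gt0//.
  by have := @expR_ge1Dx R 1; lra.
lra.
Qed.

End upper_bound.

(** * Lower bound *)

Lemma ge0_integral_sum_cond d (T : measurableType d) (R : realType)
    (mu : {measure set T -> \bar R}) (I : Type) (s : seq I) (P : pred I)
    (f : I -> T -> \bar R) : (forall i, measurable_fun setT (f i)) ->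
  (forall i x, 0 <= f i x) ->
  \int[mu]_x (\sum_(i <- s | P i) f i x) = \sum_(i <- s | P i) \int[mu]_x f i x.
Proof.
move=> mf f0; under eq_integral do rewrite -big_filter.
by rewrite ge0_integral_sum// big_filter.
Qed.

Lemma integral_restrict_indic d (T : measurableType d) (R : realType)
    (mu : {measure set T -> \bar R}) (D : set T) (f : T -> \bar R) :
  \int[mu]_(x in D) f x = \int[mu]_x (f x * (\1_D x)%:E).
Proof. by rewrite integral_mkcond epatch_indic. Qed.

Lemma sume_const (R : realType) (I : finType) (A : {pred I}) (x : \bar R) : 0 <= x ->
  \sum_(i in A) x = #|A|%:R%:E * x.
Proof.
move=> x0; rewrite big_const; elim: #|A| => [|n IH]; first by rewrite mul0e.
by rewrite iterS IH -natr1 EFinD ge0_muleDl// mul1e addeC.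
Qed.

Lemma measurable_mean_dist d (T : measurableType d) (R : realType) n (g : T -> R)
    (delta m : R) : measurable_fun setT g ->
  measurable [set t : n.-tuple T | (delta <= `|mean g t - m|)%R].
Proof.
move=> mg.
have mle : measurable_fun setT (fun t : n.-tuple T => (delta <= `|mean g t - m|)%R).
  apply: measurable_fun_ler => //; apply: measurableT_comp => //.
  by apply: measurable_funB => //; exact: measurable_mean.
by have := mle measurableT [set true] I; rewrite setTI.
Qed.

Lemma ge0_integral_mdensity2 d (T : measurableType d) (R : realType)
    (nu : {sigma_finite_measure set T -> \bar R}) (h : T -> R)
    (mh : measurable_fun setT h) (h0 : forall x, (0 <= h x)%R) (k : T * T -> \bar R) :
  measurable_fun setT k -> (forall x, 0 <= k x) ->
  \int[mdensity nu mh h0 \x mdensity nu mh h0]_z k z =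
  \int[nu \x nu]_z (k z * (h z.1 * h z.2)%:E).
Proof.
move=> mk k0.
have mkff : measurable_fun [set: T * T] (fun z => k z * (h z.1 * h z.2)%:E).
  apply: emeasurable_funM => //; apply/measurable_EFinP; exact: measurable_tensor.
rewrite !fubini_tonelli1//; last by move=> x; rewrite mule_ge0// lee_fin mulr_ge0.
rewrite ge0_integral_mdensity; last 2 first.
- exact: measurable_fun_fubini_tonelli_F.
- by move=> x; apply: integral_ge0 => y _; exact: k0.
apply: eq_integral => x _; rewrite /fubini_F.
rewrite ge0_integral_mdensity//; last exact: measurableT_comp.
rewrite -ge0_integralZr//.
- by apply: eq_integral => y _ /=; rewrite -muleA -EFinM mulrC.
- apply: emeasurable_funM; first exact: measurableT_comp.
  exact/measurable_EFinP.
- by move=> y _; rewrite mule_ge0// lee_fin.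
- by rewrite lee_fin.
Qed.

Section density_measure.
Context d (T : measurableType d) (R : realType).
Variable nu : {sigma_finite_measure set T -> \bar R}.
Variables (f : T -> R) (Df : density nu f).

Definition density_measurable : measurable_fun setT f := let: And3 h _ _ := Df in h.
Definition density_ge0 : forall x, (0 <= f x)%R := let: And3 _ h _ := Df in h.
Definition density_measure : {sigma_finite_measure set T -> \bar R} :=
  mdensity nu density_measurable density_ge0.

Lemma density_measureT : density_measure setT = 1.
Proof. by have [_ _] := Df. Qed.

Lemma ge0_integral_density_measure g : measurable_fun setT g -> (forall x, 0 <= g x) ->
  \int[density_measure]_x g x = \int[nu]_x (g x * (f x)%:E).
Proof. by move=> mg g0; exact: ge0_integral_mdensity. Qed.

Lemma ge0_integral_density_measure2 (k : T * T -> \bar R) : measurable_fun setT k ->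
  (forall x, 0 <= k x) ->
  \int[density_measure \x density_measure]_z k z = pair_integral nu k f.
Proof. exact: ge0_integral_mdensity2. Qed.

Lemma ge0_integral_pair_energy n (k : T * T -> \bar R) : measurable_fun setT k ->
  (forall x, 0 <= k x) ->
  \int[tuple_measure density_measure n]_t pair_energy k t =
  (n.-1%:R / 2)%:E * pair_integral nu k f.
Proof.
move=> mk k0.
have mpair (i j : 'I_n) : measurable_fun setT (fun t : n.-tuple T => k (tnth t i, tnth t j)).
  by apply: measurableT_comp => //; apply: measurable_fun_pair; exact: measurable_tnth.
rewrite /pair_energy ge0_integralZl_EFin ?invr_ge0//; last 2 first.
- by move=> t _; apply: sume_ge0 => i _; exact: sume_ge0.
- apply: emeasurable_sum => i; apply: emeasurable_sum_cond => j _; exact: mpair.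
rewrite ge0_integral_sum_cond; last 2 first.
- by move=> i; apply: emeasurable_sum_cond => j _; exact: mpair.
- by move=> i t; exact: sume_ge0.
rewrite (eq_bigr (fun=> n.-1%:R%:E * pair_integral nu k f)); last first.
  move=> i _; rewrite ge0_integral_sum_cond; last 2 first.
  - by move=> j; exact: mpair.
  - by move=> j t; exact: k0.
  rewrite (eq_bigr (fun=> pair_integral nu k f)); last first.
    move=> j ji; rewrite (ge0_integral_tuple_tnth2 (f := k)) ?density_measureT 1?eq_sym//.
    exact: ge0_integral_density_measure2.
  rewrite (sume_const (predC1 i)) ?cardC1 ?card_ord//; exact: (pair_integral_ge0 nu k0 density_ge0).
rewrite (sume_const predT)/= ?card_ord; last first.
  by rewrite mule_ge0// pair_integral_ge0//; exact: density_ge0.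
rewrite !muleA -!EFinM; case: n mpair => [|n] mpair; first by rewrite /= !mulr0 mul0r.
have nz : (n.+1%:R != 0 :> R)%R by rewrite pnatr_eq0.
by congr (_%:E * _); move: nz => /=; move: (n.+1%:R)%R => w nz; field.
Qed.

Lemma ge0_integral_sum_tuple n (g : T -> \bar R) : measurable_fun setT g ->
  (forall x, 0 <= g x) ->
  \int[tuple_measure density_measure n]_t (\sum_(i < n) g (tnth t i)) =
  n%:R%:E * \int[nu]_x (g x * (f x)%:E).
Proof.
move=> mg g0; rewrite ge0_integral_sum_cond//; last first.
  by move=> i; apply: measurableT_comp => //; exact: measurable_tnth.
rewrite (eq_bigr (fun=> \int[nu]_x (g x * (f x)%:E))); last first.
  move=> i _; rewrite (ge0_integral_tuple_tnth i density_measureT)//.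
  exact: ge0_integral_density_measure.
rewrite (sume_const predT)/= ?card_ord//; apply: integral_ge0 => x _.
by rewrite mule_ge0// lee_fin density_ge0.
Qed.

(** Chebyshev's inequality with variance at most [B^2 / n]. The off-diagonal terms of the squared
    mean form a pair energy of the kernel [g2], whose integral factors into [m^2]. *)
Lemma mean_chebyshev n (g : T -> R) (B delta : R) : (0 < n)%N -> (0 < delta)%R ->
  measurable_fun setT g -> (forall x, 0 <= g x)%R -> (forall x, f x != 0 -> g x <= B)%R ->
  tuple_measure density_measure n
    [set t | (delta <= `|mean g t - fine (moment nu g f)|)%R] <=
  (B ^+ 2 / (n%:R * delta ^+ 2))%:E.
Proof.
move=> n0 delta0 mg g0 gB; have f0 := density_ge0; have mf := density_measurable.
have [_ _ f1] := Df.
have nr0 : (0 < n%:R :> R)%R by rewrite ltr0n.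
pose P := tuple_measure density_measure n.
have PT : P setT = 1.
  by rewrite /P tuple_measure_setT big1// => i _; exact: density_measureT.
pose m := fine (moment nu g f).
have mgf : measurable_fun setT (fun x => (g x * f x)%:E).
  by apply/measurable_EFinP; exact: measurable_funM.
have mfE : measurable_fun setT (EFin \o f) by exact/measurable_EFinP.
have gfin : moment nu g f \is a fin_num.
  rewrite ge0_fin_numE; last exact: moment_ge0.
  apply: (@le_lt_trans _ _ (\int[nu]_x (`|B|%:E * (f x)%:E))).
    apply: ge0_le_integral => //.
    - by move=> x _; rewrite lee_fin mulr_ge0.
    - exact: measurable_funeM.
    move=> x _; rewrite -EFinM lee_fin; have [->|fx] := eqVneq (f x) 0%R.
      by rewrite !mulr0.
    by rewrite ler_wpM2r// (le_trans (gB _ fx))// ler_norm.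
  by rewrite (integralZ_density Df)// ltry.
have mE : moment nu g f = m%:E by rewrite fineK.
have m0 : (0 <= m)%R by rewrite fine_ge0// moment_ge0.
have mgE : measurable_fun setT (EFin \o g) by exact/measurable_EFinP.
have g0E x : 0 <= (EFin \o g) x by rewrite lee_fin.
have E1 : \int[P]_t (mean g t)%:E = m%:E.
  rewrite (eq_integral (fun t : n.-tuple T =>
      (n%:R^-1)%:E * \sum_(i < n) (EFin \o g) (tnth t i))); last first.
    by move=> t _; rewrite /mean EFinM -sumEFin.
  rewrite ge0_integralZl_EFin ?invr_ge0//; last 2 first.
  - by move=> t _; apply: sume_ge0.
  - apply: emeasurable_sum => i; apply: measurableT_comp => //; exact: measurable_tnth.
  rewrite ge0_integral_sum_tuple// muleA -EFinM mulVf ?gt_eqF// mul1e -mE.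
  by apply: eq_integral => x _; rewrite -EFinM.
pose V := \int[P]_t ((mean g t - m) ^+ 2)%:E.
pose g2 (x : T * T) := (g x.1 * g x.2)%R.
have mg2 : measurable_fun setT g2 by exact: measurable_tensor.
have mg2E : measurable_fun setT (EFin \o g2) by exact/measurable_EFinP.
have g20 x : 0 <= (EFin \o g2) x by rewrite lee_fin mulr_ge0.
(* The cross term is kept on the left so that both sides are sums of nonnegative terms and integrate
   without subtraction. *)
have sqE (t : n.-tuple T) : ((mean g t - m) ^+ 2 + 2 * m * mean g t =
    n%:R^-1 ^+ 2 * \sum_i g (tnth t i) ^+ 2 + 2 / n%:R * rpair_energy g2 t + m ^+ 2)%R.
  have : ((\sum_i g (tnth t i)) ^+ 2 = \sum_i g (tnth t i) ^+ 2 +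
      \sum_(i < n) \sum_(j < n | j != i) g2 (tnth t i, tnth t j))%R.
    rewrite expr2 big_distrlr/= -big_split/=; apply: eq_bigr => i _.
    by rewrite (bigD1 i)//= -expr2.
  rewrite /mean /rpair_energy.
  move: (\sum_i g (tnth t i))%R (\sum_i g (tnth t i) ^+ 2)%R.
  move: (\sum_(i < n) \sum_(j < n | j != i) g2 (tnth t i, tnth t j))%R => S2 S1 SS h.
  have {h} -> : (SS = S1 ^+ 2 - S2)%R by rewrite h addrK.
  have : (n%:R != 0 :> R)%R by rewrite gt_eqF.
  by move: (n%:R)%R => w w0; field.
have mmean := @measurable_mean _ _ _ n g mg.
have mV : measurable_fun setT (fun t : n.-tuple T => (mean g t - m) ^+ 2)%R.
  by apply: measurable_funX; exact: measurable_funB.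
have mean0 (t : n.-tuple T) : (0 <= mean g t)%R.
  by rewrite mulr_ge0 ?invr_ge0// sumr_ge0.
have Eg2 : \int[nu]_x ((g x ^+ 2)%:E * (f x)%:E) <= (B ^+ 2)%:E.
  apply: (@le_trans _ _ (\int[nu]_x ((B ^+ 2)%:E * (f x)%:E))).
    apply: ge0_le_integral => //.
    - by move=> x _; rewrite -EFinM lee_fin mulr_ge0// sqr_ge0.
    - apply: emeasurable_funM => //; apply/measurable_EFinP; exact: measurable_funX.
    - exact: measurable_funeM.
    move=> x _; rewrite -!EFinM lee_fin; have [->|fx] := eqVneq (f x) 0%R.
      by rewrite !mulr0.
    by rewrite ler_wpM2r// ler_pXn2r ?nnegrE// ?gB// (le_trans (g0 x))// gB.
  by rewrite (integralZ_density Df)// sqr_ge0.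
have PI : pair_integral nu (EFin \o g2) f = (m ^+ 2)%:E.
  rewrite /pair_integral (eq_integral (fun x : T * T =>
     (g x.1 * f x.1)%:E * (g x.2 * f x.2)%:E)); last first.
    by move=> x _; rewrite -!EFinM /g2; congr (_%:E); rewrite mulrACA.
  rewrite (@ge0_integral_tensor _ _ _ nu (fun x => (g x * f x)%:E) (fun x => (g x * f x)%:E))//.
  - by rewrite -/(moment nu g f) mE -EFinM -expr2.
  - by move=> x; rewrite lee_fin mulr_ge0.
  - by move=> x; rewrite lee_fin mulr_ge0.
have VE : V + (2 * m * m)%:E = (n%:R^-1)%:E * \int[nu]_x ((g x ^+ 2)%:E * (f x)%:E) +
    (2 / n%:R * (n.-1%:R / 2) * m ^+ 2)%:E + (m ^+ 2)%:E.
  have V1 : \int[P]_t ((mean g t - m) ^+ 2 + 2 * m * mean g t)%:E = V + (2 * m * m)%:E.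
    under eq_integral do rewrite EFinD [(2 * m * mean _ _)%:E]EFinM.
    rewrite ge0_integralD//=.
    - rewrite ge0_integralZl_EFin ?mulr_ge0//.
      + by rewrite E1.
      + by move=> t _; rewrite lee_fin.
      + exact/measurable_EFinP.
    - by move=> t _; rewrite lee_fin sqr_ge0.
    - exact/measurable_EFinP.
    - move=> t _; apply: mule_ge0; rewrite lee_fin//.
      exact: mulr_ge0.
    - by apply: measurable_funeM; exact/measurable_EFinP.
  rewrite -V1; under eq_integral do rewrite sqE.
  pose gs x : \bar R := (g x ^+ 2)%:E.
  have mgs : measurable_fun setT gs by apply/measurable_EFinP; exact: measurable_funX.
  have gs0 x : 0 <= gs x by rewrite lee_fin sqr_ge0.
  pose h1 (t : n.-tuple T) : \bar R := (n%:R^-1 ^+ 2)%:E * \sum_i gs (tnth t i).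
  pose h2 (t : n.-tuple T) : \bar R := (2 / n%:R)%:E * pair_energy (EFin \o g2) t.
  rewrite (eq_integral (fun t : n.-tuple T => h1 t + h2 t + cst (m ^+ 2)%:E t)); last first.
    by move=> t _; rewrite /h1 /h2 pair_energyE sumEFin -!EFinM -!EFinD.
  have n20 : (0 <= n%:R^-1 ^+ 2 :> R)%R by rewrite sqr_ge0.
  have mgst : measurable_fun setT (fun t : n.-tuple T => \sum_i gs (tnth t i)).
    by apply: emeasurable_sum => i; apply: measurableT_comp => //; exact: measurable_tnth.
  have mpe := @measurable_pair_energy _ _ _ n _ mg2E.
  have h10 t : 0 <= h1 t by rewrite mule_ge0// sume_ge0.
  have h20 t : 0 <= h2 t by rewrite mule_ge0 ?lee_fin ?divr_ge0// pair_energy_ge0.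
  have mh1 : measurable_fun setT h1 by exact: measurable_funeM.
  have mh2 : measurable_fun setT h2 by exact: measurable_funeM.
  rewrite !ge0_integralD//; last 3 first.
  - by move=> t _; rewrite adde_ge0.
  - exact: emeasurable_funD.
  - by move=> t _; rewrite lee_fin sqr_ge0.
  congr (_ + _ + _).
  - rewrite ge0_integralZl_EFin//; last by move=> t _; rewrite sume_ge0.
    rewrite ge0_integral_sum_tuple// muleA -EFinM; congr (_%:E * _).
    by rewrite expr2 -mulrA mulVf ?gt_eqF// mulr1.
  - rewrite ge0_integralZl_EFin ?divr_ge0//; last by move=> t _; rewrite pair_energy_ge0.
    by rewrite ge0_integral_pair_energy// PI muleA.
  - by rewrite -[RHS]mule1 -PT -integral_cst.
have Vle : V <= (B ^+ 2 / n%:R)%:E.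
  have : V + (2 * m * m)%:E <= (B ^+ 2 / n%:R + 2 * m * m)%:E.
    rewrite VE; apply: (@le_trans _ _ ((n%:R^-1)%:E * (B ^+ 2)%:E +
        (2 / n%:R * (n.-1%:R / 2) * m ^+ 2)%:E + (m ^+ 2)%:E)).
      by rewrite leeD2r// leeD2r// lee_wpmul2l// lee_fin invr_ge0.
    rewrite -EFinM -!EFinD lee_fin.
    have : (n.-1%:R / n%:R * m ^+ 2 <= m ^+ 2)%R.
      by rewrite ler_piMl ?sqr_ge0// ler_pdivrMr// mul1r ler_nat leq_pred.
    have -> : (2 / n%:R * (n.-1%:R / 2) * m ^+ 2 = n.-1%:R / n%:R * m ^+ 2)%R.
      have : (n%:R != 0 :> R)%R by rewrite gt_eqF.
      by move: (n%:R)%R => w w0; field.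
    lra.
  by rewrite EFinD leeD2rE.
have mE2 : measurable [set t : n.-tuple T | (delta <= `|mean g t - m|)%R].
  exact: measurable_mean_dist.
rewrite -/m (_ : (B ^+ 2 / (n%:R * delta ^+ 2) = (delta ^+ 2)^-1 * (B ^+ 2 / n%:R))%R); last first.
  by rewrite invfM mulrA mulrC.
have d20 : (0 < delta ^+ 2)%R by rewrite exprn_gt0.
rewrite EFinM; apply: (@le_trans _ _ (((delta ^+ 2)^-1)%:E * V)); last first.
  by rewrite lee_wpmul2l// lee_fin invr_ge0 ltW.
rewrite -ge0_integralZl_EFin ?invr_ge0 ?(ltW d20)//; last 2 first.
- by move=> t _; rewrite lee_fin sqr_ge0.
- exact/measurable_EFinP.
rewrite -/P.
have {1}-> : P [set t | (delta <= `|mean g t - m|)%R] =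
    \int[P]_t (\1_[set t | (delta <= `|mean g t - m|)%R] t)%:E.
  by rewrite integral_indic// setIT.
apply: ge0_le_integral => //.
- by apply/measurable_EFinP; exact: measurable_indic.
- by apply: measurable_funeM; exact/measurable_EFinP.
move=> t _; rewrite -EFinM lee_fin indicE; case: (boolP (t \in _)) => [|_]; last first.
  by rewrite mulr_ge0 ?invr_ge0 ?sqr_ge0// ltW.
rewrite inE/= => ht; rewrite ler_pdivlMl// mulr1 -[leRHS]real_normK ?num_real//.
by rewrite ler_pXn2r// nnegrE ltW.
Qed.

End density_measure.

Section weights.
Context d (T : measurableType d) (R : realType).
Variable nu : {sigma_finite_measure set T -> \bar R}.
Variables (K : T * T -> \bar R) (A : T -> \bar R).
Hypotheses (mK : measurable_fun [set: T * T] K) (K0 : forall x, 0 <= K x).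
Hypotheses (mA : measurable_fun [set: T] A) (A0 : forall x, 0 <= A x).
Variable q : T -> R.
Hypotheses (mq : measurable_fun [set: T] q) (q0 : forall x, (0 <= q x)%R).

Definition total_energy n (t : n.-tuple T) : \bar R :=
  pair_energy K t + (n%:R^-1)%:E * \sum_(i < n) A (tnth t i).

Definition weight n (t : n.-tuple T) : \bar R := expeR (- total_energy t).

Lemma measurable_total_energy n : measurable_fun setT (@total_energy n).
Proof.
apply: emeasurable_funD; first exact: measurable_pair_energy.
apply: measurable_funeM; apply: emeasurable_sum => i.
by apply: measurableT_comp => //; exact: measurable_tnth.
Qed.

Lemma total_energy_ge0 n (t : n.-tuple T) : 0 <= total_energy t.
Proof.
rewrite adde_ge0 ?pair_energy_ge0// mule_ge0 ?lee_fin ?invr_ge0//.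
exact: sume_ge0.
Qed.

Lemma measurable_weight n : measurable_fun setT (@weight n).
Proof.
apply: (measurableT_comp (@measurable_expeR R)); apply: measurableT_comp => //.
exact: measurable_total_energy.
Qed.

Lemma weight_le n (t : n.-tuple T) : weight t <= expeR (- pair_energy K t).
Proof.
rewrite lee_expeR leeN2 leeDl// mule_ge0 ?lee_fin ?invr_ge0//; exact: sume_ge0.
Qed.

(** On the support of [f], the bound on [A] makes the mean of [(1/n) sum A] at most [B], the bound
    on [q] serves Chebyshev's inequality, and the lower bound on [f] bounds [ln f] from below. *)
Definition nice (B : R) (f : T -> R) := forall x, f x != 0%R ->
  [/\ (B^-1 <= f x <= B)%R, A x <= B%:E & (q x <= B)%R].

(** The change of measure: where the product of the densities is positive it cancels against the
    logarithms with equality, and elsewhere the left side is zero. *)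
Lemma tilted_weight_le n (f : T -> R) (t : n.-tuple T) : (forall x, 0 <= f x)%R ->
  expeR (- (total_energy t + (\sum_(i < n) ln (f (tnth t i)))%:E)) *
    (\prod_(i < n) f (tnth t i))%:E <= weight t.
Proof.
move=> f0; have [p0|p0] := eqVneq (\prod_(i < n) f (tnth t i))%R 0%R.
  by rewrite p0 mule0 expeR_ge0.
have fi i : (0 < f (tnth t i))%R.
  by rewrite lt_neqAle f0 andbT eq_sym; move/prodf_neq0 : p0; exact.
rewrite fin_num_oppeD// expeRD -muleA.
have -> : expeR (- (\sum_(i < n) ln (f (tnth t i)))%:E) * (\prod_(i < n) f (tnth t i))%:E = 1.
  rewrite -EFinN/= -EFinM expRN expR_sum.
  by under eq_bigr do rewrite lnK ?posrE//; rewrite mulVf.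
by rewrite mule1.
Qed.

(* Adding [ln B] to [ln f] makes the tilted energy nonnegative, as [f >= B^-1]
   wherever [f] does not vanish; only nonnegative integrands occur then. *)
Lemma linearized_lower_bound n (f : T -> R) (B tau : R) (E : set (n.-tuple T))
    (Df : density nu f) : (0 < n)%N -> (1 <= B)%R -> nice B f -> measurable E ->
  (0 <= 1 + tau + n%:R * ln B)%R ->
  (1 + tau + n%:R * ln B)%:E <=
    (expR tau)%:E * \int[tuple_measure nu n]_(t in E) weight t +
    ((n.-1%:R / 2)%:E * pair_integral nu K f + B%:E +
     n%:R%:E * \int[nu]_x ((ln (f x) + ln B) * f x)%:E) +
    (1 + tau + n%:R * ln B)%:E * tuple_measure (density_measure Df) n (~` E).
Proof.
move=> n0 B1 nf mE; set s := (1 + tau + n%:R * ln B)%R => s0.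
have f0 := density_ge0 Df; have mf := density_measurable Df.
have [_ _ f1] := Df.
have nr0 : (0 < n%:R :> R)%R by rewrite ltr0n.
have B0 : (0 < B)%R by apply: lt_le_trans B1.
have lB0 : (0 <= ln B)%R by rewrite ln_ge0.
set P := tuple_measure (density_measure Df) n.
have PT : P setT = 1.
  by rewrite /P tuple_measure_setT big1// => i _; exact: density_measureT.
pose g x : \bar R := (ln (f x) + ln B)%:E.
have mg : measurable_fun setT g.
  by apply/measurable_EFinP; apply: measurable_funD => //; exact: measurableT_comp.
have g0 x : 0 <= g x.
  rewrite lee_fin; have [->|fx] := eqVneq (f x) 0%R; first by rewrite ln0// add0r.
  have [/andP[h _] _ _] := nf _ fx.
  by rewrite -subr_ge0 in h; rewrite -lerBlDr sub0r -lnV ?posrE// ler_ln ?posrE ?invr_gt0//;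
     rewrite ?(lt_le_trans _ (_ : B^-1 <= f x)%R) ?invr_gt0// -subr_ge0.
pose Y t : \bar R := pair_energy K t + (n%:R^-1)%:E * \sum_(i < n) A (tnth t i) +
  \sum_(i < n) g (tnth t i).
have msA : measurable_fun setT (fun t : n.-tuple T => \sum_(i < n) A (tnth t i)).
  by apply: emeasurable_sum => i; apply: measurableT_comp => //; exact: measurable_tnth.
have msg : measurable_fun setT (fun t : n.-tuple T => \sum_(i < n) g (tnth t i)).
  by apply: emeasurable_sum => i; apply: measurableT_comp => //; exact: measurable_tnth.
have mpe := @measurable_pair_energy _ _ _ n K mK.
have mnA : measurable_fun setT (fun t : n.-tuple T =>
  (n%:R^-1)%:E * \sum_(i < n) A (tnth t i)) by exact: measurable_funeM.
have pe0 (t : n.-tuple T) : 0 <= pair_energy K t by exact: pair_energy_ge0.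
have nA0 (t : n.-tuple T) : 0 <= (n%:R^-1)%:E * \sum_(i < n) A (tnth t i).
  by rewrite mule_ge0 ?lee_fin ?invr_ge0//; exact: sume_ge0.
have sg0 (t : n.-tuple T) : 0 <= \sum_(i < n) g (tnth t i) by exact: sume_ge0.
have Y0 t : 0 <= Y t by rewrite !adde_ge0.
have mY : measurable_fun setT Y.
  by apply: emeasurable_funD => //; exact: emeasurable_funD.
have EY : \int[P]_t Y t <= (n.-1%:R / 2)%:E * pair_integral nu K f + B%:E +
    n%:R%:E * \int[nu]_x ((ln (f x) + ln B) * f x)%:E.
  rewrite /Y !ge0_integralD//; last 2 first.
  - by move=> t _; rewrite adde_ge0.
  - exact: emeasurable_funD.
  rewrite ge0_integral_pair_energy// ge0_integral_sum_tuple//.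
  rewrite leeD//.
  rewrite leeD2l// ge0_integralZl_EFin ?invr_ge0//; last by move=> t _; exact: sume_ge0.
  rewrite ge0_integral_sum_tuple// muleA -EFinM mulVf ?gt_eqF// mul1e.
  rewrite -(integralZ_density Df (ltW B0)); apply: ge0_le_integral => //.
  - by move=> x _; rewrite mule_ge0// lee_fin.
  - by apply: emeasurable_funM => //; exact/measurable_EFinP.
  - by apply: measurable_funeM; exact/measurable_EFinP.
  move=> x _; have [->|fx] := eqVneq (f x) 0%R; first by rewrite !mule0.
  by rewrite lee_wpmul2r ?lee_fin//; have [] := nf _ fx.
pose J t := expeR (- (total_energy t + (\sum_(i < n) ln (f (tnth t i)))%:E)).
have J0 t : 0 <= J t by exact: expeR_ge0.
have mJ : measurable_fun setT J.
  apply: (measurableT_comp (@measurable_expeR R)); apply: measurableT_comp => //.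
  apply: emeasurable_funD; first exact: measurable_total_energy.
  apply/measurable_EFinP; apply: measurable_sum => i; apply: measurableT_comp => //.
  by apply: measurableT_comp => //; exact: measurable_tnth.
have m1E : measurable_fun setT (fun t => (\1_E t)%:E : \bar R).
  by apply/measurable_EFinP; exact: measurable_indic.
have i0 t : 0 <= (\1_(~` E) t)%:E :> \bar R by rewrite lee_fin.
have m1CE : measurable_fun setT (fun t => (\1_(~` E) t)%:E : \bar R).
  by apply/measurable_EFinP; apply: measurable_indic; exact: measurableC.
have JE : \int[P]_t (J t * (\1_E t)%:E) <= \int[tuple_measure nu n]_(t in E) weight t.
  rewrite /P/density_measure ge0_integral_tuple_mdensity; last 2 first.
  - exact: emeasurable_funM.
  - by move=> t; rewrite mule_ge0// lee_fin.
  rewrite (integral_restrict_indic _ E); apply: ge0_le_integral => //.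
  - by move=> t _; rewrite !mule_ge0// lee_fin// prodr_ge0.
  - apply: emeasurable_funM; first exact: emeasurable_funM.
    by apply/measurable_EFinP; exact: measurable_tuple_prod.
  - by apply: emeasurable_funM => //; exact: measurable_weight.
  by move=> t _; rewrite muleAC lee_wpmul2r ?lee_fin//; exact: tilted_weight_le.
(* On [E] this is [e^(tau - x) >= 1 + tau - x], with [x] the tilted energy and [n ln B] added to
   both sides. Off [E] the last summand alone equals [s]. *)
have intJ : s%:E <= \int[P]_t ((expR tau)%:E * (J t * (\1_E t)%:E) + Y t +
    s%:E * (\1_(~` E) t)%:E).
  rewrite -[leLHS]mule1 -PT -integral_cst//; apply: ge0_le_integral => //.
  - apply: emeasurable_funD; last exact: measurable_funeM.
    by apply: emeasurable_funD => //; apply: measurable_funeM; exact: emeasurable_funM.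
  move=> t _ /=; have [Et|nEt] := pselect (E t); last first.
    rewrite !indicE memNset// mem_set// !mule0 add0e mule1 leeDr//.
  rewrite !indicE (mem_set Et) (_ : (t \in ~` E) = false) ?mule0 ?adde0 ?mule1; last first.
    by apply: memNset => /(_ Et).
  have -> : Y t = total_energy t + (\sum_(i < n) ln (f (tnth t i)))%:E + (n%:R * ln B)%:E.
    have sgE : \sum_(i < n) g (tnth t i) = (\sum_(i < n) ln (f (tnth t i)) + n%:R * ln B)%:E.
      by rewrite sumEFin big_split/= sumr_const card_ord mulr_natl.
    by rewrite /Y sgE EFinD addeA.
  rewrite /J; case: (total_energy t) (total_energy_ge0 t) => [w _| |]//; last first.
    by move=> _; rewrite !addye//= mule0 add0e leey.
  move: (\sum_(i < n) ln (f (tnth t i)))%R => u.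
  rewrite -[expeR _]/((expR (- (w + u)))%:E) -EFinM -!EFinD lee_fin -expRD /s.
  by have := expR_ge1Dx (tau - (w + u)); lra.
apply: (le_trans intJ).
clearbody Y.
have T10 t : 0 <= (expR tau)%:E * (J t * (\1_E t)%:E).
  by rewrite !mule_ge0// lee_fin// expR_ge0.
have mT1 : measurable_fun setT (fun t => (expR tau)%:E * (J t * (\1_E t)%:E)).
  by apply: measurable_funeM; exact: emeasurable_funM.
have T30 t : 0 <= s%:E * (\1_(~` E) t)%:E by rewrite mule_ge0// lee_fin.
have mT3 : measurable_fun setT (fun t => s%:E * (\1_(~` E) t)%:E : \bar R).
  exact: measurable_funeM.
rewrite !ge0_integralD//; last 2 first.
- by move=> t _; rewrite adde_ge0.
- exact: emeasurable_funD.
apply: leeD; first apply: leeD => //.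
- rewrite ge0_integralZl_EFin ?expR_ge0//; last 2 first.
  + by move=> t _; rewrite mule_ge0// lee_fin.
  + exact: emeasurable_funM.
  by rewrite lee_wpmul2l// lee_fin expR_ge0.
- rewrite (@ge0_integralZl_EFin _ _ _ P setT measurableT (fun t => (\1_(~` E) t)%:E)
    (fun t _ => i0 t) m1CE _ s0)//.
  by rewrite integral_indic ?setIT//; exact: measurableC.
Qed.
End weights.

Section free_energy_parts.
Context d (T : measurableType d) (R : realType).
Variable nu : {sigma_finite_measure set T -> \bar R}.
Variables (K : T * T -> \bar R) (f : T -> R).
Hypotheses (K0 : forall x, 0 <= K x) (f0 : forall x, (0 <= f x)%R)
  (fF : free_energy nu K f < +oo).

Lemma entropy1_fin_num : entropy1 nu f \is a fin_num.
Proof.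
rewrite ge0_fin_numE ?entropy1_ge0//; apply: le_lt_trans fF.
by rewrite leeDl// half_pair_integral_ge0.
Qed.

Lemma pair_integral_fin_num : pair_integral nu K f \is a fin_num.
Proof.
rewrite ge0_fin_numE ?pair_integral_ge0//.
have : (2^-1)%:E * pair_integral nu K f < +oo.
  by apply: le_lt_trans fF; rewrite leeDr// entropy1_ge0.
have := pair_integral_ge0 nu K0 f0; case: (pair_integral nu K f) => [r| |]//= _.
  by move=> _; rewrite ltry.
by rewrite gt0_muley ?lte_fin.
Qed.

End free_energy_parts.

Section nice_lower_bound.
Context d (T : measurableType d) (R : realType).
Variable nu : {sigma_finite_measure set T -> \bar R}.
Hypothesis nu_fin : nu setT < +oo.
Let z := fine (nu setT).
Let z0 : (0 <= z)%R. Proof. by rewrite fine_ge0. Qed.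
Let nuE : nu setT = z%:E. Proof. by rewrite fineK// ge0_fin_numE. Qed.
Variables (K : T * T -> \bar R) (A : T -> \bar R).
Hypotheses (mK : measurable_fun [set: T * T] K) (K0 : forall x, 0 <= K x).
Hypotheses (mA : measurable_fun [set: T] A) (A0 : forall x, 0 <= A x).
Variable q : T -> R.
Hypotheses (mq : measurable_fun [set: T] q) (q0 : forall x, (0 <= q x)%R).

Variables (f : T -> R) (B : R).
Hypotheses (Df : density nu f) (B1 : (1 <= B)%R) (nf : nice A q B f)
  (fF : free_energy nu K f < +oo).

Let h := fine (entropy1 nu f).
Let p := fine (pair_integral nu K f).
Let f0 := density_ge0 Df.
Let mf := density_measurable Df.

Let lB0 : (0 <= ln B)%R. Proof. exact: ln_ge0. Qed.

Let entE : entropy1 nu f = h%:E.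
Proof. by rewrite fineK//; exact: entropy1_fin_num K0 f0 fF. Qed.

Let pairE : pair_integral nu K f = p%:E.
Proof. by rewrite fineK//; exact: pair_integral_fin_num K0 f0 fF. Qed.

Let p0 : (0 <= p)%R. Proof. by rewrite fine_ge0// pair_integral_ge0. Qed.

Let freeE : free_energy nu K f = (h + 2^-1 * p)%:E.
Proof. by rewrite /free_energy entE pairE. Qed.

Let g x := ((ln (f x) + ln B) * f x)%R.

Let g0 x : (0 <= g x)%R.
Proof.
rewrite /g; have [->|fx] := eqVneq (f x) 0%R; first by rewrite mulr0.
have [/andP[Bf _] _ _] := nf fx; rewrite mulr_ge0//.
have B0 : (0 < B)%R by apply: lt_le_trans B1.
have fp : (0 < f x)%R by apply: lt_le_trans Bf; rewrite invr_gt0.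
by rewrite -lnM ?posrE// ln_ge0// -ler_pdivrMr// mul1r.
Qed.

Let gE : \int[nu]_x (g x)%:E = (h + ln B - z)%:E.
Proof.
have mlf : measurable_fun setT (fun x => ln (f x)) by exact: measurableT_comp.
have mg : measurable_fun setT g by apply: measurable_funM => //; exact: measurable_funD.
have H : \int[nu]_x (g x)%:E + z%:E = h%:E + (ln B)%:E.
  have <- : \int[nu]_x cst 1 x = z%:E by rewrite -nuE -[RHS]mul1e -integral_cst.
  rewrite -entE -(integralZ_density Df lB0) -!ge0_integralD//.
  - by apply: eq_integral => x _; rewrite -EFinM -!EFinD; congr (_%:E); rewrite /g; ring.
  - by move=> x _; rewrite lee_fin xlnxD1_ge0.
  - exact: measurable_xlnxD1.
  - by move=> x _; rewrite -EFinM lee_fin mulr_ge0.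
  - by apply: measurable_funeM; exact/measurable_EFinP.
  - by move=> x _; rewrite lee_fin.
  - exact/measurable_EFinP.
move: H; case: (\int[nu]_x (g x)%:E) => [r| |]// [H].
by congr (_%:E); rewrite -H addrK.
Qed.

Let ge : (0 <= h + ln B - z)%R.
Proof. by rewrite -lee_fin -gE; apply: integral_ge0 => x _; rewrite lee_fin. Qed.

Lemma nice_partition_gt0 n : (0 < n)%N ->
  0 < \int[tuple_measure nu n]_t weight K A t.
Proof.
move=> n0.
(* This is the bound on the mean of [Y]. With [tau = y] it cancels from both sides, leaving
   [1 + n ln B <= e^y w], where [w] is the integral of the weight. *)
pose y := ((n.-1%:R / 2) * p + B + n%:R * (h + ln B - z))%R.
have B0 : (0 <= B)%R by apply: le_trans B1.
have y0 : (0 <= y)%R by rewrite !addr_ge0// mulr_ge0// divr_ge0.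
have nl : (0 <= n%:R * ln B)%R by rewrite mulr_ge0.
have := linearized_lower_bound mK K0 mA A0 Df n0 B1 nf measurableT (_ : 0 <= 1 + y + n%:R * ln B)%R.
rewrite setCT measure0 mule0 adde0 gE pairE => /(_ _).
rewrite -!EFinM -!EFinD -/y.
have : 0 <= \int[tuple_measure nu n]_t weight K A t.
  by apply: integral_ge0 => t _; exact: expeR_ge0.
case: (integral _ _ _) => [w| |]// _.
rewrite -EFinM -EFinD lee_fin => H; rewrite lte_fin.
have : (0 < expR y * w)%R by have := H _; lra.
by rewrite pmulr_rgt0// expR_gt0.
Qed.

(** The level [tau] exceeds the mean tilted energy by order [n e / 2]. The exceptional event costs
    at most the constant [C], because [s] grows linearly while Chebyshev's bound decays like [1/n].
    For large [n] the gain dominates and the integral is at least [e^-tau]. *)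
Lemma nice_lower_bound (O : set R) (e : R) : open O -> O (fine (moment nu q f)) -> (0 < e)%R ->
  exists n0, forall n, (n0 <= n)%N ->
    (expR (- (n%:R * (fine (free_energy nu K f) - z + e))))%:E <=
    \int[tuple_measure nu n]_(t in [set t | O (mean q t)]) weight K A t.
Proof.
move=> oO Om e0.
have B0 : (0 <= B)%R by apply: le_trans B1.
have h0 : (0 <= h)%R by rewrite fine_ge0// entropy1_ge0.
have [delta /= delta0 hdelta] : exists2 delta : R, (0 < delta)%R &
    forall y, (`|y - fine (moment nu q f)| < delta)%R -> O y.
  have /nbhs_ballP[delta /= delta0 H] := open_nbhs_nbhs (conj oO Om).
  by exists delta => // y hy; apply: H; rewrite -ball_normE/= distrC.
pose S := (1 + B + h + 2^-1 * p + e / 2 + ln B)%R.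
have S0 : (0 <= S)%R by rewrite /S !addr_ge0// ?mulr_ge0// ?divr_ge0// ltW.
pose C := (S * (B ^+ 2 / delta ^+ 2))%R.
have C0 : (0 <= C)%R by rewrite mulr_ge0// divr_ge0 ?sqr_ge0.
(* The part [2 C] of the threshold pays for the exceptional event, the part [2 B] for the constant
   [B] inside [tau]. *)
exists (Num.truncn ((2 * C + 2 * B) / e)).+1 => n nC.
have n0 : (0 < n)%N by apply: leq_trans nC.
have n1 : (1 <= n%:R :> R)%R by rewrite ler1n.
have ne : (2 * C + 2 * B <= n%:R * e)%R.
  by rewrite -ler_pdivrMr//; apply: le_trans (ltW (truncnS_gt _)) _; rewrite ler_nat.
have mO : measurable O by exact: open_measurable.
have mE : measurable [set t : n.-tuple T | O (mean q t)] by exact: measurable_mean_preimage.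
pose tau := (n%:R * (h + 2^-1 * p - z) + B + n%:R * (e / 2))%R.
have s0 : (0 <= 1 + tau + n%:R * ln B)%R.
  have : (0 <= n%:R * (h + ln B - z))%R by rewrite mulr_ge0.
  have : (0 <= n%:R * p)%R by rewrite mulr_ge0.
  have : (0 <= n%:R * (e / 2))%R by rewrite mulr_ge0// divr_ge0// ltW.
  rewrite /tau; lra.
have := linearized_lower_bound mK K0 mA A0 Df n0 B1 nf mE s0.
set s := (1 + tau + n%:R * ln B)%R in s0 *.
have sS : (s <= n%:R * S)%R.
  have : (0 <= (n%:R - 1) * (1 + B))%R by rewrite mulr_ge0 ?subr_ge0// addr_ge0.
  have : (0 <= n%:R * z)%R by rewrite mulr_ge0.
  rewrite /s /tau /S; lra.
have hP : tuple_measure (density_measure Df) n (~` [set t | O (mean q t)]) <=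
    (B ^+ 2 / (n%:R * delta ^+ 2))%:E.
  apply: le_trans (mean_chebyshev Df n0 delta0 mq q0 (B := B) _).
    apply: le_measure; rewrite ?inE; [exact: measurableC| |].
      exact: measurable_mean_dist.
    move=> t /= nO; rewrite leNgt; apply/negP => lt; apply: nO; exact: hdelta.
  by move=> x fx; have [] := nf fx.
have hC : s%:E * tuple_measure (density_measure Df) n (~` [set t | O (mean q t)]) <= C%:E.
  apply: (@le_trans _ _ (s%:E * (B ^+ 2 / (n%:R * delta ^+ 2))%:E)); first exact: lee_wpmul2l.
  rewrite -EFinM lee_fin.
  have -> : (B ^+ 2 / (n%:R * delta ^+ 2) = n%:R^-1 * (B ^+ 2 / delta ^+ 2))%R.
    by rewrite invfM mulrCA.
  rewrite mulrA ler_wpM2r ?divr_ge0 ?sqr_ge0//.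
  by rewrite ler_pdivrMr ?ltr0n// mulrC.
rewrite gE pairE => H.
have {H} := le_trans H (leeD2l _ hC).
rewrite -!EFinM -!EFinD freeE/=.
case: (integral _ _ _) => [w| |] //=; last first.
- by rewrite gt0_muleNy ?lte_fin ?expR_gt0//= leeNy_eq.
- by rewrite leey.
rewrite -EFinM -!EFinD !lee_fin => H.
have nn : (n.-1%:R = n%:R - 1 :> R)%R by rewrite -[n in RHS]prednK// -natr1 addrK.
have H1 : (1 <= expR tau * w)%R.
  move: H; rewrite nn; move: (expR tau * w)%R => v.
  have -> : s = ((n%:R - 1) / 2 * p + B + n%:R * (h + ln B - z) + 1 +
      n%:R * e / 2 + p / 2)%R by rewrite /s /tau; field.
  move: ((n%:R - 1) / 2 * p)%R (n%:R * (h + ln B - z))%R => x1 x2.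
  have : (0 <= p / 2)%R by rewrite divr_ge0.
  move: (p / 2)%R ne; move: (n%:R * e)%R => x3 x4; lra.
apply: (@le_trans _ _ (expR (- tau))).
  by rewrite ler_expR /tau; lra.
by rewrite expRN -[leLHS]mulr1 ler_pdivrMl ?expR_gt0.
Qed.

End nice_lower_bound.

Lemma measurable_bool_set d (T : measurableType d) (g : T -> bool) :
  measurable_fun setT g -> measurable [set x | g x].
Proof. by move=> mg; have := mg measurableT [set true] I; rewrite setTI. Qed.

(** * Approximation by densities with bounded data on their support *)

Section nice_approximation.
Context d (T : measurableType d) (R : realType).
Variable nu : {sigma_finite_measure set T -> \bar R}.
Hypothesis nu_fin : nu setT < +oo.
Variables (K : T * T -> \bar R) (A : T -> \bar R).
Hypotheses (mK : measurable_fun [set: T * T] K) (K0 : forall x, 0 <= K x).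
Hypotheses (mA : measurable_fun [set: T] A) (A0 : forall x, 0 <= A x)
  (Afin : nu [set x | A x = +oo] = 0).
Variable q : T -> R.
Hypotheses (mq : measurable_fun [set: T] q) (q0 : forall x, (0 <= q x)%R).
Variable f : T -> R.
Hypotheses (Df : density nu f) (fF : free_energy nu K f < +oo)
  (mfin : moment nu q f \is a fin_num).

Let f0 := density_ge0 Df.
Let mf := density_measurable Df.

Let S (k : nat) : set T :=
  [set x | [/\ (k.+1%:R^-1 <= f x <= k.+1%:R)%R, A x <= k.+1%:R%:E & (q x <= k.+1%:R)%R]].

Let mS k : measurable (S k).
Proof.
rewrite (_ : S k = [set x | (k.+1%:R^-1 <= f x)%R] `&` [set x | (f x <= k.+1%:R)%R] `&`
    [set x | A x <= k.+1%:R%:E] `&` [set x | (q x <= k.+1%:R)%R]).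
  repeat apply: measurableI; apply: measurable_bool_set.
  - exact: measurable_fun_ler.
  - exact: measurable_fun_ler.
  - exact: measurable_fun_lee.
  - exact: measurable_fun_ler.
apply/seteqP; split => x /=; first by move=> [/andP[? ?] ? ?]; do !split.
by move=> [[[? ?] ?] ?]; split => //; apply/andP.
Qed.

Let ndS : nondecreasing_seq S.
Proof.
move=> i j ij; apply/subsetPset => x [/andP[h1 h2] h3 h4].
have ij1 : (i.+1%:R <= j.+1%:R :> R)%R by rewrite ler_nat.
split.
- by rewrite (le_trans _ h1)/= ?(le_trans h2)// lef_pV2 ?posrE ?ltr0n.
- by rewrite (le_trans h3)// lee_fin.
- exact: le_trans ij1.
Qed.

Let cupS : \bigcup_k S k = [set x | f x != 0%R] `&` [set x | A x < +oo].
Proof.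
apply/seteqP; split => x.
  move=> [k _ [/andP[h1 _] h2 _]]; split => /=.
    by rewrite gt_eqF// (lt_le_trans _ h1)// invr_gt0.
  by rewrite (le_lt_trans h2)// ltry.
move=> [/= fx Ax]; have fp : (0 < f x)%R by rewrite lt_neqAle eq_sym fx f0.
have AE : A x = (fine (A x))%:E by rewrite fineK// ge0_fin_numE.
have a0 : (0 <= fine (A x))%R by rewrite fine_ge0.
have if0 : (0 <= (f x)^-1)%R by rewrite invr_ge0.
pose w := ((f x)^-1 + f x + fine (A x) + q x)%R.
have wk : (w <= (Num.truncn w).+1%:R)%R by exact/ltW/truncnS_gt.
exists (Num.truncn w) => //; have qx := q0 x; rewrite /w in wk *; split.
- apply/andP; split; last by apply: le_trans wk; lra.
  by rewrite -[leRHS]invrK lef_pV2 ?posrE ?invr_gt0//; apply: le_trans wk; lra.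
- by rewrite AE lee_fin; apply: le_trans wk; lra.
- by apply: le_trans wk; lra.
Qed.

(** The sets [S k] exhaust the support of [f] up to the null set where [A] is infinite, and [h]
    vanishes off that support. *)
Let cvg_S (h : T -> R) : measurable_fun setT h -> (forall x, 0 <= h x)%R ->
  (forall x, f x = 0 -> h x = 0)%R -> \int[nu]_x (h x)%:E \is a fin_num ->
  fine (\int[nu]_(x in S k) (h x)%:E) @[k --> \oo] --> fine (\int[nu]_x (h x)%:E).
Proof.
move=> mh h0 fh hfin.
have mhE : measurable_fun setT (EFin \o h) by exact/measurable_EFinP.
have mU : measurable (\bigcup_k S k) by exact: bigcup_measurable.
have h0E x : 0 <= (h x)%:E by rewrite lee_fin.
have -> : \int[nu]_x (h x)%:E = \int[nu]_(x in \bigcup_k S k) (h x)%:E.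
  have mN : measurable [set x | A x = +oo].
    rewrite (_ : [set x | _] = [set x | +oo <= A x]).
      by apply: measurable_bool_set; exact: measurable_fun_lee.
    by apply/seteqP; split => x /=; rewrite leye_eq => /eqP.
  rewrite (ge0_negligible_integral mN)// cupS (integral_restrict_indic _ (_ `\` _)).
  rewrite [RHS]integral_restrict_indic; apply: eq_integral => x _; rewrite !indicE.
  case: (eqVneq (f x) 0%R) => [fx|fx]; first by rewrite (fh _ fx) !mul0e.
  case: (eqVneq (A x) +oo) => Ax.
    by rewrite !memNset// => -[]//= _; rewrite Ax.
  by rewrite !mem_set//; split => //=; [rewrite ltey|exact/eqP].
have cv := nondecreasing_cvg_mu (mu := mdensity nu mh h0) mS mU ndS.
apply: fine_cvg; rewrite fineK; first exact: cv.
rewrite ge0_fin_numE; last by apply: integral_ge0.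
apply: (@le_lt_trans _ _ (\int[nu]_x (h x)%:E)); first exact: ge0_subset_integral.
by rewrite -ge0_fin_numE//; exact: integral_ge0.
Qed.

(** Restrict [f] to [S k] and divide by the remaining mass [c k]. The bound becomes [(k+1) / c k]
    because normalization raises the values of the density. *)
Lemma nice_approx (eta : R) : (0 < eta)%R -> exists B f', [/\ (1 <= B)%R, density nu f',
  nice A q B f', free_energy nu K f' <= free_energy nu K f + eta%:E &
  (`|fine (moment nu q f') - fine (moment nu q f)| <= eta)%R].
Proof.
move=> eta0.
have [_ _ f1] := Df.
pose h := fine (entropy1 nu f); pose p := fine (pair_integral nu K f).
have hE : entropy1 nu f = h%:E by rewrite fineK//; exact: entropy1_fin_num fF.
have pE : pair_integral nu K f = p%:E by rewrite fineK//; exact: pair_integral_fin_num fF.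
pose P := [set x | f x != 0%R].
have mP : measurable P.
  have mb : measurable_fun setT (fun x => f x != 0%R).
    by apply: measurable_neg; exact: measurable_fun_eqr.
  by have := mb measurableT [set true] I; rewrite setTI.
have m1P : measurable_fun setT (\1_P : T -> R) by exact: measurable_indic.
pose c k := fine (\int[nu]_(x in S k) (f x)%:E).
pose m k := fine (\int[nu]_(x in S k) (q x * f x)%:E).
pose u k := (fine (nu P) - fine (nu (S k)))%R.
have mqf : measurable_fun setT (fun x => q x * f x)%R by exact: measurable_funM.
have c1 : c k @[k --> \oo] --> (1 : R)%R.
  have -> : 1%R = fine (\int[nu]_x (f x)%:E) by rewrite f1.
  by apply: cvg_S => //; rewrite f1.
have mm : m k @[k --> \oo] --> fine (moment nu q f).
  by apply: cvg_S => // x; rewrite ?mulr_ge0// => ->; rewrite mulr0.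
have u0 : u k @[k --> \oo] --> (0 : R)%R.
  rewrite -(subrr (fine (nu P))); apply: cvgB; first exact: cvg_cst.
  have E1 D : D `<=` P -> measurable D -> nu D = \int[nu]_(x in D) (\1_P x)%:E.
    by move=> DP mD; rewrite integral_indic// setIidr.
  have SP k : S k `<=` P.
    move=> x Sx; have : (\bigcup_k S k) x by exists k.
    by rewrite cupS => -[].
  have PE : nu P = \int[nu]_x (\1_P x)%:E by rewrite integral_indic// setIT.
  rewrite PE (_ : (fun k => fine (nu (S k))) =
      (fun k => fine (\int[nu]_(x in S k) (\1_P x)%:E))); last first.
    by apply/funext => k; rewrite -E1.
  apply: cvg_S => //.
  - by move=> x fx; rewrite indicE memNset//= /P/= fx eqxx.
  - rewrite -PE ge0_fin_numE//; apply: le_lt_trans nu_fin.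
    by apply: le_measure; rewrite ?inE.
(* An upper bound for the free energy of the restriction. The normalization costs [- ln (c k)];
   [u k] pays for the support outside [S k], where the entropy integrand rises to one; the pair
   integral is divided by [c k] squared. *)
pose W k := ((h - ln (c k) + u k) / c k + p / (2 * c k ^+ 2))%R.
have cW : W k @[k --> \oo] --> (h + 2^-1 * p)%R.
  have -> : (h + 2^-1 * p = (h - ln 1 + 0) / 1 + p / (2 * 1 ^+ 2))%R.
    by rewrite ln1 expr1n; field.
  apply: cvgD; apply: cvgM => //.
  - apply: cvgD => //; apply: cvgB; first exact: cvg_cst.
    by apply: (cvg_comp c (@ln R) c1); exact: (continuous_ln ltr01).
  - by apply: cvgV.
  - exact: cvg_cst.
  - apply: cvgV; first by rewrite expr1n mulr1 pnatr_eq0.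
    by apply: cvgM; [exact: cvg_cst|exact: (cvgM c1 c1)].
have cM : (m k / c k)%R @[k --> \oo] --> fine (moment nu q f).
  by rewrite -[X in _ --> X]divr1; apply: cvgM => //; exact: cvgV.
have [k [ck Wk Mk]] : exists k, [/\ (0 < c k)%R, (W k <= h + 2^-1 * p + eta)%R &
    (`|m k / c k - fine (moment nu q f)| <= eta)%R].
  have e1 : \forall k \near \oo, (0 < c k)%R by apply: (cvgr_gt _ c1); exact: ltr01.
  have e2 : \forall k \near \oo, (W k <= h + 2^-1 * p + eta)%R.
    by apply: (cvgr_le _ cW); rewrite ltrDl.
  move/cvgrPdist_le : cM => /(_ _ eta0) e3.
  move: e1 e2 e3 => [n1 _ h1] [n2 _ h2] [n3 _ h3].
  exists (maxn n1 (maxn n2 n3)); split.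
  - by apply: h1; rewrite /= leq_maxl.
  - by apply: h2; rewrite /= leq_max leq_maxl orbT.
  - by rewrite distrC; apply: h3; rewrite /= !leq_max leqnn !orbT.
have mfE : measurable_fun setT (EFin \o f) by exact/measurable_EFinP.
have f0E x : 0 <= (f x)%:E by rewrite lee_fin.
have fin_le (g : T -> R) : measurable_fun setT g -> (forall x, 0 <= g x)%R ->
    \int[nu]_x (g x)%:E \is a fin_num -> \int[nu]_(x in S k) (g x)%:E \is a fin_num.
  move=> mg g0 gf; rewrite ge0_fin_numE; last by apply: integral_ge0 => x _; rewrite lee_fin.
  apply: (@le_lt_trans _ _ (\int[nu]_x (g x)%:E)).
    apply: ge0_subset_integral => //; first exact/measurable_EFinP.
    by move=> x _; rewrite lee_fin.
  by rewrite -ge0_fin_numE//; apply: integral_ge0 => x _; rewrite lee_fin.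
have cE : \int[nu]_(x in S k) (f x)%:E = (c k)%:E by rewrite fineK// fin_le// f1.
have mkE : \int[nu]_(x in S k) (q x * f x)%:E = (m k)%:E.
  by rewrite fineK// fin_le// => x; rewrite mulr_ge0.
have ck1 : (c k <= 1)%R.
  by rewrite -lee_fin -cE -f1; apply: ge0_subset_integral.
have ick0 : (0 < (c k)^-1)%R by rewrite invr_gt0.
pose f' x := ((c k)^-1 * f x * \1_(S k) x)%R.
have f'0 x : (0 <= f' x)%R by rewrite /f' !mulr_ge0// ltW.
have mf' : measurable_fun setT f'.
  by apply: measurable_funM; [exact: measurable_funM|exact: measurable_indic].
have int_f' (g : T -> R) : measurable_fun setT g -> (forall x, 0 <= g x)%R ->
    \int[nu]_x (g x * f' x)%:E = ((c k)^-1)%:E * \int[nu]_(x in S k) (g x * f x)%:E.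
  move=> mg g0; rewrite (integral_restrict_indic _ (S k)) -ge0_integralZl_EFin ?(ltW ick0)//.
  - by apply: eq_integral => x _; rewrite -!EFinM /f'; congr (_%:E); ring.
  - by move=> x _; rewrite -EFinM lee_fin !mulr_ge0.
  - apply: emeasurable_funM; apply/measurable_EFinP; first exact: measurable_funM.
    exact: measurable_indic.
have Df' : density nu f'.
  split => //; have := int_f' (cst 1%R) (measurable_cst _) (fun=> ler01).
  rewrite (eq_integral (fun x => (f' x)%:E)); last by move=> x _; rewrite /= mul1r.
  move=> ->; rewrite (eq_integral (fun x => (f x)%:E)); last by move=> x _; rewrite /= mul1r.
  by rewrite cE -EFinM mulVf// gt_eqF.
have momE : fine (moment nu q f') = (m k / c k)%R.
  by rewrite /moment int_f'// mkE -EFinM/= mulrC.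
exists (k.+1%:R / c k)%R, f'; split => //; last by rewrite momE.
- by rewrite ler_pdivlMr// mul1r (le_trans ck1)// ler1n.
- move=> x; rewrite /f' indicE; have [/set_mem[/andP[h1 h2] h3 h4] _|] := boolP (x \in S k).
    have kk : (k.+1%:R <= k.+1%:R / c k :> R)%R.
      by rewrite ler_pdivlMr// ler_piMr.
    rewrite mulr1; split.
    - apply/andP; split; last by rewrite mulrC ler_pM2r.
      rewrite invf_div; apply: ler_pM => //; rewrite ?invr_ge0 ?(ltW ck)//.
      by rewrite (le_trans ck1)// invf_ge1.
    - by rewrite (le_trans h3)// lee_fin.
    - exact: le_trans kk.
  by rewrite mulr0 eqxx.
have lc0 : (0 <= - ln (c k))%R by rewrite oppr_ge0; exact: ln_le0.
have SkP : S k `<=` P.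
  move=> x Sx; have : (\bigcup_k S k) x by exists k.
  by rewrite cupS => -[].
have nuPfin : nu P \is a fin_num.
  by rewrite ge0_fin_numE//; apply: le_lt_trans nu_fin; apply: le_measure; rewrite ?inE.
have nuSfin : nu (S k) \is a fin_num.
  by rewrite ge0_fin_numE//; apply: le_lt_trans nu_fin; apply: le_measure; rewrite ?inE.
have uE : nu (P `\` S k) = (u k)%:E.
  rewrite measureD//; last by rewrite -ge0_fin_numE.
  by rewrite (setIidr SkP) /u EFinB !fineK.
have mx' : measurable_fun setT (fun x => (f' x * ln (f' x) + 1)%:E) by exact: measurable_xlnxD1.
have mx : measurable_fun setT (fun x => (f x * ln (f x) + 1)%:E) by exact: measurable_xlnxD1.
have entle : entropy1 nu f' <= ((h - ln (c k) + u k) / c k)%:E.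
  have : (c k)%:E * entropy1 nu f' <= (h - ln (c k) + u k)%:E.
    rewrite (EFinD _ (u k)) (EFinD h) -hE -uE -(integralZ_density Df lc0).
    have mPS : measurable (P `\` S k) by exact: measurableD.
    rewrite -[X in _ <= _ + X](_ : \int[nu]_x (\1_(P `\` S k) x)%:E = _); last first.
      by rewrite integral_indic// setIT.
    have xx0 x : 0 <= (f x * ln (f x) + 1)%:E by rewrite lee_fin xlnxD1_ge0.
    have lcf0 x : 0 <= (- ln (c k))%:E * (f x)%:E by rewrite -EFinM lee_fin mulr_ge0.
    have mlcf : measurable_fun setT (fun x => (- ln (c k))%:E * (f x)%:E).
      exact: measurable_funeM.
    have m1 : measurable_fun setT (fun x => (\1_(P `\` S k) x)%:E : \bar R).
      by apply/measurable_EFinP; exact: measurable_indic.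
    have i0 x : 0 <= (\1_(P `\` S k) x)%:E :> \bar R by rewrite lee_fin.
    rewrite /entropy1 -ge0_integralD// -ge0_integralD//; last 2 first.
    - by move=> x _; rewrite adde_ge0.
    - exact: emeasurable_funD.
    rewrite -ge0_integralZl_EFin ?(ltW ck)//; last first.
      by move=> x _; rewrite lee_fin xlnxD1_ge0.
    apply: ge0_le_integral => //.
    - by move=> x _; rewrite -EFinM lee_fin mulr_ge0 ?(ltW ck)// xlnxD1_ge0.
    - exact: measurable_funeM.
    - by apply: emeasurable_funD => //; exact: emeasurable_funD.
    move=> x _; rewrite -!EFinM -!EFinD lee_fin /f' !indicE.
    have [Sx|Sx] := boolP (x \in S k).
      have [Px nPS] : P x /\ (x \in P `\` S k) = false.
        move/set_mem : Sx => Sx; split; first exact: SkP.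
        by apply: memNset => -[].
      have fx : (0 < f x)%R by rewrite lt_neqAle eq_sym Px f0.
      rewrite nPS mulr1 addr0 lnM ?posrE// lnV ?posrE//.
      have -> : (c k * ((c k)^-1 * f x * (- ln (c k) + ln (f x)) + 1) =
          f x * (- ln (c k) + ln (f x)) + c k)%R by field; rewrite gt_eqF.
      by rewrite mulrDr; lra.
    rewrite mulr0 mul0r add0r mulr1.
    case: (eqVneq (f x) 0%R) => [->|fx]; first by rewrite !(mul0r, mulr0) add0r addr0 ler_wpDr.
    rewrite (_ : x \in P `\` S k) ?mulr1; last first.
      by apply/mem_set; split => //; move/negP : Sx => + Sx; apply; exact/mem_set.
    have := xlnxD1_ge0 (f0 x); have : (0 <= - ln (c k) * f x)%R by rewrite mulr_ge0.
    rewrite /=; lra.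
  have := entropy1_ge0 nu f'0; case: (entropy1 nu f') => [v| |]// _.
    by rewrite -EFinM !lee_fin ler_pdivlMr// mulrC.
  by rewrite gt0_muley ?lte_fin.
have pairle : pair_integral nu K f' <= (p / c k ^+ 2)%:E.
  rewrite mulrC EFinM -pE /pair_integral.
  have ic2 : (0 <= c k ^- 2)%R by rewrite invr_ge0 sqr_ge0.
  have mff : measurable_fun setT (fun x : T * T => (f x.1 * f x.2)%:E).
    by apply/measurable_EFinP; exact: measurable_tensor.
  have mff' : measurable_fun setT (fun x : T * T => (f' x.1 * f' x.2)%:E).
    by apply/measurable_EFinP; exact: measurable_tensor.
  have ff0 x : 0 <= (f x.1 * f x.2)%:E by rewrite lee_fin mulr_ge0.
  rewrite -ge0_integralZl_EFin//; last 2 first.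
  - by move=> x _; rewrite mule_ge0.
  - exact: emeasurable_funM.
  apply: ge0_le_integral => //.
  - by move=> x _; rewrite mule_ge0// lee_fin mulr_ge0.
  - exact: emeasurable_funM.
  - by apply: measurable_funeM; exact: emeasurable_funM.
  move=> x _; rewrite muleCA lee_wpmul2l// -EFinM lee_fin.
  have f'f y : (f' y <= (c k)^-1 * f y)%R.
    rewrite /f' ler_piMr// ?mulr_ge0 ?(ltW ick0)// indicE; by case: (_ \in _).
  apply: (@le_trans _ _ ((c k)^-1 * f x.1 * ((c k)^-1 * f x.2))%R); first exact: ler_pM.
  by rewrite mulrACA -invfM -expr2.
rewrite {2}/free_energy hE pE -EFinM -!EFinD.
apply: le_trans (_ : (W k)%:E <= _); last by rewrite lee_fin.
rewrite /W EFinD; apply: leeD => //.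
apply: (@le_trans _ _ ((2^-1)%:E * (p / c k ^+ 2)%:E)); first exact: lee_wpmul2l.
rewrite -EFinM lee_fin (_ : p / (2 * c k ^+ 2) = 2^-1 * (p / c k ^+ 2))%R//.
by field; rewrite gt_eqF.
Qed.

Lemma lower_bound (O : set R) (e : R) : open O -> O (fine (moment nu q f)) -> (0 < e)%R ->
  exists n0, forall n, (n0 <= n)%N ->
    (expR (- (n%:R * (fine (free_energy nu K f) - fine (nu setT) + e))))%:E <=
    \int[tuple_measure nu n]_(t in [set t | O (mean q t)]) weight K A t.
Proof.
move=> oO Om e0.
have [delta /= delta0 hdelta] : exists2 delta : R, (0 < delta)%R &
    forall y, (`|y - fine (moment nu q f)| < delta)%R -> O y.
  have /nbhs_ballP[delta /= delta0 H] := open_nbhs_nbhs (conj oO Om).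
  by exists delta => // y hy; apply: H; rewrite -ball_normE/= distrC.
pose eta := Num.min (e / 2)%R (delta / 2)%R.
have eta0 : (0 < eta)%R by rewrite lt_min !divr_gt0.
have [B [f' [B1 Df' nf' fF' mf'']]] := nice_approx eta0.
have ffin : free_energy nu K f \is a fin_num.
  by rewrite ge0_fin_numE// free_energy_ge0.
have fF'oo : free_energy nu K f' < +oo.
  by apply: le_lt_trans fF' _; rewrite -(fineK ffin) -EFinD ltry.
have [||n0 hn0] := nice_lower_bound nu_fin mK K0 mA A0 mq q0 Df' B1 nf' fF'oo oO _
    (_ : 0 < e / 2)%R.
- apply: hdelta; apply: le_lt_trans mf'' _; rewrite /eta gt_min; apply/orP; right.
  by rewrite ltr_pdivrMr// ltr_pMr// ltr1n.
- by rewrite divr_gt0.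
exists n0 => n /hn0; apply: le_trans; rewrite lee_fin ler_expR lerN2 ler_wpM2l//.
have f'0 : forall x, (0 <= f' x)%R by have [] := Df'.
have f'fin : free_energy nu K f' \is a fin_num.
  by rewrite ge0_fin_numE// free_energy_ge0.
have : (eta <= e / 2)%R by rewrite ge_min lexx.
by move: fF'; rewrite -(fineK ffin) -(fineK f'fin) -EFinD lee_fin/=; lra.
Qed.

Lemma partition_gt0 n : (0 < n)%N -> 0 < \int[tuple_measure nu n]_t weight K A t.
Proof.
move=> n0; have [B [f' [B1 Df' nf' fF' _]]] := nice_approx ltr01.
apply: (nice_partition_gt0 nu_fin mK K0 mA A0 Df' B1 nf') => //.
have ffin : free_energy nu K f \is a fin_num.
  by rewrite ge0_fin_numE// free_energy_ge0.
by apply: le_lt_trans fF' _; rewrite -(fineK ffin) -EFinD ltry.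
Qed.

End nice_approximation.

(** * Probability measures with a density *)

Lemma measurable_lne (R : realType) : measurable_fun [set: \bar R] (@lne R).
Proof.
rewrite (_ : @lne R = fun x => if x <= 0 then -oo else
    if x < +oo then (ln (fine x))%:E else +oo); last first.
  apply/funext => -[r| |]; by rewrite ?leye_eq ?leNye//= lee_fin ltry.
apply: measurable_fun_ifT => //; first exact: measurable_fun_lee.
apply: measurable_fun_ifT => //; first exact: measurable_fun_lte.
by apply/measurable_EFinP; apply: measurableT_comp => //; exact: fine_measurable.
Qed.

(* [integralD] needs integrability; here [k] may have an infinite integral. *)
Lemma integral_shift d (T : measurableType d) (R : realType)
    (m : {measure set T -> \bar R}) (k : T -> \bar R) (c M : R) :
  m setT = M%:E -> measurable_fun setT k -> (forall x, 0 <= k x) ->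
  \int[m]_x (k x + c%:E) = \int[m]_x k x + (c * M)%:E.
Proof.
move=> mM mk k0.
have cst_int (r : R) : \int[m]_x (cst r%:E x) = (r * M)%:E.
  by rewrite EFinM -mM -integral_cst.
have [c0|c0] := leP 0%R c.
  by rewrite ge0_integralD// ?cst_int// => x _; rewrite lee_fin.
pose h x := k x + c%:E.
have mh : measurable_fun setT h by exact: emeasurable_funD.
have hp := measurable_funepos mh; have hn := measurable_funeneg mh.
have hn_le x : h^\- x <= (- c)%:E.
  rewrite funenegE ge_max lee_fin oppr_ge0 (ltW c0) andbT /h.
  rewrite leeNl -EFinN opprK; case: (k x) (k0 x) => [r| |]// r0.
    by rewrite -EFinD lee_fin; rewrite lee_fin in r0; lra.
  by rewrite addye// leey.
have nfin : \int[m]_x h^\- x \is a fin_num.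
  rewrite ge0_fin_numE; last exact: integral_ge0.
  apply: (@le_lt_trans _ _ (\int[m]_x (cst (- c)%:E x))).
    by apply: ge0_le_integral => // x _; rewrite lee_fin oppr_ge0 ltW.
  by rewrite cst_int ltry.
have E : \int[m]_x h^\+ x + (- c * M)%:E = \int[m]_x k x + \int[m]_x h^\- x.
  rewrite -cst_int -!ge0_integralD//; last by move=> x _; rewrite lee_fin oppr_ge0 ltW.
  apply: eq_integral => x _; rewrite funeposE funenegE /h /=.
  case: (k x) (k0 x) => [r| |]// r0; last by rewrite /= maxye maxNye.
  rewrite -EFinD -EFinN -!EFin_max -!EFinD; congr (_%:E); rewrite lee_fin in r0.
  have [rc|rc] := leP 0%R (r + c)%R.
    have -> : (Num.max (- (r + c)) 0 = 0)%R by apply/max_idPr; lra.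
    lra.
  have -> : (Num.max (- (r + c)) 0 = - (r + c))%R by apply/max_idPl; lra.
  lra.
rewrite integralE -/h.
move: E; have : 0 <= \int[m]_x k x by exact: integral_ge0.
have : 0 <= \int[m]_x h^\+ x by exact: integral_ge0.
rewrite -(fineK nfin); move: (fine _) => w.
case: (\int[m]_x h^\+ x) => [u| |]// _; case: (\int[m]_x k x) => [v| |]// _ //=.
by move=> [E]; congr (_%:E); lra.
Qed.

Section density_probability.
Context d (T : measurableType d) (R : realType).
Variable nu : {sigma_finite_measure set T -> \bar R}.
Variables (f : T -> R) (Df : density nu f).

(** A separate name, to which the probability structure is attached. *)
Definition density_probability : set T -> \bar R := density_measure Df.

HB.instance Definition _ := Measure.on density_probability.

HB.instance Definition _ := Measure_isProbability.Build _ _ _ density_probability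
  (density_measureT Df).

End density_probability.

Section representation.
Context d (T : measurableType d) (R : realType).
Variable nu : {sigma_finite_measure set T -> \bar R}.
Hypothesis nu_fin : nu setT < +oo.
Let z := fine (nu setT).
Let nuE : nu setT = z%:E. Proof. by rewrite fineK// ge0_fin_numE. Qed.
Variable mu : probability T R.

Definition has_density (f : T -> R) :=
  density nu f /\ forall A, measurable A -> mu A = \int[nu]_(x in A) (f x)%:E.

Lemma dominated_has_density : mu `<< nu -> exists f, has_density f.
Proof.
move=> munu; have [g [g0 gfin gint gE]] := radon_nikodym_sigma_finite munu.
have fE x : (fine (g x))%:E = g x by rewrite fineK.
have mg : measurable_fun setT g by exact: measurable_int gint.
have mufE A : measurable A -> mu A = \int[nu]_(x in A) (fine (g x))%:E.
  by move=> mA; under eq_integral do rewrite fE; exact: gE.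
exists (fine \o g); split => //; split.
- by apply: measurableT_comp => //; exact: fine_measurable.
- by move=> x; exact: fine_ge0.
- by rewrite -mufE// probability_setT.
Qed.

Lemma has_density_dominated f : has_density f -> mu `<< nu.
Proof.
move=> [[mf f0 _] muE]; apply/null_content_dominatesP => A mA nA; rewrite muE//.
by apply: null_set_integral => //; apply: measurable_funTS; exact/measurable_EFinP.
Qed.

Lemma ge0_integral_has_density f g : has_density f -> measurable_fun setT g ->
  (forall x, 0 <= g x) -> \int[mu]_x g x = \int[nu]_x (g x * (f x)%:E).
Proof.
move=> [Df muE] mg g0; rewrite -(ge0_integral_density_measure Df)//.
by apply: eq_measure_integral => A mA _; exact: muE.
Qed.

Lemma ge0_integral_has_density2 f (k : T * T -> \bar R) : has_density f ->
  measurable_fun setT k -> (forall x, 0 <= k x) ->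
  \int[mu \x mu]_x k x = pair_integral nu k f.
Proof.
move=> hf mk k0; have [[mf f0 _] _] := hf.
rewrite -(ge0_integral_density_measure2 hf.1)//.
rewrite !fubini_tonelli1//; last first.
rewrite (ge0_integral_has_density hf); last 2 first.
- exact: measurable_fun_fubini_tonelli_F.
- by move=> x; apply: integral_ge0 => y _; exact: k0.
rewrite ge0_integral_density_measure; last 2 first.
- exact: measurable_fun_fubini_tonelli_F.
- by move=> x; apply: integral_ge0 => y _; exact: k0.
apply: eq_integral => x _; congr (_ * _); rewrite /fubini_F.
by apply: eq_measure_integral => A mA _; exact: hf.2.
Qed.

(** The Radon-Nikodym derivative equals [f] almost everywhere for [nu], hence for [mu]. Positive and
    negative parts of the logarithm are transported separately, as each is nonnegative; at zeros of
    [f] the infinite logarithm is killed by the factor [f]. *)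
Lemma has_density_rel_entropy f : has_density f ->
  rel_entropy mu nu = entropy1 nu f + (- z)%:E.
Proof.
move=> hf; have munu := has_density_dominated hf.
have [[mf f0 f1] muE] := hf.
rewrite /rel_entropy; case: asboolP => // _.
pose g := Radon_Nikodym (charge_of_finite_measure mu) nu.
have gint : nu.-integrable setT g by exact: Radon_Nikodym_integrable.
have mg : measurable_fun setT g by exact: measurable_int gint.
have mfE : measurable_fun setT (EFin \o f) by exact/measurable_EFinP.
have gf : ae_eq nu setT g (EFin \o f).
  apply: integral_ae_eq => // E _ mE.
  by rewrite -muE// -Radon_Nikodym_integral.
have gfmu : ae_eq mu setT (@lne R \o g) (@lne R \o (EFin \o f)).
  by apply: ae_eq_comp; exact: (null_dominates_ae_eq measurableT munu).
have mlg : measurable_fun setT (@lne R \o g).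
  by apply: measurableT_comp => //; exact: measurable_lne.
have mlf : measurable_fun setT (@lne R \o (EFin \o f)).
  by apply: measurableT_comp => //; exact: measurable_lne.
rewrite (ae_eq_integral _ _ measurableT mlg mlf gfmu) integralE.
rewrite !(ge0_integral_has_density hf)//; last 2 first.
- exact: measurable_funeneg.
- exact: measurable_funepos.
have mx := measurable_xlnx mf.
have posE x : (@lne R \o (EFin \o f))^\+ x * (f x)%:E =
    (fun x => (f x * ln (f x))%:E)^\+ x.
  rewrite !funeposE/=; have [->|fx] := eqVneq (f x) 0%R; first by rewrite mule0 mul0r maxxx.
  have fp : (0 < f x)%R by rewrite lt_neqAle eq_sym fx f0.
  by rewrite leNgt fp/= -!EFin_max -EFinM maxr_pMl// mulrC mul0r.
have negE x : (@lne R \o (EFin \o f))^\- x * (f x)%:E =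
    (fun x => (f x * ln (f x))%:E)^\- x.
  rewrite !funenegE/=; have [->|fx] := eqVneq (f x) 0%R; first by rewrite mule0 mul0r oppr0 maxxx.
  have fp : (0 < f x)%R by rewrite lt_neqAle eq_sym fx f0.
  by rewrite leNgt fp/= -!EFin_max -EFinM maxr_pMl// mulNr mulrC mul0r.
under eq_integral do rewrite posE; under [X in _ - X]eq_integral do rewrite negE.
rewrite -integralE.
rewrite (eq_integral (fun x => (f x * ln (f x) + 1)%:E + (-1)%:E)); last first.
  by move=> x _; rewrite -EFinD addrK.
rewrite (integral_shift _ nuE) ?mulN1r//; first exact: measurable_xlnxD1.
by move=> x; rewrite lee_fin xlnxD1_ge0.
Qed.

End representation.

Section represented.
Context d (T : measurableType d) (R : realType).
Variable nu : {sigma_finite_measure set T -> \bar R}.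

Lemma density_probability_has_density f (Df : density nu f) :
  has_density nu (density_probability Df) f.
Proof. by []. Qed.

End represented.

(** * The Gibbs measure *)

Lemma sume_gtNy (R : realType) (I : finType) (P : pred I) (f : I -> \bar R) :
  (forall i, -oo < f i) -> -oo < \sum_(i | P i) f i.
Proof.
move=> fN; apply: (big_ind (fun x : \bar R => -oo < x)) => [||j _] //.
by move=> [x| |] [y| |]//= _ _; rewrite ?ltNyr.
Qed.

Lemma product_probability_setT d (T : measurableType d) (R : realType)
  (mu : probability T R) : (mu \x mu) setT = 1%:E.
Proof.
transitivity (mu setT * mu setT); first by rewrite -product_measure1E// setXTT.
by rewrite probability_setT mule1.
Qed.

Section gibbs_setting.
Context (R : realType).
Variable l : {sigma_finite_measure set R -> \bar R}.
Variables (F : {mfun R >-> \bar R}) (G : {mfun (R * R)%type >-> \bar R}).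
Hypotheses (F_gtNy : forall x, -oo < F x) (G_gtNy : forall z, -oo < G z).
Variables (a c : R).
Hypotheses (a_ge0 : (0 <= a)%R) (a_lt1 : (a < 1)%R).
Hypothesis F_int : \int[l]_x expeR (- ((1 - a)%:E * F x)) < +oo.
Hypothesis F_inf : c%:E < ereal_inf (range F).
Hypothesis G_inf : c%:E <
  ereal_inf (range (fun z : R * R => G z + a%:E * (F z.1 + F z.2))).

Local Notation rho := (ref_density F a).
Local Notation nu := (ref_measure l F a).
Let b := (1 - a)%R.
Let b0 : (0 < b)%R. Proof. by rewrite subr_gt0. Qed.

Let Fc x : c%:E <= F x.
Proof. by apply: (le_trans (ltW F_inf)); apply: ereal_inf_lbound; exists x. Qed.

Definition pair_kernel (z : R * R) : \bar R :=
  G z + a%:E * F z.1 + a%:E * F z.2 - c%:E.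

(** With the weight [1/(2n)], the terms [a F] in the pair kernel account only for the fraction
    [(n-1)/n] of [a] times the sum of [F]. The missing [1/n] is carried by this term. *)
Definition self_energy (x : R) : \bar R := a%:E * (F x - c%:E).

Let mF : measurable_fun setT F. Proof. exact: measurable_funPT. Qed.
Let mG : measurable_fun setT G. Proof. exact: measurable_funPT. Qed.
Let mrho : measurable_fun setT rho. Proof. exact: measurable_ref_density. Qed.
Let rho0 x : (0 <= rho x)%R. Proof. exact: ref_density_ge0. Qed.

Lemma measurable_pair_kernel : measurable_fun setT pair_kernel.
Proof.
apply: emeasurable_funB => //; apply: emeasurable_funD.
  apply: emeasurable_funD => //; apply: measurable_funeM.
  exact: (measurableT_comp mF).
by apply: measurable_funeM; exact: (measurableT_comp mF).
Qed.

Lemma pair_kernel_ge0 z : 0 <= pair_kernel z.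
Proof.
have : c%:E <= G z + a%:E * (F z.1 + F z.2).
  by apply: (le_trans (ltW G_inf)); apply: ereal_inf_lbound; exists z.
rewrite /pair_kernel sube_ge0// muleDr//; first by rewrite addeA.
by rewrite /adde_def; case: (F z.1) (F_gtNy z.1) => [?| |]//; case: (F z.2) (F_gtNy z.2).
Qed.

Lemma measurable_self_energy : measurable_fun setT self_energy.
Proof. by apply: measurable_funeM; exact: emeasurable_funB. Qed.

Lemma self_energy_ge0 x : 0 <= self_energy x.
Proof. by rewrite mule_ge0// ?lee_fin// sube_ge0. Qed.

Let rhoE x : (rho x)%:E = expeR (- (b%:E * F x)).
Proof.
rewrite /ref_density fineK// -/b; case: (F x) (F_gtNy x) => [r| |]//= _.
by rewrite gt0_muley.
Qed.

Lemma rho_eq0 x : F x = +oo -> rho x = 0%R.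
Proof. by move=> Fx; apply: EFin_inj; rewrite rhoE Fx gt0_muley. Qed.

Lemma rho_finite x r : F x = r%:E -> rho x = expR (- (b * r)).
Proof. by move=> Fx; apply: EFin_inj; rewrite rhoE Fx. Qed.

Lemma ref_measure_fin : nu setT < +oo.
Proof.
by rewrite /=/mdensity; under eq_integral do rewrite rhoE.
Qed.

(** The self-energy can be infinite only where [F] is, and there the reference density vanishes. *)
Lemma self_energy_fin : nu [set x | self_energy x = +oo] = 0.
Proof.
have mS : measurable [set x | self_energy x = +oo].
  rewrite (_ : [set x | _] = [set x | +oo <= self_energy x]).
    apply: measurable_bool_set; apply: measurable_fun_lee => //.
    exact: measurable_self_energy.
  by apply/seteqP; split => x /=; rewrite leye_eq => /eqP.
rewrite /=/mdensity integral0_eq// => x /= Sx; rewrite rho_eq0//.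
by move: Sx; rewrite /self_energy; case: (F x) (F_gtNy x) => [r| |].
Qed.

(** The two densities [e^(-(1-a)F)] restore the full [F] in each variable, so the integrand differs
    from that of the hypothesis only by the factor [e^c]. *)
Lemma pair_kernel_exp_integral (lam : R) : (forall lam : R,
  \int[l \x l]_z expeR ((lam * (z.1 ^+ 2 + z.2 ^+ 2))%:E - F z.1 - F z.2 - G z) < +oo) ->
  \int[nu \x nu]_x expeR ((lam * (x.1 ^+ 2 + x.2 ^+ 2))%:E - pair_kernel x) < +oo.
Proof.
move=> /(_ lam) h.
have msq : measurable_fun setT (fun z : R * R => (lam * (z.1 ^+ 2 + z.2 ^+ 2))%:E : \bar R).
  apply/measurable_EFinP; apply: measurable_funM => //; apply: measurable_funD.
    by apply: measurable_funX; exact: measurable_fst.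
  by apply: measurable_funX; exact: measurable_snd.
have mF1 : measurable_fun setT (fun z : R * R => F z.1) by exact: (measurableT_comp mF).
have mF2 : measurable_fun setT (fun z : R * R => F z.2) by exact: (measurableT_comp mF).
have mleft : measurable_fun setT (fun z : R * R =>
    expeR ((lam * (z.1 ^+ 2 + z.2 ^+ 2))%:E - pair_kernel z)).
  apply: (measurableT_comp (@measurable_expeR R)); apply: emeasurable_funB => //.
  exact: measurable_pair_kernel.
have mright : measurable_fun setT (fun z : R * R =>
    expeR ((lam * (z.1 ^+ 2 + z.2 ^+ 2))%:E - F z.1 - F z.2 - G z)).
  apply: (measurableT_comp (@measurable_expeR R)).
  by do 3 apply: emeasurable_funB => //.
rewrite ge0_integral_mdensity2//; last by move=> x; exact: expeR_ge0.
apply: (@le_lt_trans _ _ (\int[l \x l]_z ((expR c)%:E *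
    expeR ((lam * (z.1 ^+ 2 + z.2 ^+ 2))%:E - F z.1 - F z.2 - G z)))); last first.
  rewrite ge0_integralZl_EFin ?expR_ge0//; last by move=> x _; exact: expeR_ge0.
  by rewrite lte_mul_pinfty// lee_fin expR_ge0.
apply: ge0_le_integral => //.
- by move=> x _; rewrite mule_ge0 ?expeR_ge0// lee_fin mulr_ge0.
- apply: emeasurable_funM => //; apply/measurable_EFinP; exact: measurable_tensor.
- exact: measurable_funeM.
move=> [x y] _ /=; rewrite /pair_kernel/=.
have rhs0 : 0 <= (expR c)%:E * expeR ((lam * (x ^+ 2 + y ^+ 2))%:E - F x - F y - G (x, y)).
  by rewrite mule_ge0 ?expeR_ge0// lee_fin expR_ge0.
case Fx : (F x) (F_gtNy x) => [r| |]// _; last first.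
  by move: rhs0; rewrite Fx => rhs0; rewrite (rho_eq0 Fx) mul0r mule0.
case Fy : (F y) (F_gtNy y) => [s| |]// _; last first.
  by move: rhs0; rewrite Fx Fy => rhs0; rewrite (rho_eq0 Fy) mulr0 mule0.
rewrite (rho_finite Fx) (rho_finite Fy).
case: (G (x, y)) (G_gtNy (x, y)) => [g| |]// _; last by rewrite /= !mul0e mule0.
pose w := (lam * (x ^+ 2 + y ^+ 2))%R.
rewrite -/w -[expeR _]/((expR (w - (g + a * r + a * s - c)))%:E).
rewrite -[X in _ <= _ * X]/((expR (w - r - s - g))%:E).
rewrite -!EFinM lee_fin -!expRD ler_expR /b; lra.
Qed.

(** The [a c] undoes the shift in the self-energies; the rest undoes [c] in [n (n-1)] pairs of
    weight [1/(2n)]. *)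
Definition energy_shift n : R := (a * c + n.-1%:R * c / 2)%R.

Lemma energyE n (t : n.-tuple R) : (0 < n)%N -> (forall i, F (tnth t i) < +oo) ->
  n%:R%:E * energy F G t = b%:E * \sum_(i < n) F (tnth t i) +
    total_energy pair_kernel self_energy t + (energy_shift n)%:E.
Proof.
move=> n0 Ft; have nr0 : (n%:R != 0 :> R)%R by rewrite pnatr_eq0 -lt0n.
pose phi i := fine (F (tnth t i)).
have FE i : F (tnth t i) = (phi i)%:E.
  by rewrite /phi; case: (F _) (F_gtNy (tnth t i)) (Ft i).
pose Phi := (\sum_i phi i)%R.
have sF : \sum_(i < n) F (tnth t i) = Phi%:E.
  by rewrite -sumEFin; apply: eq_bigr => i _; exact: FE.
pose SG := \sum_(i < n) \sum_(j < n | j != i) G (tnth t i, tnth t j).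
have sA : \sum_(i < n) self_energy (tnth t i) = (a * (Phi - n%:R * c))%:E.
  rewrite (eq_bigr (fun i => (a * (phi i - c))%:E)); last first.
    by move=> i _; rewrite /self_energy FE.
  rewrite sumEFin -mulr_sumr; congr (_ * _)%:E.
  by rewrite sumrB sumr_const card_ord mulr_natl.
have sK : \sum_(i < n) \sum_(j < n | j != i) pair_kernel (tnth t i, tnth t j) =
    SG + (n.-1%:R * (2 * a * Phi) - n%:R * n.-1%:R * c)%:E.
  rewrite (eq_bigr (fun i => \sum_(j < n | j != i) G (tnth t i, tnth t j) +
      (\sum_(j < n | j != i) (a * phi i + a * phi j - c))%:E)); last first.
    move=> i _; rewrite -sumEFin -big_split/=; apply: eq_bigr => j _.
    rewrite /pair_kernel/= !FE; case: (G _) (G_gtNy (tnth t i, tnth t j)) => [g| |]// _.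
    by rewrite -!EFinM -!EFinD; congr (_%:E); ring.
  rewrite big_split/=; congr (_ + _); rewrite sumEFin; congr (_%:E).
  have n1E : (n.-1%:R = n%:R - 1 :> R)%R by rewrite -[n in RHS]prednK// -natr1 addrK.
  (* A row has [n - 1] copies of [a * phi i], and the total [a * Phi] must lose one more because
     [j = i] is excluded. *)
  rewrite (eq_bigr (fun i => (n%:R - 2) * a * phi i + (a * Phi - (n%:R - 1) * c))%R); last first.
    move=> i _; have : (\sum_j (a * phi i + a * phi j - c) =
        n%:R * (a * phi i) + a * Phi - n%:R * c)%R.
      by rewrite sumrB big_split/= !sumr_const card_ord -mulr_sumr !mulr_natl.
    rewrite (bigD1 i)//=; move: (\sum_(j < n | j != i) _)%R => w h; lra.
  rewrite big_split/= -mulr_sumr sumr_const card_ord -/Phi -mulr_natl n1E; ring.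
have SGy : -oo < SG.
  by apply: sume_gtNy => i; apply: sume_gtNy => j; exact: G_gtNy.
rewrite /total_energy /energy /pair_energy sF sA sK -/SG /energy_shift.
have n1E : (n.-1%:R = n%:R - 1 :> R)%R by rewrite -[n in RHS]prednK// -natr1 addrK.
have np : (0 < n%:R :> R)%R by rewrite ltr0n.
case: SG {sK} SGy => [g| |]// _; last first.
  rewrite gt0_muley ?lte_fin ?invr_gt0 ?mulr_gt0 ?exprn_gt0//.
  rewrite addye// gt0_muley ?lte_fin ?invr_gt0 ?mulr_gt0//.
  by rewrite gt0_muley ?lte_fin ?invr_gt0 ?mulr_gt0.
rewrite n1E /b; move: np nr0; move: (n%:R)%R => w np nr0.
rewrite -!EFinM -!EFinD; congr (_%:E); field.
by rewrite nr0.
Qed.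

Lemma gibbs_weightE n (t : n.-tuple R) : (0 < n)%N ->
  expeR (- (n%:R%:E * energy F G t)) = (expR (- energy_shift n))%:E *
    (weight pair_kernel self_energy t * (\prod_(i < n) rho (tnth t i))%:E).
Proof.
move=> n0; have [Ft|] := pselect (forall i, F (tnth t i) < +oo).
  rewrite energyE// /weight.
  have FE i : F (tnth t i) = (fine (F (tnth t i)))%:E.
    by case: (F _) (F_gtNy (tnth t i)) (Ft i).
  have -> : (\prod_(i < n) rho (tnth t i))%R = expR (- (b * \sum_i fine (F (tnth t i))))%R.
    rewrite (eq_bigr (fun i => expR (- (b * fine (F (tnth t i)))))%R); last first.
      by move=> i _; exact: rho_finite.
    by rewrite -expR_sum sumrN -mulr_sumr.
  rewrite (eq_bigr (fun i => (fine (F (tnth t i)))%:E)) ?sumEFin//.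
  case: (total_energy _ _ t) (total_energy_ge0 pair_kernel_ge0 self_energy_ge0 t) => [w| |]// _.
    rewrite -[expeR _]/((expR (- (b * (\sum_i fine (F (tnth t i))) + w + energy_shift n)))%:E).
    rewrite -[X in _ = _ * (X * _)]/((expR (- w))%:E) -!EFinM -!expRD; congr (expR _)%:E.
    by ring.
  by rewrite /= mul0e mule0.
move=> /existsNP[i /negP]; rewrite -leNgt leye_eq => /eqP Fi.
have -> : (\prod_(i < n) rho (tnth t i))%R = 0%R.
  by apply/eqP/prodf_eq0; exists i => //; apply/eqP; exact: rho_eq0.
rewrite !mule0.
have -> : n%:R%:E * energy F G t = +oo.
  have sF : \sum_(i < n) F (tnth t i) = +oo.
    rewrite (bigD1 i)//= Fi addye// -ltNye; exact: sume_gtNy.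
  rewrite /energy sF gt0_muley ?lte_fin ?invr_gt0 ?ltr0n//.
  rewrite addye ?gt0_muley ?lte_fin ?ltr0n//.
  have : -oo < \sum_(i < n) \sum_(j < n | j != i) G (tnth t i, tnth t j).
    by apply: sume_gtNy => k; apply: sume_gtNy => j; exact: G_gtNy.
  case: (\sum_(i < n) _) => [g| |]// _.
  by rewrite gt0_muley// lte_fin invr_gt0 mulr_gt0// exprn_gt0// ltr0n.
by [].
Qed.

Lemma gibbs_integralE n (B : set (n.-tuple R)) : (0 < n)%N -> measurable B ->
  \int[tuple_measure l n]_(t in B) expeR (- (n%:R%:E * energy F G t)) =
  (expR (- energy_shift n))%:E *
    \int[tuple_measure nu n]_(t in B) weight pair_kernel self_energy t.
Proof.
move=> n0 mB.
have mW := @measurable_weight _ _ _ _ _ measurable_pair_kernel measurable_self_energy n.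
have W0 (t : n.-tuple R) : 0 <= weight pair_kernel self_energy t by exact: expeR_ge0.
have m1 : measurable_fun setT (fun t => (\1_B t)%:E : \bar R).
  by apply/measurable_EFinP; exact: measurable_indic.
rewrite (integral_restrict_indic _ B) [in RHS](integral_restrict_indic _ B).
rewrite ge0_integral_tuple_mdensity; last 2 first.
- exact: emeasurable_funM.
- by move=> t; rewrite mule_ge0// lee_fin.
rewrite -ge0_integralZl_EFin ?expR_ge0//; last 2 first.
- by move=> t _; rewrite !mule_ge0// lee_fin// prodr_ge0.
- apply: emeasurable_funM; first exact: emeasurable_funM.
  by apply/measurable_EFinP; exact: measurable_tuple_prod.
by apply: eq_integral => t _; rewrite gibbs_weightE// -!muleA; congr (_ * (_ * _)); rewrite muleC.
Qed.

Let Kc z : G z + a%:E * F z.1 + a%:E * F z.2 = pair_kernel z + c%:E.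
Proof.
rewrite /pair_kernel; move: (G z + _ + _) => w.
by rewrite subeK.
Qed.

(** Half of the shift of the pair kernel gives [c / 2], and the added one in [entropy1] gives the
    mass of [nu]. *)
Lemma has_density_gibbs_functional (mu : probability R R) f : has_density nu mu f ->
  gibbs_functional l F G a mu =
  free_energy nu pair_kernel f + (c / 2 - fine (nu setT))%:E.
Proof.
move=> hf; have [[mf f0 f1] _] := hf.
have mK := measurable_pair_kernel; have K0 := pair_kernel_ge0.
rewrite /gibbs_functional (has_density_rel_entropy ref_measure_fin hf).
under eq_integral do rewrite Kc.
have mu2 := product_probability_setT mu.
rewrite (integral_shift _ mu2)// mulr1 (ge0_integral_has_density2 hf)//.
have := entropy1_ge0 nu f0; have := pair_integral_ge0 nu K0 f0; rewrite /free_energy.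
case: (entropy1 nu f) => [u| |]//; case: (pair_integral nu pair_kernel f) => [v| |]// _ _;
  last by rewrite !gt0_muley ?lte_fin ?invr_gt0.
- by rewrite -!EFinM -!EFinD; congr (_%:E); field.
- by rewrite addye// gt0_muley ?lte_fin ?invr_gt0.
Qed.

Lemma gibbs_functionalNdominated (mu : probability R R) : ~ (mu `<< nu) ->
  gibbs_functional l F G a mu = +oo.
Proof.
move=> nmu; rewrite /gibbs_functional /rel_entropy; case: asboolP => // _.
rewrite addye//; under eq_integral do rewrite Kc.
have mK := measurable_pair_kernel; have K0 := pair_kernel_ge0.
have mu2 := product_probability_setT mu.
rewrite (integral_shift _ mu2)//.
have : 0 <= \int[mu \x mu]_x pair_kernel x by exact: integral_ge0.
case: (integral _ _ _) => [w| |]// _.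
by rewrite addye// gt0_muley// lte_fin invr_gt0.
Qed.

Lemma has_density_second_moment (mu : probability R R) f : has_density nu mu f ->
  second_moment mu = moment nu (fun x => x ^+ 2)%R f.
Proof.
move=> hf; rewrite /second_moment (ge0_integral_has_density hf).
- by [].
- by apply/measurable_EFinP; exact: measurable_funX.
- by move=> x; rewrite lee_fin sqr_ge0.
Qed.

Hypothesis A_int : exists A : set R, [/\ measurable A, 0 < l A &
  \int[l \x l]_(z in A `*` A) (F z.1 + F z.2 + G z) < +oo].

Let sublevel (r : R) := [set x | F x <= r%:E].

Let msublevel r : measurable (sublevel r).
Proof. by apply: measurable_bool_set; exact: measurable_fun_lee. Qed.

Let rho_ge (r : R) x : F x <= r%:E -> (expR (- (b * r)) <= rho x)%R.
Proof.
case Fx : (F x) (F_gtNy x) => [s| |]//; rewrite ?leye_eq// lee_fin => _ sr.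
by rewrite (rho_finite Fx) ler_expR lerN2 ler_pM2l.
Qed.

Let expR_sublevel (D : set R) r : measurable D -> D `<=` sublevel r ->
  (expR (- (b * r)))%:E * l D <= nu D.
Proof.
move=> mD Dr; rewrite -integral_cst//; apply: ge0_le_integral => //.
- by move=> x _; rewrite lee_fin expR_ge0.
- by apply: measurable_funTS; exact/measurable_EFinP.
- by move=> x Dx; rewrite lee_fin; apply: rho_ge; exact: Dr.
Qed.

Let sublevel_fin r : l (sublevel r) < +oo.
Proof.
have h := expR_sublevel (@msublevel r) (fun=> id).
have : (expR (- (b * r)))%:E * l (sublevel r) < +oo.
  apply: le_lt_trans h _; apply: le_lt_trans ref_measure_fin.
  by apply: le_measure; rewrite ?inE.
case: (l _) (measure_ge0 l (sublevel r)) => [w| |]//; first by move=> *; rewrite ltry.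
by rewrite gt0_muley// lte_fin expR_gt0.
Qed.

Let S z := F z.1 + F z.2 + G z.

Let mS : measurable_fun setT S.
Proof.
by apply: emeasurable_funD => //; apply: emeasurable_funD; exact: (measurableT_comp mF).
Qed.

(** Since [S] equals the nonnegative kernel plus [c] plus [b] times the two values of [F], and
    [F >= c], one has [S >= c + 2 b c >= - beta]. *)
Let beta := ((2 * b + 1) * `|c|)%R.

Let beta0 : (0 <= beta)%R.
Proof. by rewrite mulr_ge0// addr_ge0// mulr_ge0// ltW. Qed.

Let bc0 : (0 <= b * `|c|)%R. Proof. by rewrite mulr_ge0// ltW. Qed.

(** If [S < 0] then each [b F] is below [|c| + b |c|], which confines the negative part to a square
    of finite measure. This matters because [+oo - +oo] is [-oo]: only with an integrable negative
    part does the hypothesis on [A] bound the positive part. *)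
Let S_neg z : S^\- z <= beta%:E * (\1_(sublevel (`|c| / b + `|c|) `*`
  sublevel (`|c| / b + `|c|)) z)%:E.
Proof.
case: z => x y; rewrite funenegE ge_max; apply/andP; split; last first.
  by rewrite mule_ge0// lee_fin.
have K0 := pair_kernel_ge0 (x, y); move: K0; rewrite /pair_kernel /S/=.
have := Fc x; have := Fc y.
case Fx : (F x) (F_gtNy x) => [r| |]//; last first.
  case: (F y) (F_gtNy y) => [?| |]//; case: (G (x, y)) (G_gtNy (x, y)) => [?| |]//= *;
  by rewrite leNye.
case Fy : (F y) (F_gtNy y) => [s| |]//; last first.
  by case: (G (x, y)) (G_gtNy (x, y)) => [?| |]//= *; rewrite leNye.
case: (G (x, y)) (G_gtNy (x, y)) => [g| |]//; last by move=> /= *; rewrite leNye.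
move=> _ _ _.
rewrite -!EFinM -!EFinD -!EFinN !lee_fin => cs cr K0.
have := ler_norm c; have := ler_norm (- c); rewrite normrN => nc1 nc2.
have brc : (b * c <= b * r)%R by rewrite ler_pM2l.
have bsc : (b * c <= b * s)%R by rewrite ler_pM2l.
have bcn : (b * - c <= b * `|c|)%R by rewrite ler_pM2l.
have Kb : (c <= g + a * r + a * s)%R by lra.
have bE1 : (a * r = r - b * r)%R by rewrite /b; ring.
have bE2 : (a * s = s - b * s)%R by rewrite /b; ring.
have bE3 : (beta = 2 * (b * `|c|) + `|c|)%R by rewrite /beta; ring.
rewrite indicE; have [_|] := boolP ((x, y) \in _); first by rewrite mulr1 bE3; lra.
rewrite mulr0 => /negP nin; rewrite leNgt; apply/negP => S0; apply: nin.
have bM : (b * (`|c| / b + `|c|) = `|c| + b * `|c|)%R by field; rewrite gt_eqF.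
apply/mem_set; split; rewrite /sublevel/=.
  by rewrite Fx lee_fin -(ler_pM2l b0) bM; lra.
by rewrite Fy lee_fin -(ler_pM2l b0) bM; lra.
Qed.

Let square_fin r : \int[l \x l]_z (\1_(sublevel r `*` sublevel r) z)%:E < +oo.
Proof.
rewrite integral_indic//; last exact: measurableX.
rewrite setIT (_ : _ (_ `*` _) = l (sublevel r) * l (sublevel r)); last exact: product_measure1E.
by rewrite lte_mul_pinfty// ge0_fin_numE//; exact: sublevel_fin.
Qed.

(** The competitor is the normalized restriction of [nu] to the part of [A] where [F] is at most
    some [k]. *)
Lemma finite_free_energy : exists f, density nu f /\ free_energy nu pair_kernel f < +oo.
Proof.
have [A [mA lA Aint]] := A_int.
have mAA : measurable (A `*` A) by exact: measurableX.
have mpos := measurable_funepos mS; have mneg := measurable_funeneg mS.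
have m1 r : measurable_fun setT (fun z => (\1_(sublevel r `*` sublevel r) z)%:E : \bar R).
  by apply/measurable_EFinP; apply: measurable_indic; exact: measurableX.
have i0 r z : 0 <= (\1_(sublevel r `*` sublevel r) z)%:E :> \bar R by rewrite lee_fin.
have negfin : \int[l \x l]_(z in A `*` A) S^\- z < +oo.
  apply: (@le_lt_trans _ _ (\int[l \x l]_z S^\- z)); first exact: ge0_subset_integral.
  apply: (@le_lt_trans _ _ (\int[l \x l]_z (beta%:E *
      (\1_(sublevel (`|c| / b + `|c|) `*` sublevel (`|c| / b + `|c|)) z)%:E))).
    by apply: ge0_le_integral => //; apply: measurable_funeM; exact: m1.
  rewrite (ge0_integralZl_EFin _ measurableT (fun z _ => i0 _ z) (m1 _) beta0).
  by rewrite lte_mul_pinfty ?lee_fin//; exact: square_fin.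
have posfin : \int[l \x l]_(z in A `*` A) S^\+ z < +oo.
  have : \int[l \x l]_(z in A `*` A) S^\+ z - \int[l \x l]_(z in A `*` A) S^\- z < +oo.
    by rewrite -[ltLHS]integralE; exact: Aint.
  have : 0 <= \int[l \x l]_(z in A `*` A) S^\- z by exact: integral_ge0.
  have : 0 <= \int[l \x l]_(z in A `*` A) S^\+ z by exact: integral_ge0.
  move: negfin.
  case: (\int[l \x l]_(z in A `*` A) S^\- z) => [u| |]// _.
  by case: (\int[l \x l]_(z in A `*` A) S^\+ z) => [v| |]// *; exact: ltry.
pose D k := A `&` sublevel k%:R.
have mD k : measurable (D k) by exact: measurableI.
(* Otherwise [F] would be infinite almost everywhere on [A], and the positive part of [S] would have
   infinite integral over the square. *)
have [k lD] : exists k, 0 < l (D k).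
  apply: contrapT => nD.
  have D0 k : l (D k) = 0.
    apply/eqP; rewrite eq_le measure_ge0 andbT leNgt; apply/negP => h; apply: nD; by exists k.
  pose Y := A `&` [set x | +oo <= F x].
  have mY : measurable Y.
    by apply: measurableI => //; apply: measurable_bool_set; exact: measurable_fun_lee.
  have AU : A = (\bigcup_k D k) `|` Y.
    apply/seteqP; split => x; last by move=> [[k _ []]|[]].
    move=> Ax; case Fx : (F x) (F_gtNy x) => [r| |]// _.
      left; exists (Num.truncn r).+1 => //; split => //; rewrite /sublevel/= Fx lee_fin.
      exact/ltW/truncnS_gt.
    by right; split => //=; rewrite Fx.
  have lY : 0 < l Y.
    apply: lt_le_trans lA _; rewrite AU; apply: le_trans (measureU2 _ _ _) _ => //.
      exact: bigcup_measurable.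
    rewrite -[leRHS]add0e leeD2r//; apply: (le_trans (measure_sigma_subadditive _ _ _ _)).
    - exact: mD.
    - exact: bigcup_measurable.
    - exact: subset_refl.
    - by rewrite eseries0// => j _ _; exact: D0.
  move: posfin; apply/negP; rewrite -leNgt.
  apply: (@le_trans _ _ (\int[l \x l]_(z in Y `*` A) S^\+ z)); last first.
    apply: ge0_subset_integral => //; [exact: measurableX|exact: measurable_funTS|].
    by move=> z [[? _] ?].
  rewrite (eq_integral (cst +oo)); last first.
    move=> [x y] /set_mem[[_ /= Fx] _]; rewrite funeposE /S/=; move: Fx; rewrite leye_eq => /eqP ->.
    by case: (F y) (F_gtNy y) => [?| |]//; case: (G (x, y)) (G_gtNy (x, y)) => [?| |]//=; rewrite maxye.
  rewrite integral_cst; last exact: measurableX.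
  rewrite (_ : _ (_ `*` _) = l Y * l A); last exact: product_measure1E.
  by rewrite gt0_mulye// mule_gt0.
have Dk : D k `<=` sublevel k%:R by move=> x [].
have lDfin : l (D k) < +oo.
  by apply: le_lt_trans (sublevel_fin k%:R); apply: le_measure; rewrite ?inE.
have nuDfin : nu (D k) < +oo.
  by apply: le_lt_trans ref_measure_fin; apply: le_measure; rewrite ?inE.
have nuD0 : 0 < nu (D k).
  apply: lt_le_trans (expR_sublevel (mD k) Dk).
  by rewrite mule_gt0// lte_fin expR_gt0.
pose w := fine (nu (D k)).
have wE : nu (D k) = w%:E by rewrite fineK// ge0_fin_numE.
have w0 : (0 < w)%R by rewrite -lte_fin -wE.
have iw0 : (0 < w^-1)%R by rewrite invr_gt0.
pose f x := (w^-1 * \1_(D k) x)%R.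
have f0 x : (0 <= f x)%R by rewrite mulr_ge0// ltW.
have mf : measurable_fun setT f by apply: measurable_funM => //; exact: measurable_indic.
exists f; split.
  split => //; under eq_integral do rewrite EFinM.
  rewrite ge0_integralZl_EFin ?(ltW iw0)//; last first.
    by apply/measurable_EFinP; exact: measurable_indic.
  rewrite (_ : \int[nu]_x (\1_(D k) x)%:E = w%:E) -?EFinM ?mulVf ?gt_eqF//.
  by rewrite -wE -[in RHS](setIT (D k)) -integral_indic.
have K0 := pair_kernel_ge0; have mK := measurable_pair_kernel.
have entfin : entropy1 nu f < +oo.
  pose C := (`|w^-1 * ln w^-1| + 1)%R.
  apply: (@le_lt_trans _ _ (\int[nu]_x (cst C%:E x))).
    apply: ge0_le_integral => //.
    - by move=> x _; rewrite lee_fin xlnxD1_ge0.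
    - exact: measurable_xlnxD1.
    move=> x _; rewrite lee_fin lerD2r /f indicE; case: (_ \in _).
      by rewrite mulr1 ler_norm.
    by rewrite mulr0 mul0r.
  rewrite integral_cst// lte_mul_pinfty// ?lee_fin ?addr_ge0//; exact: ref_measure_fin.
have pairfin : pair_integral nu pair_kernel f < +oo.
  (* The competitor takes only the values [w^-1] and zero, and [F >= c] bounds the reference density
     by [e^(b |c|)]. *)
  pose C := (w^-1 * w^-1 * (expR (b * `|c|) * expR (b * `|c|)))%R.
  have C0 : (0 <= C)%R by rewrite !mulr_ge0 ?expR_ge0 ?(ltW iw0).
  pose g (z : R * R) := C%:E * (S^\+ z * (\1_(A `*` A) z)%:E +
    beta%:E * (\1_(sublevel k%:R `*` sublevel k%:R) z)%:E).
  have mI : measurable_fun setT (fun z => S^\+ z * (\1_(A `*` A) z)%:E).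
    apply: emeasurable_funM => //; apply/measurable_EFinP; exact: measurable_indic.
  have mB : measurable_fun setT (fun z =>
      beta%:E * (\1_(sublevel k%:R `*` sublevel k%:R) z)%:E).
    by apply: measurable_funeM; exact: m1.
  have I0 z : 0 <= S^\+ z * (\1_(A `*` A) z)%:E by rewrite mule_ge0// lee_fin.
  have B0 z : 0 <= beta%:E * (\1_(sublevel k%:R `*` sublevel k%:R) z)%:E.
    by rewrite mule_ge0// lee_fin.
  have gfin : \int[l \x l]_z g z < +oo.
    rewrite /g ge0_integralZl_EFin//; last 2 first.
    - by move=> z _; rewrite adde_ge0.
    - exact: emeasurable_funD.
    rewrite lte_mul_pinfty ?lee_fin// ge0_integralD// -integral_restrict_indic.
    rewrite (ge0_integralZl_EFin _ measurableT (fun z _ => i0 _ z) (m1 _) beta0).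
    by rewrite lte_add_pinfty// lte_mul_pinfty ?lee_fin//; exact: square_fin.
  have mkff : measurable_fun setT (fun z : R * R => pair_kernel z * (f z.1 * f z.2)%:E).
    apply: emeasurable_funM => //; apply/measurable_EFinP; exact: measurable_tensor.
  have kff0 z : 0 <= pair_kernel z * (f z.1 * f z.2)%:E.
    by rewrite mule_ge0// lee_fin mulr_ge0.
  rewrite /pair_integral ge0_integral_mdensity2//.
  apply: le_lt_trans gfin; apply: ge0_le_integral => //.
  - by move=> z _; rewrite mule_ge0// lee_fin mulr_ge0.
  - apply: emeasurable_funM => //; apply/measurable_EFinP; exact: measurable_tensor.
  - by apply: measurable_funeM; exact: emeasurable_funD.
  move=> [x y] _; rewrite /=.
  have g0 z : 0 <= g z by rewrite mule_ge0 ?lee_fin// adde_ge0.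
  have [xD|xD] := boolP (x \in D k); last first.
    by rewrite /f indicE (negbTE xD) mulr0 !mul0r mule0 mul0e; exact: g0.
  have [yD|yD] := boolP (y \in D k); last first.
    by rewrite /f [\1_ _ y]indicE (negbTE yD) mulr0 mulr0 mule0 mul0e; exact: g0.
  rewrite /f !indicE xD yD !mulr1 /g.
  move/set_mem : xD => [Ax xk]; move/set_mem : yD => [Ay yk].
  rewrite !indicE !mem_set//= !mule1.
  have rle u v : F u = v%:E -> (rho u <= expR (b * `|c|))%R.
    move=> Fu; rewrite (rho_finite Fu) ler_expR -mulrN ler_pM2l//.
    by have := Fc u; rewrite Fu lee_fin; have := ler_norm (- c); rewrite normrN; lra.
  move: xk yk (Fc x) (Fc y); rewrite /sublevel/= /pair_kernel/= /S funeposE/=.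
  case Fx : (F x) (F_gtNy x) => [r| |]//.
  case Fy : (F y) (F_gtNy y) => [s| |]//.
  have rx := rle _ _ Fx; have ry := rle _ _ Fy.
  move=> _ _ _ _ cr cs.
  case Gxy : (G (x, y)) (G_gtNy (x, y)) => [v| |]// _; last first.
    rewrite /= maxye addye// gt0_muley ?leey// lte_fin.
    by rewrite /C !mulr_gt0// expR_gt0.
  have K0xy : (0 <= v + a * r + a * s - c)%R.
    by have := K0 (x, y); rewrite /pair_kernel/= Fx Fy Gxy.
  rewrite -[X in X * _ * _]/((v + a * r + a * s - c)%:E) -!EFinM.
  rewrite -[maxe _ _]/(maxe (r + s + v)%:E 0%:E) -EFin_max -EFinD -EFinM lee_fin.
  have h1 : (v + a * r + a * s - c <= Num.max (r + s + v) 0 + beta)%R.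
    rewrite lee_fin in cr; rewrite lee_fin in cs.
    have : (r + s + v <= Num.max (r + s + v) 0)%R by rewrite le_max lexx.
    have := ler_norm (- c); rewrite normrN => nc1.
    have brc : (b * c <= b * r)%R by rewrite ler_pM2l.
    have bsc : (b * c <= b * s)%R by rewrite ler_pM2l.
    have bcn : (b * - c <= b * `|c|)%R by rewrite ler_pM2l.
    have -> : (a * r = r - b * r)%R by rewrite /b; ring.
    have -> : (a * s = s - b * s)%R by rewrite /b; ring.
    have -> : (beta = 2 * (b * `|c|) + `|c|)%R by rewrite /beta; ring.
    lra.
  rewrite -mulrA mulrC; apply: ler_pM => //.
    by rewrite !mulr_ge0// ltW.
  rewrite /C; apply: ler_pM => //; first by rewrite mulr_ge0// ltW.
    by rewrite mulr_ge0.
  exact: ler_pM.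
by rewrite lte_add_pinfty// lte_mul_pinfty// lee_fin invr_ge0.
Qed.

End gibbs_setting.

(** * The large deviation principle *)

Lemma limn_esup_le (R : realType) (u : (\bar R)^nat) (y : \bar R) n0 :
  (forall n, (n0 <= n)%N -> u n <= y) -> limn_esup u <= y.
Proof.
move=> uy; rewrite limn_esup_lim; apply: lime_le; first exact: is_cvg_esups.
exists n0 => // n /= n0n; apply: ge_ereal_sup => _ [k /= nk <-].
by apply: uy; exact: leq_trans nk.
Qed.

Lemma limn_einf_ge (R : realType) (u : (\bar R)^nat) (y : \bar R) n0 :
  (forall n, (n0 <= n)%N -> y <= u n) -> y <= limn_einf u.
Proof.
move=> yu; rewrite limn_einf_lim; apply: lime_ge; first exact: is_cvg_einfs.
exists n0 => // n /= n0n; apply: le_ereal_inf_tmp => _ [k /= nk <-].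
by apply: yu; exact: leq_trans nk.
Qed.

Lemma lte_between (R : realType) (x y : \bar R) : x < y -> exists r : R, x < r%:E < y.
Proof.
move: x y => [x| |] [y| |]//= xy.
- exists ((x + y) / 2)%R; move: xy; rewrite !lte_fin => xy.
  by apply/andP; split; lra.
- by exists (x + 1)%R; rewrite lte_fin ltrDl ltr01 ltry.
- by exists (y - 1)%R; rewrite ltNyr lte_fin ltrBlDr ltrDl ltr01.
- by exists 0%R; rewrite ltNyr ltry.
Qed.

Lemma borel_measurable (R : realType) (B : set R) : borel B -> measurable B.
Proof.
apply: smallest_sub; first exact: sigma_algebra_measurable.
by move=> O; exact: open_measurable.
Qed.

Section gibbs_ldp.
Context (R : realType).
Variable l : {sigma_finite_measure set R -> \bar R}.
Variables (F : {mfun R >-> \bar R}) (G : {mfun (R * R)%type >-> \bar R}).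
Hypotheses (F_gtNy : forall x, -oo < F x) (G_gtNy : forall z, -oo < G z).
Variables (a c : R).
Hypotheses (a_ge0 : (0 <= a)%R) (a_lt1 : (a < 1)%R).
Hypothesis F_int : \int[l]_x expeR (- ((1 - a)%:E * F x)) < +oo.
Hypothesis F_inf : c%:E < ereal_inf (range F).
Hypothesis G_inf : c%:E <
  ereal_inf (range (fun z : R * R => G z + a%:E * (F z.1 + F z.2))).
Hypothesis A_int : exists A : set R, [/\ measurable A, 0 < l A &
  \int[l \x l]_(z in A `*` A) (F z.1 + F z.2 + G z) < +oo].
Hypothesis exp_int : forall lam : R,
  \int[l \x l]_z expeR ((lam * (z.1 ^+ 2 + z.2 ^+ 2))%:E - F z.1 - F z.2 - G z) < +oo.

Local Notation nu := (ref_measure l F a).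
Local Notation K := (pair_kernel F G a c).
Local Notation A := (self_energy F a c).
Let q (x : R) : R := (x ^+ 2)%R.
Let z := fine (nu setT).

Let mK := measurable_pair_kernel F G a c.
Let K0 := pair_kernel_ge0 F_gtNy G_inf.
Let mA := measurable_self_energy F a c.
Let A0 := self_energy_ge0 a_ge0 F_inf.
Let nu_fin := ref_measure_fin F_gtNy a_lt1 F_int.
Let A_fin := self_energy_fin l F_gtNy c a_lt1.
Let mq : measurable_fun setT q. Proof. exact: measurable_funX. Qed.
Let q0 x : (0 <= q x)%R. Proof. exact: sqr_ge0. Qed.
Let expint lam : \int[nu \x nu]_x expeR ((lam * (q x.1 + q x.2))%:E - K x) < +oo.
Proof. exact: pair_kernel_exp_integral. Qed.

Let FE := free_energy nu K.

Let FE_ge0 f : density nu f -> 0 <= FE f.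
Proof. by move=> [_ f0 _]; exact: free_energy_ge0. Qed.

Let FE_fin f : density nu f -> FE f < +oo -> FE f \is a fin_num.
Proof. by move=> Df Ff; rewrite ge0_fin_numE// FE_ge0. Qed.

Let mom_fin f : density nu f -> FE f < +oo -> moment nu q f \is a fin_num.
Proof.
move=> Df Ff; apply: (moment_fin_num nu_fin mK K0 mq q0 expint (C := fine (FE f)) Df).
by rewrite fineK// FE_fin.
Qed.

Definition ground_energy : R := fine (ereal_inf [set FE f | f in density nu]).
Local Notation i0 := ground_energy.

Let ground_energyE : ereal_inf [set FE f | f in density nu] = i0%:E.
Proof.
rewrite fineK// ge0_fin_numE.
  have [f [Df Ff]] := finite_free_energy F_gtNy G_gtNy a_lt1 F_int F_inf G_inf A_int.
  by apply: le_lt_trans Ff; apply: ereal_inf_lbound; exists f.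
by apply: le_ereal_inf_tmp => _ [f Df <-]; exact: FE_ge0.
Qed.

Let ground_energy_le f : density nu f -> i0%:E <= FE f.
Proof. by move=> Df; rewrite -ground_energyE; apply: ereal_inf_lbound; exists f. Qed.

Let ground_energy_approx (e : R) : (0 < e)%R -> exists f, density nu f /\ FE f < (i0 + e)%:E.
Proof.
move=> e0; have : ereal_inf [set FE f | f in density nu] < (i0 + e)%:E.
  by rewrite ground_energyE lte_fin ltrDl.
by move=> /ereal_inf_lt[_ [f Df <-] h]; exists f.
Qed.

Definition weight_integral n (B : set (n.-tuple R)) : \bar R :=
  \int[tuple_measure nu n]_(t in B) weight K A t.

Let partition_fin n : weight_integral [set: n.-tuple R] < +oo.
Proof.
rewrite /weight_integral; apply: (@le_lt_trans _ _ (tuple_measure nu n setT)); last first.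
  exact: tuple_measure_setT_lty.
rewrite -[leRHS]mul1e -integral_cst//; apply: ge0_le_integral => //.
- by move=> t _; exact: expeR_ge0.
- exact: measurable_weight.
move=> t _; rewrite /weight -expeR0 lee_expeR oppe_le0.
exact: total_energy_ge0.
Qed.

Let partition_pos n : (0 < n)%N -> 0 < weight_integral [set: n.-tuple R].
Proof.
move=> n0; have [f [Df Ff]] := finite_free_energy F_gtNy G_gtNy a_lt1 F_int F_inf G_inf A_int.
exact: (partition_gt0 nu_fin mK K0 mA A0 A_fin mq q0 Df Ff (mom_fin Df Ff)).
Qed.

Lemma partition_function_bounds n : 0 < partition_function l F G n.+1 < +oo.
Proof.
rewrite /partition_function (gibbs_integralE l F_gtNy G_gtNy a_ge0 a_lt1 F_inf G_inf)//.
rewrite -/(weight_integral _); apply/andP; split.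
  by rewrite mule_gt0 ?partition_pos// lte_fin expR_gt0.
by rewrite lte_mul_pinfty ?partition_fin// lee_fin expR_ge0.
Qed.

Let W n := fine (weight_integral [set: n.+1.-tuple R]).

Let WE n : weight_integral [set: n.+1.-tuple R] = (W n)%:E.
Proof. by rewrite fineK// ge0_fin_numE ?partition_fin// ltW// partition_pos. Qed.

Let W0 n : (0 < W n)%R. Proof. by rewrite -lte_fin -WE partition_pos. Qed.

Let gibbsE n (B : set (n.+1.-tuple R)) : measurable B ->
  gibbs l F G B = ((W n)^-1)%:E * weight_integral B.
Proof.
move=> mB; rewrite /gibbs /partition_function !(gibbs_integralE l F_gtNy G_gtNy a_ge0 a_lt1 F_inf G_inf)//.
rewrite -/(weight_integral _) -/(weight_integral B) WE -EFinM/= muleA -EFinM.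
by congr (_%:E * _); rewrite invfM mulrAC mulVf ?mul1r// gt_eqF// expR_gt0.
Qed.

Let scaled_normE n (t : n.+1.-tuple R) : scaled_norm t = Num.sqrt (mean q t).
Proof. by rewrite /scaled_norm /mean mulrC sqrtrM ?invr_ge0// sqrtrV. Qed.

Let msqrt : measurable_fun setT (@Num.sqrt R).
Proof. by apply: continuous_measurable_fun; exact: sqrt_continuous. Qed.

Let mevent n (B : set R) : measurable B ->
  measurable [set t : n.-tuple R | B (Num.sqrt (mean q t))].
Proof.
move=> mB; apply: (@measurable_mean_preimage _ _ _ n q (@Num.sqrt R @^-1` B)) => //.
by rewrite -[X in measurable X]setTI; exact: msqrt.
Qed.

Let event_upper (C : set R) (theta e : R) : closed C -> (0 < e)%R ->
  (forall f, density nu f -> C (Num.sqrt (fine (moment nu q f))) -> theta%:E <= FE f) ->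
  exists n0, forall n, (n0 <= n)%N ->
    weight_integral [set t : n.-tuple R | C (Num.sqrt (mean q t))] <=
    (expR (- (n%:R * (theta - z - e))))%:E.
Proof.
move=> cC e0 hC; have cC2 : closed (@Num.sqrt R @^-1` C).
  by apply: preimage_closed => // x _; exact: sqrt_continuous.
have [n0 hn0] := upper_bound nu_fin mK K0 mq q0 expint cC2 e0 hC.
exists n0 => n /hn0; apply: le_trans; apply: ge0_le_integral => //.
- by apply: mevent; exact: closed_measurable.
- by move=> t _; exact: expeR_ge0.
- by apply: measurable_funTS; exact: measurable_weight.
- apply: measurable_funTS; apply: (measurableT_comp (@measurable_expeR R)).
  by apply: measurableT_comp => //; exact: measurable_pair_energy.
- by move=> t _; exact: weight_le.
Qed.

Let event_lower (O : set R) f (e : R) : open O -> (0 < e)%R -> density nu f -> FE f < +oo ->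
  O (Num.sqrt (fine (moment nu q f))) ->
  exists n0, forall n, (n0 <= n)%N ->
    (expR (- (n%:R * (fine (FE f) - z + e))))%:E <=
    weight_integral [set t : n.-tuple R | O (Num.sqrt (mean q t))].
Proof.
move=> oO e0 Df Ff Of; have oO2 : open (@Num.sqrt R @^-1` O).
  by apply: open_comp => // x _; exact: sqrt_continuous.
exact: (lower_bound nu_fin mK K0 mA A0 A_fin mq q0 Df Ff (mom_fin Df Ff) oO2 Of e0).
Qed.

(** The partition function is bounded below by [event_lower] on the whole line, at a density within
    [e / 3] of the ground energy. The mass [z] cancels in the quotient. *)
Let gibbs_event_upper (C : set R) (theta e : R) : closed C -> (0 < e)%R ->
  (forall f, density nu f -> C (Num.sqrt (fine (moment nu q f))) -> theta%:E <= FE f) ->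
  exists n0, forall n, (n0 <= n)%N ->
    gibbs l F G [set t : n.+1.-tuple R | C (Num.sqrt (mean q t))] <=
    (expR (- (n.+1%:R * (theta - i0 - e))))%:E.
Proof.
move=> cC e0 hC; have e30 : (0 < e / 3)%R by rewrite divr_gt0.
have [n1 hn1] := event_upper cC e30 hC.
have [f [Df Ff]] := ground_energy_approx e30.
have Ffoo : FE f < +oo by apply: lt_trans Ff (ltry _).
have [n2 hn2] := event_lower (@openT R) e30 Df Ffoo I.
exists (maxn n1 n2) => n; rewrite geq_max => /andP[n1n n2n].
have {}hn1 := hn1 n.+1 (leqW n1n); have {}hn2 := hn2 n.+1 (leqW n2n).
have mC : measurable [set t : n.+1.-tuple R | C (Num.sqrt (mean q t))].
  by apply: mevent; exact: closed_measurable.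
rewrite gibbsE//; move: hn1 hn2.
rewrite (_ : [set t | setT _] = setT)// WE lee_fin => hn1 hn2.
apply: (@le_trans _ _ (((W n)^-1)%:E * (expR (- (n.+1%:R * (theta - z - e / 3))))%:E)).
  by rewrite lee_wpmul2l// lee_fin invr_ge0 ltW.
rewrite -EFinM lee_fin ler_pdivrMl//.
apply: (@le_trans _ _ (expR (- (n.+1%:R * (fine (FE f) - z + e / 3))) *
    expR (- (n.+1%:R * (theta - i0 - e))))%R); last by rewrite ler_wpM2r ?expR_ge0.
rewrite -expRD ler_expR.
have : (fine (FE f) <= i0 + e / 3)%R by rewrite -lee_fin fineK ?FE_fin// ltW.
move=> h; have : (n.+1%:R * fine (FE f) <= n.+1%:R * (i0 + e / 3) :> R)%R by rewrite ler_wpM2l.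
move: (n.+1%:R : R) (ler0n R n.+1) => w w0; have : (0 <= w * e)%R by rewrite mulr_ge0// ltW.
lra.
Qed.

(** Here the partition function is bounded above by [event_upper] for the closed set [setT], with
    the ground energy as [theta]. *)
Let gibbs_event_lower (O : set R) f (e : R) : open O -> (0 < e)%R -> density nu f ->
  FE f < +oo -> O (Num.sqrt (fine (moment nu q f))) ->
  exists n0, forall n, (n0 <= n)%N ->
    (expR (- (n.+1%:R * (fine (FE f) - i0 + e))))%:E <=
    gibbs l F G [set t : n.+1.-tuple R | O (Num.sqrt (mean q t))].
Proof.
move=> oO e0 Df Ff Of; have e20 : (0 < e / 2)%R by rewrite divr_gt0.
have [n1 hn1] := event_lower oO e20 Df Ff Of.
have [|n2 hn2] := event_upper (C := setT) (theta := i0) closedT e20.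
  by move=> g Dg _; exact: ground_energy_le.
exists (maxn n1 n2) => n; rewrite geq_max => /andP[n1n n2n].
have {}hn1 := hn1 n.+1 (leqW n1n); have {}hn2 := hn2 n.+1 (leqW n2n).
have mO : measurable [set t : n.+1.-tuple R | O (Num.sqrt (mean q t))].
  by apply: mevent; exact: open_measurable.
rewrite gibbsE//; move: hn1 hn2.
rewrite (_ : [set t | setT _] = setT)// WE lee_fin => hn1 hn2.
apply: (@le_trans _ _ (((W n)^-1)%:E * (expR (- (n.+1%:R * (fine (FE f) - z + e / 2))))%:E)); last first.
  by rewrite lee_wpmul2l// lee_fin invr_ge0 ltW.
rewrite -EFinM lee_fin ler_pdivlMl//.
apply: (@le_trans _ _ (expR (- (n.+1%:R * (i0 - z - e / 2))) *
    expR (- (n.+1%:R * (fine (FE f) - i0 + e))))%R); first by rewrite ler_wpM2r ?expR_ge0.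
rewrite -expRD ler_expR; move: (n.+1%:R : R) => w; lra.
Qed.

Local Notation J := (norm_rate l F G a).

Let kappa := (c / 2 - z)%R.

Let functionalE mu f : has_density nu mu f ->
  gibbs_functional l F G a mu = FE f + kappa%:E.
Proof. exact: has_density_gibbs_functional. Qed.

Let functional_lt (mu : probability R R) : gibbs_functional l F G a mu < +oo ->
  exists2 f, has_density nu mu f & FE f < +oo.
Proof.
move=> h; have [munu|nmunu] := pselect (mu `<< nu); last first.
  by move: h; rewrite (gibbs_functionalNdominated F_gtNy G_inf nmunu).
have [f hf] := dominated_has_density munu; exists f => //.
move: h; rewrite (functionalE hf); have := FE_ge0 hf.1.
by case: (FE f) => [u| |]// *; exact: ltry.
Qed.

Let P2_density f (Df : density nu f) : FE f < +oo -> P2 (density_probability Df).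
Proof.
move=> Ff; rewrite /P2/= (has_density_second_moment (density_probability_has_density Df)).
by rewrite -ge0_fin_numE ?mom_fin// moment_ge0.
Qed.

(** A finite value of the functional forces a density, and finite free energy forces a finite second
    moment; the infimum over [P2] is therefore the one over densities. *)
Let inf_functional : ereal_inf (gibbs_functional l F G a @` (@P2 R)) = (i0 + kappa)%:E.
Proof.
apply/eqP; rewrite eq_le; apply/andP; split.
  apply/lee_addgt0Pr => e e0; have [f [Df Ff]] := ground_energy_approx e0.
  have Ffoo : FE f < +oo by apply: lt_trans Ff (ltry _).
  apply: (@le_trans _ _ (FE f + kappa%:E)).
    apply: ereal_inf_lbound; exists (density_probability Df); first exact: P2_density.
    exact: functionalE (density_probability_has_density Df).
  rewrite -(fineK (FE_fin Df Ffoo)) -!EFinD lee_fin.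
  by move: Ff; rewrite -(fineK (FE_fin Df Ffoo)) lte_fin; lra.
apply: le_ereal_inf_tmp => _ [mu _ <-].
have [h|] := ltP (gibbs_functional l F G a mu) +oo; last by rewrite leye_eq => /eqP ->; rewrite leey.
have [f hf _] := functional_lt h.
by rewrite (functionalE hf) EFinD leeD2r// ground_energy_le; have [] := hf.
Qed.

Let starE mu f : has_density nu mu f ->
  gibbs_functional_star l F G a mu = FE f - i0%:E.
Proof.
move=> hf; rewrite /gibbs_functional_star inf_functional (functionalE hf).
have := FE_ge0 hf.1; case: (FE f) => [u| |]// _.
by rewrite -EFinD -!EFinB; congr (_%:E); ring.
Qed.

Let norm_rate_le f : density nu f -> FE f < +oo ->
  J (Num.sqrt (fine (moment nu q f))) <= FE f - i0%:E.
Proof.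
move=> Df Ff; apply: ereal_inf_lbound; have hf := density_probability_has_density Df.
exists (density_probability Df); last exact: starE.
split; first exact: P2_density.
by rewrite (has_density_second_moment hf).
Qed.

Let norm_rate_lt x (r : R) : J x < r%:E ->
  exists f, [/\ density nu f, FE f < (i0 + r)%:E & x = Num.sqrt (fine (moment nu q f))].
Proof.
move=> /ereal_inf_lt[_ [mu [P2mu ->] <-]] h.
have fin : gibbs_functional l F G a mu < +oo.
  rewrite ltNge leye_eq; apply/negP => /eqP E.
  by move: h; rewrite /gibbs_functional_star inf_functional E.
have [f hf Ff] := functional_lt fin.
exists f; split; [by have [] := hf| |by rewrite (has_density_second_moment hf)].
move: h; rewrite (starE hf) -(fineK (FE_fin hf.1 Ff)) -EFinB !lte_fin; lra.
Qed.

Let norm_rate_ge0 x : 0 <= J x.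
Proof.
apply: le_ereal_inf_tmp => _ [mu _ <-]; rewrite /gibbs_functional_star inf_functional.
have [h|] := ltP (gibbs_functional l F G a mu) +oo; last first.
  by rewrite leye_eq => /eqP ->; rewrite addye// leey.
have [f hf Ff] := functional_lt h.
rewrite -inf_functional -/(gibbs_functional_star l F G a mu) (starE hf).
by rewrite sube_ge0// ground_energy_le; have [] := hf.
Qed.

(** The common source of lower semicontinuity and goodness: near minimizers at the points [x n] have
    a limit density whose moment is the square of [y]. The strict inequality is what provides
    densities before attainment of the infimum is known. *)
Let norm_rate_limit (x : nat -> R) (y r : R) : (forall n, J (x n) < r%:E) ->
  (forall n, `|y - x n| <= n.+1%:R^-1)%R -> J y <= r%:E.
Proof.
move=> Jx xy; have [f hf] := choice (fun n => norm_rate_lt (Jx n)).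
have [U [UU ooU]] := ultraFilterLemma (F := \oo) _.
have [||g [Dg gC gcv]] := free_energy_compact (f := f) (C := (i0 + r)%R)
    nu_fin mK K0 mq q0 expint UU ooU.
- by move=> n; have [] := hf n.
- by move=> n; have [_ /ltW] := hf n.
have xE n : Num.sqrt (fine (moment nu q (f n))) = x n by have [] := hf n.
have cv1 : x n @[n --> U] --> Num.sqrt (fine (moment nu q g)).
  rewrite (_ : x = (@Num.sqrt R) \o (fun n => fine (moment nu q (f n)))); last first.
    by apply/funext => n; rewrite /= xE.
  by apply: (cvg_comp _ _ gcv); exact: sqrt_continuous.
have cv2 : x n @[n --> U] --> y.
  apply/cvgrPdist_le => e e0; apply: ooU.
  exists (Num.truncn e^-1) => // n /= ne; apply: (le_trans (xy n)).
  rewrite -[leRHS]invrK lef_pV2 ?posrE ?invr_gt0//.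
  by apply: le_trans (ltW (truncnS_gt _)) _; rewrite ler_nat.
have -> : y = Num.sqrt (fine (moment nu q g)) by exact: (cvg_unique _ cv2 cv1).
have Fg : FE g < +oo by apply: le_lt_trans gC (ltry _).
apply: (le_trans (norm_rate_le Dg Fg)).
by move: gC; rewrite -/(FE g) -(fineK (FE_fin Dg Fg)) -EFinB !lee_fin; lra.
Qed.

Let near_points (D : set R) y : (forall V, nbhs y V -> exists x, V x /\ D x) ->
  exists x : nat -> R, forall n, D (x n) /\ (`|y - x n| <= n.+1%:R^-1)%R.
Proof.
move=> h; have H n : exists x, D x /\ (`|y - x| <= n.+1%:R^-1)%R.
  have [|x [Vx Dx]] := h (ball y n.+1%:R^-1); first by apply: nbhsx_ballx; rewrite invr_gt0.
  by exists x; split => //; move: Vx; rewrite -ball_normE/= => /ltW.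
by have [x hx] := choice H; exists x.
Qed.

Lemma norm_rate_lsc : lower_semicontinuous J.
Proof.
move=> y r rJ; have [r' rr' r'J] : exists2 r' : R, (r < r')%R & r'%:E < J y.
  move: rJ; case: (J y) => [j| |]//; last by move=> _; exists (r + 1)%R; rewrite ?ltry// ltrDl.
  by rewrite lte_fin => rj; exists ((r + j) / 2)%R; rewrite ?lte_fin; lra.
apply: contrapT => h.
have [|x hx] := @near_points [set x | J x <= r%:E] y.
  move=> V Vy; apply: contrapT => h2; apply: h; exists V => // x Vx.
  by rewrite ltNge; apply/negP => Jx; apply: h2; exists x.
have := @norm_rate_limit x y r' _ (fun n => (hx n).2).
rewrite leNgt r'J => h3; have : false by apply: h3 => n; apply: le_lt_trans (hx n).1 _; rewrite lte_fin.
by [].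
Qed.

(** On a free energy sublevel the second moment is at most [R0 + 1]: the head contributes at most
    [R0] and the tail at most one. Sublevel sets of [J] are thus closed subsets of a segment. *)
Lemma norm_rate_good : good_rate J.
Proof.
move=> r.
have [R0 [R00 hR0]] := uniform_head_moment nu_fin mK K0 mq q0 expint (i0 + (r + 1)) ltr01.
apply: (@subclosed_compact _ _ `[0%R, Num.sqrt (R0 + 1)]%classic).
- move=> y /= cy; have [|x hx] := @near_points [set x | J x <= r%:E] y.
    by move=> V Vy; have [x [Jx Vx]] := cy V Vy; exists x.
  apply/lee_addgt0Pr => e e0; rewrite -EFinD.
  apply: (@norm_rate_limit x) => n; last exact: (hx n).2.
  by apply: le_lt_trans (hx n).1 _; rewrite lte_fin ltrDl.
- exact: segment_compact.
move=> x /= Jx; have [|f [Df Ff ->]] := @norm_rate_lt x (r + 1)%R.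
  by apply: le_lt_trans Jx _; rewrite lte_fin ltrDl.
rewrite in_itv/= sqrtr_ge0/= ler_wsqrtr//.
have /andP[_ /le_trans] := hR0 R0 f (lexx _) Df (ltW Ff); apply; rewrite lerD2r.
have hb := integral_density_bounded Df (measurable_head_part mq R0)
  (fun x => head_part_bnd q0 x R00).
rewrite -lee_fin fineK// -(integralZ_density Df R00); apply: ge0_le_integral => //.
- move=> t _; rewrite lee_fin mulr_ge0//; last by have [_ f0 _] := Df; exact: f0.
  by have /andP[] := head_part_bnd q0 t R00.
- apply/measurable_EFinP; apply: measurable_funM; first exact: measurable_head_part.
  by have [] := Df.
- by apply: measurable_funeM; apply/measurable_EFinP; have [] := Df.
move=> t _; rewrite -EFinM lee_fin ler_wpM2r//; first by have [_ f0 _] := Df; exact: f0.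
by have /andP[] := head_part_bnd q0 t R00.
Qed.

Let log_lower n (v : \bar R) (y : R) : (expR (- (n.+1%:R * y)))%:E <= v ->
  (- y)%:E <= (n.+1%:R^-1)%:E * lne v.
Proof.
move=> h; have v0 : 0 <= v by apply: le_trans h; rewrite lee_fin expR_ge0.
have : (- (n.+1%:R * y))%:E <= lne v.
  rewrite -[leLHS]expeRK lee_lne ?in_itv/= ?leey ?andbT ?lee_fin ?expR_ge0//.
move=> /(lee_wpmul2l (x := (n.+1%:R^-1)%:E)); rewrite lee_fin invr_ge0 => /(_ (ler0n _ _)).
by apply: le_trans; rewrite -EFinM lee_fin mulrN mulKf// pnatr_eq0.
Qed.

Let log_upper n (v : \bar R) (y : R) : 0 <= v -> v <= (expR (- (n.+1%:R * y)))%:E ->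
  (n.+1%:R^-1)%:E * lne v <= (- y)%:E.
Proof.
move=> v0 h.
have : lne v <= (- (n.+1%:R * y))%:E.
  rewrite -[leRHS]expeRK lee_lne ?in_itv/= ?leey ?andbT ?lee_fin ?expR_ge0//.
move=> /(lee_wpmul2l (x := (n.+1%:R^-1)%:E)); rewrite lee_fin invr_ge0 => /(_ (ler0n _ _)).
by move=> /le_trans; apply; rewrite -EFinM lee_fin mulrN mulKf// pnatr_eq0.
Qed.

Lemma gibbs_ldp (d : nat -> measure_display) (Omega : forall n, measurableType (d n))
    (P : forall n, probability (Omega n) R)
    (X : forall n, {RV (P n) >-> (n.+1.-tuple R)}) :
  (forall n (B : set (n.+1.-tuple R)), measurable B ->
    distribution (P n) (X n) B = gibbs l F G B) ->
  ldp P (fun n w => scaled_norm (X n w)) (fun n => n.+1%:R) J.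
Proof.
move=> XG.
have preE n (B : set R) : (fun w => scaled_norm (X n w)) @^-1` B =
    X n @^-1` [set t | B (Num.sqrt (mean q t))].
  by apply/seteqP; split => w /=; rewrite scaled_normE.
have mpre n (B : set R) : measurable B -> measurable ((fun w => scaled_norm (X n w)) @^-1` B).
  move=> mB; rewrite preE -[X in measurable X]setTI.
  by apply: measurable_funPT => //; exact: mevent.
have PE n (B : set R) : measurable B -> P n ((fun w => scaled_norm (X n w)) @^-1` B) =
    gibbs l F G [set t : n.+1.-tuple R | B (Num.sqrt (mean q t))].
  by move=> mB; rewrite preE -XG//; exact: mevent.
have Pmono n (B C : set R) : measurable B -> measurable C -> B `<=` C ->
    P n ((fun w => scaled_norm (X n w)) @^-1` B) <= P n ((fun w => scaled_norm (X n w)) @^-1` C).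
  by move=> mB mC BC; apply: le_measure; rewrite ?inE; [exact: mpre..|exact: preimage_subset].
split.
- by move=> n B /borel_measurable; exact: mpre.
- split=> [n|]; first by rewrite ltr0n.
  by apply/cvgryPge => r; exists (Num.truncn r) => // n /= rn;
     rewrite (le_trans (ltW (truncnS_gt r)))// ler_nat ltnS.
- exact: norm_rate_ge0.
- exact: norm_rate_lsc.
move=> B /borel_measurable mB u; split.
- rewrite leeNl; apply: le_ereal_inf_tmp => _ [x /= Bx <-].
  rewrite leeNl leNgt; apply/negP => h.
  have [r hr1 hr2] : exists2 r : R, J x < r%:E & limn_einf u < (- r)%:E.
    have [r /andP[r1 r2]] := lte_between h.
    by exists (- r)%R; rewrite ?opprK// EFinN lteNr.
  have [f [Df Ff xE]] := norm_rate_lt hr1.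
  have Ffoo : FE f < +oo by apply: lt_trans Ff (ltry _).
  (* The whole slack is used as tolerance, so that the exponent of the lower bound becomes exactly
     [r]. *)
  have e0 : (0 < i0 + r - fine (FE f))%R.
    by rewrite subr_gt0 -lte_fin fineK ?FE_fin.
  have [|n0 hn0] := gibbs_event_lower (O := B°) (@open_interior _ B) e0 Df Ffoo.
    by rewrite -xE.
  move: hr2; rewrite ltNge => /negP; apply; apply: (limn_einf_ge (n0 := n0)) => n /hn0.
  rewrite -PE; last by apply: open_measurable; exact: open_interior.
  rewrite (_ : fine (FE f) - i0 + _ = r)%R; last by ring.
  move=> hn; apply: log_lower; apply: (le_trans hn); apply: Pmono => //.
    by apply: open_measurable; exact: open_interior.
  exact: interior_subset.
- exact: limn_einf_sup.
have cB : measurable (closure B) by apply: closed_measurable; exact: closed_closure.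
rewrite leNgt; apply/negP => h.
have [r hr1 hr2] : exists2 r : R, r%:E < ereal_inf (J @` closure B) & (- r)%:E < limn_esup u.
  have [r /andP[r1 r2]] := lte_between h.
  by exists (- r)%R; rewrite ?opprK// EFinN lteNl.
(* The margin [r' - r] is the tolerance of the upper bound, whose exponent is then exactly [r]. *)
have [r' rr' hr'] : exists2 r' : R, (r < r')%R & r'%:E <= ereal_inf (J @` closure B).
  by have [r' /andP[]] := lte_between hr1; exists r' => //; exact: ltW.
have e0 : (0 < r' - r)%R by rewrite subr_gt0.
have [|n0 hn0] := gibbs_event_upper (C := closure B) (theta := r' + i0)
    (@closed_closure _ B) e0.
  move=> f Df Cf; have [Ff|] := ltP (FE f) +oo; last by rewrite leye_eq => /eqP ->; rewrite leey.
  have : r'%:E <= FE f - i0%:E.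
    apply: le_trans (norm_rate_le Df Ff); apply: (le_trans hr').
    by apply: ereal_inf_lbound; eexists; [exact: Cf|].
  by rewrite leeBrDr// EFinD.
move: hr2; rewrite ltNge => /negP; apply; apply: (limn_esup_le (n0 := n0)) => n /hn0.
rewrite -PE//.
rewrite (_ : r' + i0 - i0 - _ = r)%R; last by ring.
move=> hn; apply: log_upper; first exact: measure_ge0.
by apply: le_trans hn; apply: Pmono => //; exact: subset_closure.
Qed.

End gibbs_ldp.

Theorem proposition3p18 (R : realType)
    (l : {sigma_finite_measure set R -> \bar R}) (l_na : non_atomic l)
    (F : {mfun R >-> \bar R}) (G : {mfun (R * R)%type >-> \bar R})
    (F_gtNy : forall x, -oo < F x) (G_gtNy : forall z, -oo < G z)
    (F_lsc : @lower_semicontinuous (subspace [set x : R | F x < +oo]) R F)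
    (G_lsc : @lower_semicontinuous (subspace [set z : R * R | G z < +oo]) R G)
    (a c : R) (a_ge0 : (0 <= a)%R) (a_lt1 : (a < 1)%R)
    (F_int : \int[l]_x expeR (- ((1 - a)%:E * F x)) < +oo)
    (F_inf : c%:E < ereal_inf (range F))
    (G_inf : c%:E <
      ereal_inf (range (fun z : R * R => G z + a%:E * (F z.1 + F z.2))))
    (A_int : exists A : set R, [/\ measurable A, 0 < l A &
      \int[l \x l]_(z in A `*` A) (F z.1 + F z.2 + G z) < +oo])
    (exp_int : forall lam : R,
      \int[l \x l]_z expeR ((lam * (z.1 ^+ 2 + z.2 ^+ 2))%:E
                            - F z.1 - F z.2 - G z) < +oo) :
  (forall n, 0 < partition_function l F G n.+1 < +oo) /\
  forall (d : nat -> measure_display)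
    (Omega : forall n, measurableType (d n))
    (P : forall n, probability (Omega n) R)
    (X : forall n, {RV (P n) >-> (n.+1.-tuple R)}),
    (forall n (B : set (n.+1.-tuple R)), measurable B ->
      distribution (P n) (X n) B = gibbs l F G B) ->
    ldp P (fun n w => scaled_norm (X n w)) (fun n => n.+1%:R)
      (norm_rate l F G a) /\
    good_rate (norm_rate l F G a).
Proof.
split=> [n|d Omega P X XG]; first exact: (partition_function_bounds F_gtNy G_gtNy a_ge0 a_lt1 F_int F_inf G_inf A_int exp_int).
split; first exact: (gibbs_ldp F_gtNy G_gtNy a_ge0 a_lt1 F_int F_inf G_inf A_int exp_int XG).
exact: (norm_rate_good F_gtNy G_gtNy a_lt1 F_int F_inf G_inf A_int exp_int).
Qed.
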